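(* Let $c,a:\mathbb{R}\to\mathbb{R}$ be smooth functions such that $c^{(l)}$ and $a^{(l)}$ are bounded on $\mathbb{R}$ for $l=1,2,3$, and $|c'(z)|\ge m_0$, $|a(z)|\ge m_0$ for all $z\in\mathbb{R}$, for some constant $m_0>0$. Let $\varphi_1\in\mathbb{R}$ be a constant with $c(\varphi_1)=0$, and let $\varphi_2,\psi_1,\psi_2:\mathbb{R}\to\mathbb{R}$ be smooth functions such that $\varphi_2^{(j)}$ ($j=1,\dots,4$) and $\psi_1^{(k)},\psi_2^{(k)}$ ($k=0,1,2,3$) are bounded on $\mathbb{R}$, and $|\psi_1(x)|\ge \psi_0$ for all $x\in\mathbb{R}$, for some constant $\psi_0>0$. Then there exist constants $\lambda_0>0$ and $\delta>0$ such that for every $\lambda\in\mathbb{R}$ with $|\lambda|\le\lambda_0$, the degenerate Cauchy problem consisting of the system \[ \begin{aligned} R_{1t}-cR_{1x}&=\tfrac{c'(R_1+S_1)}{4}\tfrac{R_1-S_1}{c}+\lambda aa'\tfrac{R_2-S_2}{c}-\tfrac{a^2c'}{4}\tfrac{(R_2-S_2)^2}{c}+aa'R_2S_2,\\ S_{1t}+cS_{1x}&=\tfrac{c'(R_1+S_1)}{4}\tfrac{S_1-R_1}{c}+\lambda aa'\tfrac{R_2-S_2}{c}-\tfrac{a^2c'}{4}\tfrac{(R_2-S_2)^2}{c}+aa'R_2S_2,\\ R_{2t}-cR_{2x}&=\tfrac{c'R_1}{2}\tfrac{R_2-S_2}{c}-\tfrac{\lambda a'}{a}\tfrac{R_1-S_1}{c}-\tfrac{a'}{a}(R_1S_2+S_1R_2),\\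 S_{2t}+cS_{2x}&=\tfrac{c'S_1}{2}\tfrac{S_2-R_2}{c}-\tfrac{\lambda a'}{a}\tfrac{R_1-S_1}{c}-\tfrac{a'}{a}(R_1S_2+S_1R_2),\\ u_t&=\tfrac{R_1+S_1}{2},\qquad v_t=\tfrac{R_2+S_2}{2}, \end{aligned} \] (where $c,c',a,a'$ are evaluated at $u$) together with the initial conditions, for all $x\in\mathbb{R}$, \[ R_1(0,x)=S_1(0,x)=\psi_1(x),\quad R_2(0,x)=S_2(0,x)=\psi_2(x), \] \[ R_{1t}(0,x)=S_{1t}(0,x)=f_{11}(x),\quad R_{2t}(0,x)=f_{21}(x),\quad S_{2t}(0,x)=f_{22}(x), \] \[ u(0,x)=\varphi_1,\ u_t(0,x)=\psi_1(x),\ v(0,x)=\varphi_2(x),\ v_t(0,x)=\psi_2(x), \] has a classical solution $(R_1,S_1,R_2,S_2,u,v)$ on $[0,\delta]\times\mathbb{R}$.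
   Context: Here $f_{11}(x)=a(\varphi_1)a'(\varphi_1)\psi_2^2(x)+2\lambda a(\varphi_1)a'(\varphi_1)\varphi_2'(x)$, $f_{21}(x)=c'(\varphi_1)\psi_1(x)\varphi_2'(x)-\frac{2a'(\varphi_1)}{a(\varphi_1)}\psi_1(x)\psi_2(x)$, $f_{22}(x)=-c'(\varphi_1)\psi_1(x)\varphi_2'(x)-\frac{2a'(\varphi_1)}{a(\varphi_1)}\psi_1(x)\psi_2(x)$. The system is obtained from the variational wave system below by setting $R_1=u_t+c(u)u_x$, $S_1=u_t-c(u)u_x$, $R_2=v_t+c(u)v_x$, $S_2=v_t-c(u)v_x$. Since $c(u(0,x))=c(\varphi_1)=0$, the system is parabolically degenerate on the initial line $t=0$ (its coefficients contain $1/c$). A classical solution means continuously differentiable functions on $[0,\delta]\times\mathbb{R}$ satisfying the equations (where $c(u)\ne0$, i.e. for $t>0$) and the initial conditions. *)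

(* Defs.v *)
From Stdlib Require Import Reals Lra.
Open Scope R_scope.

(* D is the sequence of all derivatives of f: D 0 = f, D (n+1) = (D n)'.
   Existence of such D is exactly "f is C^infinity (smooth)"; D n is f^(n). *)
Definition smooth_with (f : R -> R) (D : nat -> R -> R) : Prop :=
  (forall x, D 0%nat x = f x) /\
  (forall (n : nat) (x : R), derivable_pt_lim (D n) x (D (S n) x)).

Definition bounded_fun (f : R -> R) : Prop :=
  exists M : R, forall x : R, Rabs (f x) <= M.

Definition cont_strip (delta : R) (G : R -> R -> R) : Prop :=
  forall t x, 0 <= t <= delta ->
  forall eps, 0 < eps -> exists d, 0 < d /\
    forall t' x', 0 <= t' <= delta -> Rabs (t' - t) < d -> Rabs (x' - x) < d ->
      Rabs (G t' x' - G t x) < eps.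

(* Ft is the partial t-derivative of F on the strip (one-sided at t=0, t=delta). *)
Definition pderiv_t (delta : R) (F Ft : R -> R -> R) : Prop :=
  forall t x, 0 <= t <= delta ->
  forall eps, 0 < eps -> exists d, 0 < d /\
    forall h, h <> 0 -> Rabs h < d -> 0 <= t + h <= delta ->
      Rabs ((F (t + h) x - F t x) / h - Ft t x) < eps.

Definition pderiv_x (delta : R) (F Fx : R -> R -> R) : Prop :=
  forall t x, 0 <= t <= delta -> derivable_pt_lim (fun y => F t y) x (Fx t x).

Definition C1_strip (delta : R) (F Ft Fx : R -> R -> R) : Prop :=
  cont_strip delta F /\ pderiv_t delta F Ft /\ pderiv_x delta F Fx /\
  cont_strip delta Ft /\ cont_strip delta Fx.

(* The functions f11, f21, f22 of the paper; Dc, Da, Dphi2 are the derivative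
   sequences of c, a, phi2. *)
Definition f11 (Da Dphi2 : nat -> R -> R) (phi1 lambda : R) (psi2 : R -> R) (x : R) : R :=
  Da 0%nat phi1 * Da 1%nat phi1 * (psi2 x) ^ 2
  + 2 * lambda * Da 0%nat phi1 * Da 1%nat phi1 * Dphi2 1%nat x.

Definition f21 (Dc Da Dphi2 : nat -> R -> R) (phi1 : R) (psi1 psi2 : R -> R) (x : R) : R :=
  Dc 1%nat phi1 * psi1 x * Dphi2 1%nat x
  - 2 * Da 1%nat phi1 / Da 0%nat phi1 * psi1 x * psi2 x.

Definition f22 (Dc Da Dphi2 : nat -> R -> R) (phi1 : R) (psi1 psi2 : R -> R) (x : R) : R :=
  - (Dc 1%nat phi1 * psi1 x * Dphi2 1%nat x)
  - 2 * Da 1%nat phi1 / Da 0%nat phi1 * psi1 x * psi2 x.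

Definition classical_solution (c a : R -> R) (Dc Da Dphi2 : nat -> R -> R)
  (phi1 : R) (phi2 psi1 psi2 : R -> R) (lambda delta : R) : Prop :=
  exists (R1 S1 R2 S2 u v R1t R1x S1t S1x R2t R2x S2t S2x ut ux vt vx : R -> R -> R),
    C1_strip delta R1 R1t R1x /\ C1_strip delta S1 S1t S1x /\
    C1_strip delta R2 R2t R2x /\ C1_strip delta S2 S2t S2x /\
    C1_strip delta u ut ux /\ C1_strip delta v vt vx /\
    (forall t x, 0 < t <= delta ->
      let C := c (u t x) in let C' := Dc 1%nat (u t x) in
      let A := a (u t x) in let A' := Da 1%nat (u t x) in
      let r1 := R1 t x in let s1 := S1 t x in
      let r2 := R2 t x in let s2 := S2 t x in
      R1t t x - C * R1x t x =
        C' * (r1 + s1) / 4 * ((r1 - s1) / C) + lambda * A * A' * ((r2 - s2) / C)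
        - A ^ 2 * C' / 4 * ((r2 - s2) ^ 2 / C) + A * A' * r2 * s2 /\
      S1t t x + C * S1x t x =
        C' * (r1 + s1) / 4 * ((s1 - r1) / C) + lambda * A * A' * ((r2 - s2) / C)
        - A ^ 2 * C' / 4 * ((r2 - s2) ^ 2 / C) + A * A' * r2 * s2 /\
      R2t t x - C * R2x t x =
        C' * r1 / 2 * ((r2 - s2) / C) - lambda * A' / A * ((r1 - s1) / C)
        - A' / A * (r1 * s2 + s1 * r2) /\
      S2t t x + C * S2x t x =
        C' * s1 / 2 * ((s2 - r2) / C) - lambda * A' / A * ((r1 - s1) / C)
        - A' / A * (r1 * s2 + s1 * r2) /\
      ut t x = (r1 + s1) / 2 /\
      vt t x = (r2 + s2) / 2) /\
    (forall x,
      R1 0 x = psi1 x /\ S1 0 x = psi1 x /\ R2 0 x = psi2 x /\ S2 0 x = psi2 x /\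
      R1t 0 x = f11 Da Dphi2 phi1 lambda psi2 x /\
      S1t 0 x = f11 Da Dphi2 phi1 lambda psi2 x /\
      R2t 0 x = f21 Dc Da Dphi2 phi1 psi1 psi2 x /\
      S2t 0 x = f22 Dc Da Dphi2 phi1 psi1 psi2 x /\
      u 0 x = phi1 /\ ut 0 x = psi1 x /\ v 0 x = phi2 x /\ vt 0 x = psi2 x).

(* Main.v *)
Require Import Defs.
From Stdlib Require Import Reals Lra Lia ZArith ClassicalEpsilon.
From mathcomp Require ssrnat classical_sets filter.
Open Scope R_scope.

(** Since c(u) = c'(phi1) psi1 t + O(t^2), the ratio t c'(u) R1 / c(u) is 1 + O(t), so that the singular sources
    act on the remainders rho = R - psi - t f like rho' = (1 + O(t + lambda)) (rho - sigma) / (2t) + O(t). In sup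
    norm this is rho' <= (theta / t) rho + K t with theta close to 1 < 2, which preserves a bound rho <= M t^2; as
    the coefficient expansions hold together with two x-derivatives, so does the bound.

    Solutions are built by the semi-Lagrangian scheme R_{k+1}(x) = R_k(x + h c(u_k(x))) + h Phi_k(x), whose iterates
    are compositions of C^2 functions satisfying the above bounds uniformly in h (jets of order two form a ring with
    a submultiplicative norm). The iterates and their x-derivatives are uniformly Lipschitz, so their pointwise
    limits along a free ultrafilter on the steps h = 1/(n+1) satisfy the limiting inequalities, which say that
    the limit is C^1 and solves the system. *)

(** * Second-order jets *)

(** Inserting M t^2 into the remainder inequality asks for theta M + K <= 2 M, so a theta below 2 is
    absorbed by a large M. It is near 1 because only half-differences (rho - sigma) / 2 meet the
    factor 1 / t, and averaging two remainders does not increase their bound. The terms in lambda /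
    c couple the two pairs and add O(lambda) to theta: here the smallness of lambda is spent. The
    constants must not be chosen in a circle, as M depends on K. Hence K is obtained under the
    weaker bound rho <= t, free of M, and the remainder of u has its own constant, so that c(u) is
    bounded below by a multiple of t before M is known; M t <= 1 is secured last, through delta.
    Composition with x + h c(u) loses no derivative: the shift is O(h t) together with its two
    derivatives and multiplies norms by 1 + O(h t). Bounded second derivatives make the first ones
    Lipschitz, which a C^1 limit needs; one further derivative of the data measures how far the
    shift moves the profile psi + t f. *)

Record jet := Jet { j0 : R; j1 : R; j2 : R }.

Lemma jet_ext (a b : jet) : j0 a = j0 b -> j1 a = j1 b -> j2 a = j2 b -> a = b.
Proof. destruct a, b; simpl; intros; subst; reflexivity. Qed.

Definition jcst (r : R) : jet := Jet r 0 0.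
Definition jadd (a b : jet) : jet := Jet (j0 a + j0 b) (j1 a + j1 b) (j2 a + j2 b).
Definition jopp (a : jet) : jet := Jet (- j0 a) (- j1 a) (- j2 a).
Definition jsub (a b : jet) : jet := jadd a (jopp b).
Definition jmul (a b : jet) : jet :=
  Jet (j0 a * j0 b) (j1 a * j0 b + j0 a * j1 b)
      (j2 a * j0 b + 2 * (j1 a * j1 b) + j0 a * j2 b).
Definition jinv (a : jet) : jet :=
  Jet (/ j0 a) (- j1 a * (/ j0 a * / j0 a))
      (2 * (j1 a * j1 a) * (/ j0 a * / j0 a * / j0 a) - j2 a * (/ j0 a * / j0 a)).
Definition jcomp (D : nat -> R -> R) (n : nat) (a : jet) : jet :=
  Jet (D n (j0 a)) (D (S n) (j0 a) * j1 a)
      (D (S (S n)) (j0 a) * (j1 a * j1 a) + D (S n) (j0 a) * j2 a).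

Declare Scope jet_scope.
Delimit Scope jet_scope with J.
Bind Scope jet_scope with jet.
Infix "+" := jadd : jet_scope.
Infix "*" := jmul : jet_scope.
Infix "-" := jsub : jet_scope.
Notation "- a" := (jopp a) : jet_scope.
Notation "0" := (jcst 0) : jet_scope.
Notation "1" := (jcst 1) : jet_scope.

Lemma jet_ring_theory : ring_theory 0%J 1%J jadd jmul jsub jopp eq.
Proof. constructor; intros; try reflexivity; apply jet_ext; simpl; ring. Qed.
Add Ring jet_ring : jet_ring_theory.

Lemma jcst_mul (r s : R) : jcst (r * s) = (jcst r * jcst s)%J.
Proof. apply jet_ext; simpl; ring. Qed.

Lemma jcst_add (r s : R) : jcst (r + s) = (jcst r + jcst s)%J.
Proof. apply jet_ext; simpl; ring. Qed.

Lemma jmul_inv (a : jet) : j0 a <> 0 -> (a * jinv a = 1)%J.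
Proof. intros H; apply jet_ext; simpl; field; exact H. Qed.

(** The l^1 norm of the Taylor coefficients [j0], [j1], [j2 / 2]. Jets multiply like polynomials
    truncated at degree two, and this weight makes the norm submultiplicative. *)
Definition nj (a : jet) : R := Rabs (j0 a) + Rabs (j1 a) + Rabs (j2 a) / 2.

Lemma nj_pos (a : jet) : 0 <= nj a.
Proof.
  unfold nj. pose proof (Rabs_pos (j0 a)). pose proof (Rabs_pos (j1 a)).
  pose proof (Rabs_pos (j2 a)). lra.
Qed.

Lemma nj_j0 (a : jet) : Rabs (j0 a) <= nj a.
Proof. unfold nj. pose proof (Rabs_pos (j1 a)). pose proof (Rabs_pos (j2 a)). lra. Qed.

Lemma nj_j1 (a : jet) : Rabs (j1 a) <= nj a.
Proof. unfold nj. pose proof (Rabs_pos (j0 a)). pose proof (Rabs_pos (j2 a)). lra. Qed.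

Lemma nj_j2 (a : jet) : Rabs (j2 a) <= 2 * nj a.
Proof. unfold nj. pose proof (Rabs_pos (j0 a)). pose proof (Rabs_pos (j1 a)). lra. Qed.

Lemma nj_cst (r : R) : nj (jcst r) = Rabs r.
Proof. unfold nj; simpl. rewrite Rabs_R0. lra. Qed.

Lemma nj_add (a b : jet) : nj (a + b) <= nj a + nj b.
Proof.
  unfold nj; simpl. pose proof (Rabs_triang (j0 a) (j0 b)).
  pose proof (Rabs_triang (j1 a) (j1 b)). pose proof (Rabs_triang (j2 a) (j2 b)). lra.
Qed.

Lemma nj_opp (a : jet) : nj (- a) = nj a.
Proof. unfold nj; simpl. rewrite !Rabs_Ropp. reflexivity. Qed.

Lemma nj_sub (a b : jet) : nj (a - b) <= nj a + nj b.
Proof. unfold jsub. pose proof (nj_add a (- b)). rewrite nj_opp in H. exact H. Qed.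

Lemma nj_mul (a b : jet) : nj (a * b) <= nj a * nj b.
Proof.
  unfold nj; simpl.
  pose proof (Rabs_triang (j1 a * j0 b) (j0 a * j1 b)) as H1.
  pose proof (Rabs_triang (j2 a * j0 b + 2 * (j1 a * j1 b)) (j0 a * j2 b)) as H2.
  pose proof (Rabs_triang (j2 a * j0 b) (2 * (j1 a * j1 b))) as H3.
  rewrite !Rabs_mult in *. rewrite (Rabs_pos_eq 2) in H3 by lra.
  pose proof (Rabs_pos (j0 a)); pose proof (Rabs_pos (j1 a)); pose proof (Rabs_pos (j2 a)).
  pose proof (Rabs_pos (j0 b)); pose proof (Rabs_pos (j1 b)); pose proof (Rabs_pos (j2 b)).
  set (a0 := Rabs (j0 a)) in *; set (a1 := Rabs (j1 a)) in *; set (a2 := Rabs (j2 a)) in *.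
  set (b0 := Rabs (j0 b)) in *; set (b1 := Rabs (j1 b)) in *; set (b2 := Rabs (j2 b)) in *.
  assert (0 <= a1 * b2) by (apply Rmult_le_pos; assumption).
  assert (0 <= a2 * b1) by (apply Rmult_le_pos; assumption).
  assert (0 <= a2 * b2) by (apply Rmult_le_pos; assumption).
  lra.
Qed.

Lemma nj_scal (r : R) (a : jet) : nj (jcst r * a) <= Rabs r * nj a.
Proof. rewrite <- (nj_cst r). apply nj_mul. Qed.

(** Each term of the bound is homogeneous of degree -1 in ([m], [N]). With both proportional to t,
    as happens for c(u), it is a constant over t, so t / c(u) stays bounded together with two
    derivatives. *)
Lemma nj_inv (a : jet) (m N : R) :
  0 < m -> m <= Rabs (j0 a) -> nj a <= N ->
  nj (jinv a) <= / m + 2 * (N * (/ m * / m)) + N * N * (/ m * / m * / m).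
Proof.
  intros Hm Ha HN.
  pose proof (nj_j1 a) as H1. pose proof (nj_j2 a) as H2. pose proof (nj_pos a) as Hp.
  unfold nj at 1; simpl.
  assert (Hi : Rabs (/ j0 a) <= / m) by (rewrite Rabs_inv; apply Rinv_le_contravar; assumption).
  assert (Hi0 := Rabs_pos (/ j0 a)).
  assert (Hm' : 0 < / m) by (apply Rinv_0_lt_compat; assumption).
  set (i := Rabs (/ j0 a)) in *.
  assert (E1 : Rabs (- j1 a * (/ j0 a * / j0 a)) <= N * (/ m * / m)).
  { rewrite !Rabs_mult, Rabs_Ropp. fold i. pose proof (Rabs_pos (j1 a)).
    apply Rmult_le_compat; try lra; [apply Rmult_le_pos; lra | apply Rmult_le_compat; lra]. }
  assert (E2 : Rabs (2 * (j1 a * j1 a) * (/ j0 a * / j0 a * / j0 a) - j2 a * (/ j0 a * / j0 a))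
     <= 2 * (N * N * (/ m * / m * / m)) + 2 * N * (/ m * / m)).
  { unfold Rminus. eapply Rle_trans; [apply Rabs_triang|]. rewrite Rabs_Ropp, !Rabs_mult. fold i.
    rewrite (Rabs_pos_eq 2) by lra. pose proof (Rabs_pos (j1 a)). pose proof (Rabs_pos (j2 a)).
    assert (i * i <= / m * / m) by (apply Rmult_le_compat; lra).
    assert (0 <= i * i) by (apply Rmult_le_pos; lra).
    apply Rplus_le_compat.
    - rewrite Rmult_assoc. apply Rmult_le_compat_l; [lra|].
      apply Rmult_le_compat; try (apply Rmult_le_pos; lra); apply Rmult_le_compat; lra.
    - apply Rmult_le_compat; lra. }
  lra.
Qed.

(** * Jets of functions, and composition with a shift *)

Definition C2 (F : R -> jet) : Prop :=
  forall x, derivable_pt_lim (fun y => j0 (F y)) x (j1 (F x)) /\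
            derivable_pt_lim (fun y => j1 (F y)) x (j2 (F x)).

Lemma derivable_pt_lim_eq (f g : R -> R) (x l l' : R) :
  derivable_pt_lim f x l -> (forall y, f y = g y) -> l = l' -> derivable_pt_lim g x l'.
Proof.
  intros H E <- eps He. destruct (H eps He) as [d Hd]. exists d. intros h h0 h1.
  rewrite <- !E. apply Hd; assumption.
Qed.

Lemma derivable_pt_lim_mul (f g : R -> R) (x l m : R) :
  derivable_pt_lim f x l -> derivable_pt_lim g x m ->
  derivable_pt_lim (fun y => f y * g y) x (l * g x + f x * m).
Proof. apply derivable_pt_lim_mult. Qed.

Lemma derivable_pt_lim_add (f g : R -> R) (x l m : R) :
  derivable_pt_lim f x l -> derivable_pt_lim g x m ->
  derivable_pt_lim (fun y => f y + g y) x (l + m).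
Proof. apply derivable_pt_lim_plus. Qed.

Lemma derivable_pt_lim_compose (f g : R -> R) (x l m : R) :
  derivable_pt_lim f x l -> derivable_pt_lim g (f x) m ->
  derivable_pt_lim (fun y => g (f y)) x (m * l).
Proof. apply derivable_pt_lim_comp. Qed.

Lemma derivable_pt_lim_inverse (f : R -> R) (x l : R) :
  derivable_pt_lim f x l -> f x <> 0 ->
  derivable_pt_lim (fun y => / f y) x (- l * (/ f x * / f x)).
Proof.
  intros H H0. eapply derivable_pt_lim_eq.
  - apply (derivable_pt_lim_div (fun _ => 1) f x 0 l); [apply derivable_pt_lim_const|exact H|exact H0].
  - intros y. unfold div_fct, Rdiv. ring.
  - unfold Rsqr. field. exact H0.
Qed.

Lemma C2_cst (r : R) : C2 (fun _ => jcst r).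
Proof. intros x; simpl; split; apply derivable_pt_lim_const. Qed.

Lemma C2_add (F G : R -> jet) : C2 F -> C2 G -> C2 (fun x => F x + G x)%J.
Proof.
  intros HF HG x; destruct (HF x), (HG x); simpl; split; apply derivable_pt_lim_add; assumption.
Qed.

Lemma C2_mul (F G : R -> jet) : C2 F -> C2 G -> C2 (fun x => F x * G x)%J.
Proof.
  intros HF HG x; destruct (HF x) as [f1 f2], (HG x) as [g1 g2]; simpl; split.
  - apply derivable_pt_lim_mul; assumption.
  - eapply derivable_pt_lim_eq.
    + apply derivable_pt_lim_add; apply derivable_pt_lim_mul; [exact f2|exact g1|exact f1|exact g2].
    + reflexivity.
    + simpl. ring.
Qed.

Lemma C2_opp (F : R -> jet) : C2 F -> C2 (fun x => - F x)%J.
Proof. intros HF x; destruct (HF x); simpl; split; apply derivable_pt_lim_opp; assumption. Qed.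

Lemma C2_sub (F G : R -> jet) : C2 F -> C2 G -> C2 (fun x => F x - G x)%J.
Proof. intros HF HG. apply C2_add; [exact HF | apply C2_opp; exact HG]. Qed.

Lemma C2_inv (F : R -> jet) : C2 F -> (forall x, j0 (F x) <> 0) -> C2 (fun x => jinv (F x)).
Proof.
  intros HF H0 x; destruct (HF x) as [f1 f2]; simpl.
  assert (I : derivable_pt_lim (fun y => / j0 (F y)) x (- j1 (F x) * (/ j0 (F x) * / j0 (F x))))
    by (apply derivable_pt_lim_inverse; [exact f1|apply H0]).
  split; [exact I|].
  eapply derivable_pt_lim_eq.
  - apply derivable_pt_lim_mul; [apply derivable_pt_lim_opp; exact f2|].
    apply derivable_pt_lim_mul; exact I.
  - reflexivity.
  - unfold opp_fct; simpl. field. apply H0.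
Qed.

Lemma C2_comp (D : nat -> R -> R) (n : nat) (F : R -> jet) :
  (forall (k : nat) x, derivable_pt_lim (D k) x (D (S k) x)) -> C2 F -> C2 (fun x => jcomp D n (F x)).
Proof.
  intros HD HF x; destruct (HF x) as [f1 f2]; simpl; split.
  - apply (derivable_pt_lim_compose (fun y => j0 (F y)) (D n)); [exact f1|apply HD].
  - eapply derivable_pt_lim_eq.
    + apply derivable_pt_lim_mul; [|exact f2].
      apply (derivable_pt_lim_compose (fun y => j0 (F y)) (D (S n))); [exact f1|apply HD].
    + reflexivity.
    + simpl. ring.
Qed.

Definition jof (D : nat -> R -> R) (n : nat) (x : R) : jet := Jet (D n x) (D (S n) x) (D (S (S n)) x).

Lemma C2_jof (D : nat -> R -> R) (n : nat) :
  (forall (k : nat) x, derivable_pt_lim (D k) x (D (S k) x)) -> C2 (jof D n).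
Proof. intros HD x; simpl; split; apply HD. Qed.

(* The jet at [x] of the composition of [F] with [y |-> y + b(y)]. *)
Definition shift (b F : R -> jet) (x : R) : jet :=
  let G := F (x + j0 (b x)) in
  Jet (j0 G) (j1 G * (1 + j1 (b x)))
      (j2 G * ((1 + j1 (b x)) * (1 + j1 (b x))) + j1 G * j2 (b x)).

Lemma C2_shift (b F : R -> jet) : C2 b -> C2 F -> C2 (shift b F).
Proof.
  intros Hb HF x; destruct (Hb x) as [b1 b2]; simpl.
  assert (I : derivable_pt_lim (fun y => y + j0 (b y)) x (1 + j1 (b x)))
    by (apply derivable_pt_lim_add; [apply derivable_pt_lim_id|exact b1]).
  destruct (HF (x + j0 (b x))) as [f1 f2]. split.
  - apply (derivable_pt_lim_compose (fun y => y + j0 (b y)) (fun y => j0 (F y))); assumption.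
  - eapply derivable_pt_lim_eq.
    + apply derivable_pt_lim_mul.
      * apply (derivable_pt_lim_compose (fun y => y + j0 (b y)) (fun y => j1 (F y))); eassumption.
      * apply derivable_pt_lim_add; [apply (derivable_pt_lim_const 1)|exact b2].
    + intros y. reflexivity.
    + unfold fct_cte; simpl. ring.
Qed.

Lemma shift_add (b F G : R -> jet) (x : R) :
  shift b (fun y => F y + G y)%J x = (shift b F x + shift b G x)%J.
Proof. apply jet_ext; simpl; ring. Qed.

Lemma shift_mul (b F G : R -> jet) (x : R) :
  shift b (fun y => F y * G y)%J x = (shift b F x * shift b G x)%J.
Proof. apply jet_ext; simpl; ring. Qed.

Lemma shift_cst (b : R -> jet) (r x : R) : shift b (fun _ => jcst r) x = jcst r.
Proof. apply jet_ext; simpl; ring. Qed.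

(** The chain rule brings the factors 1 + e and (1 + e)^2 <= 1 + 3 e and a term in [j2 (b x)]. The
    form 1 + 4 e, rather than a fixed constant, matters: the factor is paid at every time step, with
    e of order h. *)
Lemma nj_shift (b F : R -> jet) (x N e : R) :
  (forall y, nj (F y) <= N) -> nj (b x) <= e -> e <= 1 -> nj (shift b F x) <= N * (1 + 4 * e).
Proof.
  intros HF Hb He. unfold shift. set (G := F (x + j0 (b x))).
  assert (HG : nj G <= N) by apply HF.
  pose proof (nj_j1 (b x)) as B1. pose proof (nj_j2 (b x)) as B2. pose proof (nj_pos (b x)) as B.
  assert (HG' := HG). unfold nj in HG'. unfold nj; simpl.
  assert (X : Rabs (1 + j1 (b x)) <= 1 + e).
  { eapply Rle_trans; [apply Rabs_triang|]. rewrite Rabs_R1. lra. }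
  assert (X2 : Rabs (1 + j1 (b x)) * Rabs (1 + j1 (b x)) <= 1 + 3 * e).
  { eapply Rle_trans; [apply Rmult_le_compat; [apply Rabs_pos|apply Rabs_pos|exact X|exact X]|].
    assert (e * e <= e * 1) by (apply Rmult_le_compat_l; lra). lra. }
  pose proof (Rabs_pos (j0 G)); pose proof (Rabs_pos (j1 G)); pose proof (Rabs_pos (j2 G)).
  pose proof (Rabs_triang (j2 G * ((1 + j1 (b x)) * (1 + j1 (b x)))) (j1 G * j2 (b x))) as T.
  rewrite !Rabs_mult in *.
  assert (Rabs (j1 G) * Rabs (1 + j1 (b x)) <= Rabs (j1 G) * (1 + e)) by (apply Rmult_le_compat_l; lra).
  assert (Rabs (j2 G) * (Rabs (1 + j1 (b x)) * Rabs (1 + j1 (b x))) <= Rabs (j2 G) * (1 + 3 * e))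
    by (apply Rmult_le_compat_l; lra).
  assert (Rabs (j1 G) * Rabs (j2 (b x)) <= Rabs (j1 G) * (2 * e)) by (apply Rmult_le_compat_l; lra).
  assert (0 <= Rabs (j0 G) * e) by (apply Rmult_le_pos; lra).
  assert (0 <= Rabs (j1 G) * e) by (apply Rmult_le_pos; lra).
  assert (0 <= Rabs (j2 G) * e) by (apply Rmult_le_pos; lra).
  assert ((Rabs (j0 G) + Rabs (j1 G) + Rabs (j2 G) / 2) * (1 + 4 * e) <= N * (1 + 4 * e))
    by (apply Rmult_le_compat_r; lra).
  lra.
Qed.

Lemma increment_bound (f g : R -> R) (B x d : R) :
  (forall y, derivable_pt_lim f y (g y)) -> (forall y, Rabs (g y) <= B) ->
  Rabs (f (x + d) - f x) <= B * Rabs d.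
Proof.
  intros Hf Hg.
  destruct (MVT_abs f g x (x + d)) as [c [Hc _]]; [intros c _; apply Hf|].
  rewrite Hc. replace (x + d - x) with d by ring.
  apply Rmult_le_compat_r; [apply Rabs_pos|apply Hg].
Qed.

(** The mean value theorem is used twice, on [f] minus its linear part at [x] and then on [g]; this
    gives [B] where the sharp constant is [B / 2]. *)
Lemma taylor_bound (f g k : R -> R) (B x d : R) :
  (forall y, derivable_pt_lim f y (g y)) -> (forall y, derivable_pt_lim g y (k y)) ->
  (forall y, Rabs (k y) <= B) ->
  Rabs (f (x + d) - f x - d * g x) <= B * (d * d).
Proof.
  intros Hf Hg Hk.
  assert (Hd : forall y, derivable_pt_lim (fun y => f y + (- g x) * y) y (g y + - g x)).
  { intros y. apply derivable_pt_lim_add; [apply Hf|].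
    eapply derivable_pt_lim_eq; [apply (derivable_pt_lim_scal id (- g x) y 1), derivable_pt_lim_id|reflexivity|ring]. }
  destruct (MVT_abs (fun y => f y + (- g x) * y) (fun y => g y + - g x) x (x + d)) as [c [Hc Hb]];
    [intros c _; apply Hd|].
  replace (f (x + d) - f x - d * g x) with (f (x + d) + - g x * (x + d) - (f x + - g x * x)) by ring.
  rewrite Hc. replace (x + d - x) with d by ring.
  assert (I : Rabs (g c + - g x) <= B * Rabs (c - x)).
  { replace c with (x + (c - x)) at 1 by ring. apply (increment_bound g k); assumption. }
  assert (J : Rabs (c - x) <= Rabs d).
  { unfold Rmin, Rmax in Hb. unfold Rabs. destruct (Rle_dec x (x + d)), (Rcase_abs (c - x)), (Rcase_abs d); lra. }
  replace (d * d) with (Rabs d * Rabs d) by (rewrite <- Rabs_mult; apply Rabs_pos_eq, Rle_0_sqr).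
  rewrite <- Rmult_assoc. apply Rmult_le_compat_r; [apply Rabs_pos|].
  eapply Rle_trans; [exact I|]. apply Rmult_le_compat_l; [|exact J].
  eapply Rle_trans; [apply Rabs_pos|apply (Hk 0)].
Qed.

(* Satisfied by bounded C^3 functions, and stable under products without a third-order Leibniz formula. *)
Definition shift_stable (F : R -> jet) (L : R) : Prop :=
  (forall x, nj (F x) <= L) /\
  forall (b : R -> jet) (x e : R), nj (b x) <= e -> e <= 1 -> nj (shift b F x - F x) <= L * e.

Lemma shift_stable_pos (F : R -> jet) (L : R) : shift_stable F L -> 0 <= L.
Proof. intros [H _]. eapply Rle_trans; [apply (nj_pos (F 0))|apply H]. Qed.

Lemma shift_stable_cst (r : R) : shift_stable (fun _ => jcst r) (Rabs r).
Proof.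
  split; [intros; rewrite nj_cst; lra|]. intros b x e Hb He. rewrite shift_cst.
  replace (jcst r - jcst r)%J with (jcst 0) by ring. rewrite nj_cst, Rabs_R0.
  apply Rmult_le_pos; [apply Rabs_pos|]. pose proof (nj_pos (b x)). lra.
Qed.

Lemma shift_stable_add (F G : R -> jet) (L M : R) :
  shift_stable F L -> shift_stable G M -> shift_stable (fun x => F x + G x)%J (L + M).
Proof.
  intros [F0 F1] [G0 G1]; split.
  - intros x. eapply Rle_trans; [apply nj_add|]. specialize (F0 x); specialize (G0 x); lra.
  - intros b x e Hb He. rewrite shift_add.
    replace (shift b F x + shift b G x - (F x + G x))%J with ((shift b F x - F x) + (shift b G x - G x))%J by ring.
    eapply Rle_trans; [apply nj_add|]. specialize (F1 b x e Hb He); specialize (G1 b x e Hb He); lra.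
Qed.

Lemma shift_stable_mul (F G : R -> jet) (L M : R) :
  shift_stable F L -> shift_stable G M -> shift_stable (fun x => F x * G x)%J (6 * (L * M)).
Proof.
  intros HF HG. pose proof (shift_stable_pos _ _ HF) as HL. pose proof (shift_stable_pos _ _ HG) as HM.
  destruct HF as [F0 F1], HG as [G0 G1].
  assert (0 <= L * M) by (apply Rmult_le_pos; assumption). split.
  - intros x. eapply Rle_trans; [apply nj_mul|].
    eapply Rle_trans; [apply Rmult_le_compat; [apply nj_pos|apply nj_pos|apply F0|apply G0]|]. lra.
  - intros b x e Hb He. rewrite shift_mul.
    replace (shift b F x * shift b G x - F x * G x)%J
      with ((shift b F x - F x) * shift b G x + F x * (shift b G x - G x))%J by ring.
    assert (0 <= e) by (pose proof (nj_pos (b x)); lra).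
    eapply Rle_trans; [apply nj_add|].
    (* The factor 5 is 1 + 4 e at e <= 1; the other half of the discrete Leibniz rule adds 1, whence
       the 6 of the statement. *)
    assert (X : nj ((shift b F x - F x) * shift b G x) <= (L * e) * (M * 5)).
    { eapply Rle_trans; [apply nj_mul|]. apply Rmult_le_compat; try apply nj_pos.
      - apply F1; assumption.
      - eapply Rle_trans; [apply nj_shift with (e := e); [apply G0|assumption|assumption]|].
        apply Rmult_le_compat_l; lra. }
    assert (Y : nj (F x * (shift b G x - G x)) <= L * (M * e)).
    { eapply Rle_trans; [apply nj_mul|]. apply Rmult_le_compat; try apply nj_pos; [apply F0|apply G1; assumption]. }
    lra.
Qed.

(** Comparing second derivatives at two points takes a third one. This is where three bounded
    derivatives of [psi1] and [psi2], and four of [phi2], which enters through its first derivative,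
    are used. *)
Lemma shift_stable_jof (D : nat -> R -> R) (n : nat) :
  (forall (k : nat) x, derivable_pt_lim (D k) x (D (S k) x)) ->
  (forall k : nat, (n <= k <= 3 + n)%nat -> bounded_fun (D k)) ->
  exists L, shift_stable (jof D n) L.
Proof.
  intros HD HB.
  destruct (HB n ltac:(lia)) as [B0 H0], (HB (S n) ltac:(lia)) as [B1 H1],
    (HB (S (S n)) ltac:(lia)) as [B2 H2], (HB (S (S (S n))) ltac:(lia)) as [B3 H3].
  assert (P0 : 0 <= B0) by (eapply Rle_trans; [apply Rabs_pos|apply (H0 0)]).
  assert (P1 : 0 <= B1) by (eapply Rle_trans; [apply Rabs_pos|apply (H1 0)]).
  assert (P2 : 0 <= B2) by (eapply Rle_trans; [apply Rabs_pos|apply (H2 0)]).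
  assert (P3 : 0 <= B3) by (eapply Rle_trans; [apply Rabs_pos|apply (H3 0)]).
  exists (B0 + 3 * B1 + 4 * B2 + B3). split.
  - intros x. unfold nj, jof; simpl. specialize (H0 x); specialize (H1 x); specialize (H2 x). lra.
  - intros b x e Hb He.
    pose proof (nj_j0 (b x)) as b0. pose proof (nj_j1 (b x)) as b1. pose proof (nj_j2 (b x)) as b2.
    pose proof (nj_pos (b x)) as bp.
    assert (I0 := increment_bound (D n) (D (S n)) B1 x (j0 (b x)) (HD n) H1).
    assert (I1 := increment_bound (D (S n)) (D (S (S n))) B2 x (j0 (b x)) (HD (S n)) H2).
    assert (I2 := increment_bound (D (S (S n))) (D (S (S (S n)))) B3 x (j0 (b x)) (HD (S (S n))) H3).
    unfold nj, shift, jof; simpl.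
    specialize (H1 (x + j0 (b x))). specialize (H2 (x + j0 (b x))).
    set (y := x + j0 (b x)) in *.
    assert (E1 : Rabs (D (S n) y * (1 + j1 (b x)) + - D (S n) x) <= B2 * e + B1 * e).
    { replace (D (S n) y * (1 + j1 (b x)) + - D (S n) x) with ((D (S n) y - D (S n) x) + D (S n) y * j1 (b x)) by ring.
      eapply Rle_trans; [apply Rabs_triang|]. rewrite Rabs_mult. apply Rplus_le_compat.
      - eapply Rle_trans; [exact I1|]. apply Rmult_le_compat_l; lra.
      - apply Rmult_le_compat; try apply Rabs_pos; lra. }
    assert (E2 : Rabs (D (S (S n)) y * ((1 + j1 (b x)) * (1 + j1 (b x))) + D (S n) y * j2 (b x) + - D (S (S n)) x)
       <= B3 * e + B2 * (3 * e) + B1 * (2 * e)).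
    { replace (D (S (S n)) y * ((1 + j1 (b x)) * (1 + j1 (b x))) + D (S n) y * j2 (b x) + - D (S (S n)) x)
        with ((D (S (S n)) y - D (S (S n)) x) + D (S (S n)) y * (2 * j1 (b x) + j1 (b x) * j1 (b x)) + D (S n) y * j2 (b x)) by ring.
      eapply Rle_trans; [apply Rabs_triang|]. apply Rplus_le_compat.
      eapply Rle_trans; [apply Rabs_triang|]. apply Rplus_le_compat.
      - eapply Rle_trans; [exact I2|]. apply Rmult_le_compat_l; lra.
      - rewrite Rabs_mult. apply Rmult_le_compat; try apply Rabs_pos; try lra.
        eapply Rle_trans; [apply Rabs_triang|]. rewrite !Rabs_mult, (Rabs_pos_eq 2) by lra.
        assert (Rabs (j1 (b x)) * Rabs (j1 (b x)) <= e * 1) by (apply Rmult_le_compat; try apply Rabs_pos; lra). lra.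
      - rewrite Rabs_mult. apply Rmult_le_compat; try apply Rabs_pos; lra. }
    assert (E0 : Rabs (D n y + - D n x) <= B1 * e).
    { eapply Rle_trans; [exact I0|]. apply Rmult_le_compat_l; lra. }
    assert (0 <= B0 * e) by (apply Rmult_le_pos; lra).
    assert (0 <= B1 * e) by (apply Rmult_le_pos; lra).
    assert (0 <= B2 * e) by (apply Rmult_le_pos; lra).
    assert (0 <= B3 * e) by (apply Rmult_le_pos; lra).
    lra.
Qed.

(** * Limits along filters and ultralimits *)

(** Filters on an arbitrary type, so that one calculus of limits serves the ultrafilter on step
    numbers and the neighbourhoods [near_time] and [near_strip]. *)
Record is_filter {T : Type} (F : (T -> Prop) -> Prop) : Prop := IsFilter {
  flt_all : forall P : T -> Prop, (forall x, P x) -> F P;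
  flt_and : forall P Q : T -> Prop, F P -> F Q -> F (fun x => P x /\ Q x);
  flt_imp : forall P Q : T -> Prop, (forall x, P x -> Q x) -> F P -> F Q }.

Record free_ultra (U : (nat -> Prop) -> Prop) : Prop := FreeUltra {
  fu_filter : is_filter U;
  fu_proper : ~ U (fun _ => False);
  fu_dec : forall P : nat -> Prop, U P \/ U (fun n => ~ P n);
  fu_free : forall N : nat, U (fun n => (N <= n)%nat) }.

Lemma free_ultra_exists : exists U, free_ultra U.
Proof.
  destruct (filter.ultraFilterLemma filter.eventually_filter) as [U [HU Hle]].
  exists U. pose proof (@filter.ultra_proper nat U HU) as HP. destruct HP as [HP0 HP].
  assert (Himp : forall P Q : nat -> Prop, (forall x, P x -> Q x) -> U P -> U Q).
  { intros P Q H HUP. exact (@filter.filterS nat U HP P Q H HUP). }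
  split; [split| | |].
  - intros P H. apply (Himp (@classical_sets.setT nat)); [intros; apply H|]. exact (@filter.filterT nat U HP).
  - intros P Q H1 H2. exact (@filter.filterI nat U HP P Q H1 H2).
  - exact Himp.
  - intros H. apply HP0. apply (Himp (fun _ => False)); [intros x []|exact H].
  - intros P. exact (@filter.in_ultra_setVsetC nat U P HU).
  - intros N. apply Hle. exists N; [exact I|]. intros n Hn. unfold classical_sets.mkset in Hn. revert Hn.
    destruct (@ssrnat.leP N n) as [H|H]; [intros _; exact H|discriminate].
Qed.

Definition tends {T : Type} (F : (T -> Prop) -> Prop) (f : T -> R) (l : R) : Prop :=
  forall eps, 0 < eps -> F (fun x => Rabs (f x - l) < eps).

Section Tends.
Context {T : Type} (F : (T -> Prop) -> Prop).
Hypothesis HF : is_filter F.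

Lemma tends_cst (l : R) : tends F (fun _ => l) l.
Proof. intros eps He. apply (flt_all _ HF). intros _. rewrite Rminus_diag, Rabs_R0. exact He. Qed.

Lemma tends_add (f g : T -> R) (l m : R) : tends F f l -> tends F g m -> tends F (fun x => f x + g x) (l + m).
Proof.
  intros Hf Hg eps He.
  eapply (flt_imp _ HF); [|apply (flt_and _ HF); [apply (Hf (eps / 2)); lra|apply (Hg (eps / 2)); lra]].
  cbv beta. intros x [h1 h2]. replace (f x + g x - (l + m)) with ((f x - l) + (g x - m)) by ring.
  eapply Rle_lt_trans; [apply Rabs_triang|]. lra.
Qed.

Lemma tends_comp (f : T -> R) (l : R) (g : R -> R) :
  continuity_pt g l -> tends F f l -> tends F (fun x => g (f x)) (g l).
Proof.
  intros Hg Hf eps He. destruct (Hg eps He) as [d [Hd H]].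
  eapply (flt_imp _ HF); [|apply (Hf d Hd)]. cbv beta. intros x Hx.
  destruct (Req_dec (f x) l) as [->|Hn].
  - rewrite Rminus_diag, Rabs_R0. exact He.
  - apply H. split; [split; [exact I|auto]|exact Hx].
Qed.

Lemma tends_opp (f : T -> R) (l : R) : tends F f l -> tends F (fun x => - f x) (- l).
Proof. apply (tends_comp f l Ropp). apply continuity_pt_opp. apply derivable_continuous_pt, derivable_pt_id. Qed.

Lemma tends_abs (f : T -> R) (l : R) : tends F f l -> tends F (fun x => Rabs (f x)) (Rabs l).
Proof. apply (tends_comp f l Rabs). apply Rcontinuity_abs. Qed.

Lemma tends_inv (f : T -> R) (l : R) : l <> 0 -> tends F f l -> tends F (fun x => / f x) (/ l).
Proof.
  intros Hl. apply (tends_comp f l Rinv). apply (continuity_pt_inv id l); [|exact Hl].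
  apply derivable_continuous_pt, derivable_pt_id.
Qed.

Lemma tends_derivable (D : nat -> R -> R) (k : nat) (f : T -> R) (l : R) :
  (forall (k : nat) x, derivable_pt_lim (D k) x (D (S k) x)) -> tends F f l -> tends F (fun x => D k (f x)) (D k l).
Proof. intros HD. apply (tends_comp f l (D k)). apply derivable_continuous_pt. exists (D (S k) l). apply HD. Qed.

Lemma tends_sqr (f : T -> R) (l : R) : tends F f l -> tends F (fun x => f x * f x) (l * l).
Proof.
  apply (tends_comp f l (fun y => y * y)).
  apply derivable_continuous_pt. exists (1 * l + l * 1).
  apply derivable_pt_lim_mul; apply derivable_pt_lim_id.
Qed.

Lemma tends_ext (f g : T -> R) (l m : R) : tends F f l -> (forall x, g x = f x) -> m = l -> tends F g m.
Proof. intros Hf E -> eps He. eapply (flt_imp _ HF); [|apply (Hf eps He)]. cbv beta; intros x. rewrite E. auto. Qed.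

(** Polarisation, f g = ((f + g)^2 - (f - g)^2) / 4, reduces products to sums and to composition
    with continuous functions of one variable. *)
Lemma tends_mul (f g : T -> R) (l m : R) : tends F f l -> tends F g m -> tends F (fun x => f x * g x) (l * m).
Proof.
  intros Hf Hg.
  assert (Q : forall (f : T -> R) l, tends F f l -> tends F (fun x => f x * / 4) (l * / 4)).
  { intros f0 l0 H0. apply (tends_comp f0 l0 (fun y => y * / 4)); [|exact H0].
    apply derivable_continuous_pt. exists (1 * / 4 + l0 * 0).
    apply (derivable_pt_lim_mul id (fun _ => / 4)); [apply derivable_pt_lim_id|apply derivable_pt_lim_const]. }
  eapply tends_ext; [apply Q, tends_add; [apply tends_sqr, (tends_add f g); eassumption|
    apply tends_opp, tends_sqr, (tends_add f); [exact Hf|apply tends_opp, Hg]]| |].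
  - intros x. simpl. field.
  - field.
Qed.

Lemma tends_le (f g : T -> R) (l m : R) :
  ~ F (fun _ => False) -> tends F f l -> tends F g m -> F (fun x => f x <= g x) -> l <= m.
Proof.
  intros HP Hf Hg Hle. apply Rnot_lt_le. intros Hlt. apply HP.
  eapply (flt_imp _ HF); [|apply (flt_and _ HF); [exact Hle|apply (flt_and _ HF);
    [apply (Hf ((l - m) / 2)); lra|apply (Hg ((l - m) / 2)); lra]]].
  cbv beta. intros x (h1 & h2 & h3). apply Rabs_def2 in h2, h3. lra.
Qed.

End Tends.

Section Ultralimit.
Variable U : (nat -> Prop) -> Prop.
Hypothesis HU : free_ultra U.

(** The limit l is the supremum of the levels y such that y <= f n for [U]-many n. Values below l -
    eps are excluded by minimality of the supremum, values above l + eps by [fu_dec], since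
    otherwise l + eps would itself be a level. *)
Lemma bounded_tends (f : nat -> R) (B : R) : (forall n, Rabs (f n) <= B) -> exists l, tends U f l.
Proof.
  intros HB. pose proof (fu_filter _ HU) as HF.
  assert (HB' : forall n, - B <= f n <= B) by (intros n; specialize (HB n); unfold Rabs in HB; destruct (Rcase_abs (f n)); lra).
  destruct (completeness (fun y => U (fun n => y <= f n))) as [l [Hub Hlub]].
  - exists B. intros y Hy. apply Rnot_lt_le. intros Hlt. apply (fu_proper _ HU).
    eapply (flt_imp _ HF); [|exact Hy]. cbv beta. intros n Hn. destruct (HB' n). lra.
  - exists (- B). apply (flt_all _ HF). intros n. apply HB'.
  - exists l. intros eps He.
    assert (H1 : U (fun n => l - eps < f n)).
    { apply NNPP. intros Hn. assert (l <= l - eps); [|lra]. apply Hlub. intros y Hy.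
      apply Rnot_lt_le. intros Hlt. apply Hn. eapply (flt_imp _ HF); [|exact Hy]. cbv beta. intros; lra. }
    assert (H2 : U (fun n => ~ (l + eps <= f n))).
    { destruct (fu_dec _ HU (fun n => l + eps <= f n)) as [H|H]; [|exact H]. specialize (Hub _ H). lra. }
    eapply (flt_imp _ HF); [|apply (flt_and _ HF); [exact H1|exact H2]]. cbv beta.
    intros n [h1 h2]. apply Rabs_def1; lra.
Qed.

Definition ulim (f : nat -> R) : R := epsilon (inhabits 0) (tends U f).

(** The centre [c] is there for v: [phi2] may be unbounded, so the iterates are uniformly close to a
    base profile but not uniformly bounded. *)
Lemma ulim_tends (f : nat -> R) (c B : R) : (forall n, Rabs (f n - c) <= B) -> tends U f (ulim f).
Proof.
  intros H. apply (epsilon_spec (inhabits 0) (tends U f)). apply (bounded_tends f (Rabs c + B)). intros n.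
  replace (f n) with (c + (f n - c)) by ring. eapply Rle_trans; [apply Rabs_triang|]. specialize (H n). lra.
Qed.

(** * Passing to the limit in a time discretisation *)

Definition hstep (n : nat) : R := / (INR n + 1).

Lemma hstep_pos (n : nat) : 0 < hstep n.
Proof. apply Rinv_0_lt_compat. pose proof (pos_INR n). lra. Qed.

Lemma hstep_tends : tends U hstep 0.
Proof.
  intros eps He. destruct (INR_unbounded (/ eps)) as [N HN].
  eapply (flt_imp _ (fu_filter _ HU)); [|apply (fu_free _ HU N)]. cbv beta. intros n Hn.
  rewrite Rminus_0_r, Rabs_pos_eq by (left; apply hstep_pos). apply le_INR in Hn.
  unfold hstep. rewrite <- (Rinv_inv eps). apply Rinv_lt_contravar; [|lra].
  assert (0 < / eps) by (apply Rinv_0_lt_compat, He).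
  apply Rmult_lt_0_compat; lra.
Qed.

Lemma hstep_eventually (e : R) : 0 < e -> U (fun n => hstep n < e).
Proof.
  intros He. eapply (flt_imp _ (fu_filter _ HU)); [|apply (hstep_tends e He)]. cbv beta.
  intros n H. rewrite Rminus_0_r in H. apply Rabs_def2 in H. lra.
Qed.

Definition idx (n : nat) (t : R) : nat := Z.to_nat (Int_part (t * (INR n + 1))).

Lemma idx_spec (n : nat) (t : R) : 0 <= t -> INR (idx n t) * hstep n <= t < INR (idx n t) * hstep n + hstep n.
Proof.
  intros Ht. unfold idx. set (y := t * (INR n + 1)).
  assert (Hn : 0 < INR n + 1) by (pose proof (pos_INR n); lra).
  assert (Hy : 0 <= y) by (apply Rmult_le_pos; lra).
  destruct (base_Int_part y) as [h1 h2].
  assert (Hz : (0 <= Int_part y)%Z).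
  { assert (-1 < Int_part y)%Z; [|lia]. apply lt_IZR. lra. }
  rewrite INR_IZR_INZ, Z2Nat.id by exact Hz.
  assert (E : t = y * hstep n) by (unfold y, hstep; field; lra).
  pose proof (hstep_pos n) as Hh. set (m := IZR (Int_part y)) in *.
  split.
  - rewrite E. apply Rmult_le_compat_r; lra.
  - rewrite E. replace (m * hstep n + hstep n) with ((m + 1) * hstep n) by ring.
    apply Rmult_lt_compat_r; lra.
Qed.

Lemma idx_mul (n k : nat) : idx n (INR k * hstep n) = k.
Proof.
  pose proof (hstep_pos n) as Hh.
  assert (H0 : 0 <= INR k * hstep n) by (apply Rmult_le_pos; [apply pos_INR|lra]).
  destruct (idx_spec n _ H0) as [h1 h2]. set (j := idx n (INR k * hstep n)) in *.
  assert (INR j <= INR k) by (apply Rmult_le_reg_r with (hstep n); lra).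
  assert (INR k < INR j + 1) by (apply Rmult_lt_reg_r with (hstep n); lra).
  apply INR_le in H. rewrite <- S_INR in H1. apply INR_lt in H1. lia.
Qed.

Lemma idx_0 (n : nat) : idx n 0 = 0%nat.
Proof. transitivity (idx n (INR 0 * hstep n)); [f_equal; simpl; ring|apply idx_mul]. Qed.

Lemma idx_mono (n : nat) (s t : R) : 0 <= s -> s <= t -> (idx n s <= idx n t)%nat.
Proof.
  intros Hs Hst. destruct (idx_spec n s Hs) as [h1 _]. destruct (idx_spec n t ltac:(lra)) as [_ h2].
  pose proof (hstep_pos n).
  assert (INR (idx n s) < INR (idx n t) + 1) by (apply Rmult_lt_reg_r with (hstep n); lra).
  rewrite <- S_INR in H0. apply INR_lt in H0. lia.
Qed.

Variables (delta K : R) (Z : nat -> nat -> R -> jet) (G : nat -> nat -> R -> R) (z0 : R -> R).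
Hypothesis HK : 0 <= K.
Hypothesis ZC2 : forall n k, INR k * hstep n <= delta -> C2 (Z n k).
Hypothesis Z0b : forall n k x, INR k * hstep n <= delta -> Rabs (j0 (Z n k x) - z0 x) <= K.
Hypothesis Z1b : forall n k x, INR k * hstep n <= delta -> Rabs (j1 (Z n k x)) <= K.
Hypothesis Z2b : forall n k x, INR k * hstep n <= delta -> Rabs (j2 (Z n k x)) <= K.
Hypothesis Zs0 : forall n k x, INR (S k) * hstep n <= delta ->
  Rabs (j0 (Z n (S k) x) - j0 (Z n k x)) <= K * hstep n.
Hypothesis Zs1 : forall n k x, INR (S k) * hstep n <= delta ->
  Rabs (j1 (Z n (S k) x) - j1 (Z n k x)) <= K * hstep n.
(** Consistency is asked from the second step on: the first one starts on the degenerate line, where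
    [G] will be singular. *)
Hypothesis ZG : forall n k x, INR (S (S k)) * hstep n <= delta ->
  Rabs (j0 (Z n (S (S k)) x) - j0 (Z n (S k) x) - hstep n * G n (S k) x) <= K * (hstep n * hstep n).

Definition zn (n : nat) (t x : R) : R := j0 (Z n (idx n t) x).
Definition pn (n : nat) (t x : R) : R := j1 (Z n (idx n t) x).
Definition zlim (t x : R) : R := ulim (fun n => zn n t x).
Definition plim (t x : R) : R := ulim (fun n => pn n t x).

Lemma idx_le_delta (n : nat) (t : R) : 0 <= t <= delta -> INR (idx n t) * hstep n <= delta.
Proof. intros Ht. destruct (idx_spec n t ltac:(lra)). lra. Qed.

Lemma zlim_tends (t x : R) : 0 <= t <= delta -> tends U (fun n => zn n t x) (zlim t x).
Proof. intros Ht. apply (ulim_tends _ (z0 x) K). intros n. apply Z0b, idx_le_delta, Ht. Qed.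

Lemma plim_tends (t x : R) : 0 <= t <= delta -> tends U (fun n => pn n t x) (plim t x).
Proof. intros Ht. apply (ulim_tends _ 0 K). intros n. rewrite Rminus_0_r. apply Z1b, idx_le_delta, Ht. Qed.

Lemma telescope (n : nat) (f : nat -> R) (g c : R) (k m : nat) :
  (forall j, (k <= j < k + m)%nat -> Rabs (f (S j) - f j - hstep n * g) <= c) ->
  Rabs (f (k + m)%nat - f k - INR m * hstep n * g) <= INR m * c.
Proof.
  induction m as [|m IH]; intros H.
  - rewrite Nat.add_0_r. simpl. replace (f k - f k - 0 * hstep n * g) with 0 by ring. rewrite Rabs_R0. lra.
  - rewrite Nat.add_succ_r, S_INR.
    replace (f (S (k + m)) - f k - (INR m + 1) * hstep n * g)
      with ((f (S (k + m)) - f (k + m)%nat - hstep n * g) + (f (k + m)%nat - f k - INR m * hstep n * g)) by ring.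
    eapply Rle_trans; [apply Rabs_triang|].
    assert (h1 := H (k + m)%nat ltac:(lia)). assert (h2 := IH ltac:(intros; apply H; lia)). lra.
Qed.

(** The extra [hstep n] is the error of rounding [s] and [t] to the grid, since the iterates are
    step functions of time. *)
Lemma time_lipschitz (n : nat) (f : nat -> R) (s t : R) :
  (forall k, INR (S k) * hstep n <= delta -> Rabs (f (S k) - f k) <= K * hstep n) ->
  0 <= s -> s <= t -> t <= delta ->
  Rabs (f (idx n t) - f (idx n s)) <= K * (t - s + hstep n).
Proof.
  intros Hf Hs Hst Ht. pose proof (idx_mono n s t Hs Hst) as Hm.
  destruct (idx_spec n s Hs) as [s1 s2]. destruct (idx_spec n t ltac:(lra)) as [t1 t2].
  pose proof (hstep_pos n) as Hh.
  replace (idx n t) with (idx n s + (idx n t - idx n s))%nat by lia.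
  set (m := (idx n t - idx n s)%nat).
  assert (T : Rabs (f (idx n s + m)%nat - f (idx n s) - INR m * hstep n * 0) <= INR m * (K * hstep n)).
  { apply telescope. intros j Hj. rewrite Rmult_0_r, Rminus_0_r. apply Hf.
    apply Rle_trans with (INR (idx n t) * hstep n); [|lra]. apply Rmult_le_compat_r; [lra|]. apply le_INR. lia. }
  rewrite Rmult_0_r, Rminus_0_r in T. eapply Rle_trans; [exact T|].
  replace (INR m * (K * hstep n)) with (K * (INR m * hstep n)) by ring. apply Rmult_le_compat_l; [exact HK|].
  unfold m. rewrite minus_INR by exact Hm. lra.
Qed.

Lemma time_lipschitz_abs (n : nat) (f : nat -> R) (s t : R) :
  (forall k, INR (S k) * hstep n <= delta -> Rabs (f (S k) - f k) <= K * hstep n) ->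
  0 <= s <= delta -> 0 <= t <= delta ->
  Rabs (f (idx n t) - f (idx n s)) <= K * (Rabs (t - s) + hstep n).
Proof.
  intros Hf Hs Ht. destruct (Rle_dec s t) as [H|H].
  - rewrite (Rabs_pos_eq (t - s)) by lra. apply time_lipschitz; try assumption; lra.
  - rewrite Rabs_minus_sym, (Rabs_minus_sym t s), (Rabs_pos_eq (s - t)) by lra. apply time_lipschitz; try assumption; lra.
Qed.

Lemma zn_time (n : nat) (s t x : R) : 0 <= s <= delta -> 0 <= t <= delta ->
  Rabs (zn n t x - zn n s x) <= K * (Rabs (t - s) + hstep n).
Proof. intros Hs Ht. apply (time_lipschitz_abs n (fun k => j0 (Z n k x))); try assumption. intros; apply Zs0; assumption. Qed.

Lemma pn_time (n : nat) (s t x : R) : 0 <= s <= delta -> 0 <= t <= delta ->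
  Rabs (pn n t x - pn n s x) <= K * (Rabs (t - s) + hstep n).
Proof. intros Hs Ht. apply (time_lipschitz_abs n (fun k => j1 (Z n k x))); try assumption. intros; apply Zs1; assumption. Qed.

Lemma zn_space (n : nat) (t x y : R) : 0 <= t <= delta -> Rabs (zn n t y - zn n t x) <= K * Rabs (y - x).
Proof.
  intros Ht. pose proof (idx_le_delta n t Ht) as Hi. unfold zn.
  replace y with (x + (y - x)) at 1 by ring.
  apply (increment_bound (fun y => j0 (Z n (idx n t) y)) (fun y => j1 (Z n (idx n t) y))).
  - intros w. apply (ZC2 n _ Hi).
  - intros w. apply Z1b, Hi.
Qed.

Lemma pn_space (n : nat) (t x y : R) : 0 <= t <= delta -> Rabs (pn n t y - pn n t x) <= K * Rabs (y - x).
Proof.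
  intros Ht. pose proof (idx_le_delta n t Ht) as Hi. unfold pn.
  replace y with (x + (y - x)) at 1 by ring.
  apply (increment_bound (fun y => j1 (Z n (idx n t) y)) (fun y => j2 (Z n (idx n t) y))).
  - intros w. apply (ZC2 n _ Hi).
  - intros w. apply Z2b, Hi.
Qed.

(** The rounding error [hstep n] vanishes along [U], so the limit satisfies a genuine Lipschitz
    bound in both variables. *)
Lemma lipschitz_limit (w : nat -> R -> R -> R) (l : R -> R -> R) :
  (forall t x, 0 <= t <= delta -> tends U (fun n => w n t x) (l t x)) ->
  (forall n s t x, 0 <= s <= delta -> 0 <= t <= delta -> Rabs (w n t x - w n s x) <= K * (Rabs (t - s) + hstep n)) ->
  (forall n t x y, 0 <= t <= delta -> Rabs (w n t y - w n t x) <= K * Rabs (y - x)) ->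
  cont_strip delta l.
Proof.
  intros Hl Ht Hx t x Htd eps He.
  assert (L : forall t' x', 0 <= t' <= delta -> Rabs (l t' x' - l t x) <= K * (Rabs (t' - t) + 0) + K * Rabs (x' - x)).
  { intros t' x' Ht'. pose proof (fu_filter _ HU) as HF.
    eapply (tends_le U HF (fun n => Rabs (w n t' x' + - w n t x))
       (fun n => K * (Rabs (t' - t) + hstep n) + K * Rabs (x' - x))).
    - apply (fu_proper _ HU).
    - apply tends_abs; [exact HF|]. apply tends_add; [exact HF|apply Hl, Ht'|apply tends_opp; [exact HF|apply Hl, Htd]].
    - apply tends_add; [exact HF| |apply tends_cst, HF]. apply tends_mul; [exact HF|apply tends_cst, HF|].
      apply tends_add; [exact HF|apply tends_cst, HF|apply hstep_tends].
    - apply (flt_all _ HF). intros n.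
      replace (w n t' x' + - w n t x) with ((w n t' x - w n t x) + (w n t' x' - w n t' x)) by ring.
      eapply Rle_trans; [apply Rabs_triang|]. apply Rplus_le_compat; [apply Ht|apply Hx]; assumption. }
  exists (eps / (2 * (K + 1))). split; [apply Rdiv_lt_0_compat; lra|].
  intros t' x' Ht' h1 h2. eapply Rle_lt_trans; [apply L, Ht'|].
  set (d := eps / (2 * (K + 1))) in *.
  assert (E : (K + 1) * d = eps / 2) by (unfold d; field; lra).
  assert (0 < d) by (unfold d; apply Rdiv_lt_0_compat; lra).
  assert (K * (Rabs (t' - t) + 0) <= K * d) by (apply Rmult_le_compat_l; lra).
  assert (K * Rabs (x' - x) <= K * d) by (apply Rmult_le_compat_l; lra).
  lra.
Qed.

Lemma zlim_cont : cont_strip delta zlim.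
Proof. apply (lipschitz_limit zn); [apply zlim_tends|apply zn_time|apply zn_space]. Qed.

Lemma plim_cont : cont_strip delta plim.
Proof. apply (lipschitz_limit pn); [apply plim_tends|apply pn_time|apply pn_space]. Qed.

(** The Taylor inequality with remainder K d^2 holds for every iterate with the same K, and a closed
    inequality survives a pointwise limit. No uniform convergence of the derivatives is called
    for. *)
Lemma zlim_pderiv_x : pderiv_x delta zlim plim.
Proof.
  intros t x Ht eps He. pose proof (fu_filter _ HU) as HF.
  assert (L : forall d, Rabs (zlim t (x + d) - zlim t x - d * plim t x) <= K * (d * d)).
  { intros d.
    eapply (tends_le U HF (fun n => Rabs (zn n t (x + d) + - zn n t x + - (d * pn n t x))) (fun _ => K * (d * d))).
    - apply (fu_proper _ HU).
    - apply tends_abs; [exact HF|].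
      apply tends_add; [exact HF|apply tends_add; [exact HF|apply zlim_tends, Ht|apply tends_opp; [exact HF|apply zlim_tends, Ht]]|].
      apply tends_opp; [exact HF|]. apply tends_mul; [exact HF|apply tends_cst, HF|apply plim_tends, Ht].
    - apply tends_cst, HF.
    - apply (flt_all _ HF). intros n. pose proof (idx_le_delta n t Ht) as Hi.
      apply (taylor_bound (fun y => j0 (Z n (idx n t) y)) (fun y => j1 (Z n (idx n t) y)) (fun y => j2 (Z n (idx n t) y))).
      + intros w. apply (ZC2 n _ Hi).
      + intros w. apply (ZC2 n _ Hi).
      + intros w. apply Z2b, Hi. }
  assert (Hd : 0 < eps / (K + 1)) by (apply Rdiv_lt_0_compat; lra).
  exists (mkposreal _ Hd). simpl. intros h Hh0 Hh.
  replace ((zlim t (x + h) - zlim t x) / h - plim t x) with ((zlim t (x + h) - zlim t x - h * plim t x) / h) by (field; exact Hh0).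
  unfold Rdiv. rewrite Rabs_mult, Rabs_inv.
  assert (P : 0 < Rabs h) by (apply Rabs_pos_lt, Hh0).
  apply Rle_lt_trans with (K * (h * h) * / Rabs h).
  - apply Rmult_le_compat_r; [left; apply Rinv_0_lt_compat, P|apply L].
  - replace (h * h) with (Rabs h * Rabs h) by (rewrite <- Rabs_mult; apply Rabs_pos_eq, Rle_0_sqr).
    replace (K * (Rabs h * Rabs h) * / Rabs h) with (K * Rabs h) by (field; lra).
    assert (E : (K + 1) * (eps / (K + 1)) = eps) by (field; lra).
    assert (K * Rabs h <= K * (eps / (K + 1))) by (apply Rmult_le_compat_l; lra). lra.
Qed.

(* Joint neighbourhoods of an infinite step number and of the time [t]. *)
Definition near_time (t : R) (P : nat * R -> Prop) : Prop :=
  exists d, 0 < d /\ U (fun n => forall s, 0 <= s <= delta -> Rabs (s - t) < d -> P (n, s)).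

Lemma near_time_filter (t : R) : is_filter (near_time t).
Proof.
  pose proof (fu_filter _ HU) as HF. split.
  - intros P H. exists 1. split; [lra|]. apply (flt_all _ HF). intros; apply H.
  - intros P Q [d [Hd H1]] [e [He H2]]. exists (Rmin d e). split; [apply Rmin_glb_lt; assumption|].
    eapply (flt_imp _ HF); [|apply (flt_and _ HF); [exact H1|exact H2]]. cbv beta. intros n [h1 h2] s Hs Hsd.
    split; [apply h1|apply h2]; try assumption; eapply Rlt_le_trans; try exact Hsd; [apply Rmin_l|apply Rmin_r].
  - intros P Q HPQ [d [Hd H]]. exists d. split; [exact Hd|].
    eapply (flt_imp _ HF); [|exact H]. cbv beta. intros n h s Hs Hsd. apply HPQ, h; assumption.
Qed.

Lemma near_time_limit (w : nat -> R -> R) (t l : R) :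
  0 <= t <= delta ->
  (forall n s, 0 <= s <= delta -> Rabs (w n s - w n t) <= K * (Rabs (s - t) + hstep n)) ->
  tends U (fun n => w n t) l -> tends (near_time t) (fun q => w (fst q) (snd q)) l.
Proof.
  intros Ht Hw Hl eps He. pose proof (fu_filter _ HU) as HF.
  set (d := eps / (4 * (K + 1))).
  assert (Hd : 0 < d) by (apply Rdiv_lt_0_compat; lra).
  assert (E : (K + 1) * d = eps / 4) by (unfold d; field; lra).
  exists d. split; [exact Hd|].
  eapply (flt_imp _ HF); [|apply (flt_and _ HF); [apply (Hl (eps / 2)); lra|apply (hstep_eventually d Hd)]].
  cbv beta. intros n [h1 h2] s Hs Hsd. simpl.
  replace (w n s - l) with ((w n s - w n t) + (w n t - l)) by ring.
  eapply Rle_lt_trans; [apply Rabs_triang|].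
  pose proof (Hw n s Hs) as h3.
  assert (K * (Rabs (s - t) + hstep n) <= K * (2 * d)) by (apply Rmult_le_compat_l; lra). lra.
Qed.

Lemma zn_near (t x : R) : 0 <= t <= delta -> tends (near_time t) (fun q => zn (fst q) (snd q) x) (zlim t x).
Proof.
  intros Ht. apply (near_time_limit (fun n s => zn n s x)); [exact Ht|intros; apply zn_time; assumption|apply zlim_tends, Ht].
Qed.

Lemma pn_near (t x : R) : 0 <= t <= delta -> tends (near_time t) (fun q => pn (fst q) (snd q) x) (plim t x).
Proof.
  intros Ht. apply (near_time_limit (fun n s => pn n s x)); [exact Ht|intros; apply pn_time; assumption|apply plim_tends, Ht].
Qed.

(** A Riemann sum: the increment from [a] to [b] is a sum of steps h G, with G within eps of g
    throughout the window of radius d around t. *)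
Lemma increment_limit (t x g eps d a b : R) :
  0 < t <= delta -> 0 < eps -> 0 < d ->
  U (fun n => forall s, 0 <= s <= delta -> Rabs (s - t) < d -> Rabs (G n (idx n s) x - g) < eps) ->
  0 < a -> a <= b -> b <= delta -> t - d < a -> b < t + d ->
  Rabs (zlim b x - zlim a x - (b - a) * g) <= (b - a) * eps.
Proof.
  intros Ht He Hd HG Ha Hab Hb Had Hbd. pose proof (fu_filter _ HU) as HF.
  assert (Hh := hstep_tends).
  (* The steps have total length at most b - a + h and a relative error eps + K h; the last term
     corrects that length to b - a. *)
  eapply (tends_le U HF (fun n => Rabs (zn n b x + - zn n a x + - ((b - a) * g)))
    (fun n => (b - a + hstep n) * (eps + K * hstep n) + hstep n * Rabs g)).
  - apply (fu_proper _ HU).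
  - apply tends_abs; [exact HF|]. apply tends_add; [exact HF| |apply tends_cst, HF].
    apply tends_add; [exact HF|apply zlim_tends; lra|apply tends_opp; [exact HF|apply zlim_tends; lra]].
  - replace ((b - a) * eps) with ((b - a + 0) * (eps + K * 0) + 0 * Rabs g) by ring.
    repeat first [apply hstep_tends | apply (tends_cst U HF) | apply (tends_mul U HF (fun n => b - a + hstep n))
      | apply (tends_mul U HF (fun n => hstep n)) | apply (tends_mul U HF (fun n => K))
      | apply (tends_add U HF (fun n => (b - a + hstep n) * (eps + K * hstep n)))
      | apply (tends_add U HF (fun n => b - a)) | apply (tends_add U HF (fun n => eps))].
  (* A step below [a] makes the first index at least 1, where [ZG] applies; a step below a - (t - d)
     keeps the first grid time inside the window. *)
  - assert (Hr : 0 < Rmin a (a - (t - d))) by (apply Rmin_glb_lt; lra).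
    eapply (flt_imp _ HF); [|apply (flt_and _ HF); [exact HG|apply (hstep_eventually _ Hr)]].
    cbv beta. intros n [hG hh]. pose proof (hstep_pos n) as hp.
    assert (hh1 : hstep n < a) by (eapply Rlt_le_trans; [exact hh|apply Rmin_l]).
    assert (hh2 : hstep n < a - (t - d)) by (eapply Rlt_le_trans; [exact hh|apply Rmin_r]).
    destruct (idx_spec n a ltac:(lra)) as [a1 a2]. destruct (idx_spec n b ltac:(lra)) as [b1 b2].
    pose proof (idx_mono n a b ltac:(lra) Hab) as hm. unfold zn.
    set (k := idx n a) in *. set (l := idx n b) in *.
    assert (Hk : (1 <= k)%nat).
    { destruct k; [|lia]. simpl in a2. lra. }
    pose proof (telescope n (fun j => j0 (Z n j x)) g (hstep n * (eps + K * hstep n)) k (l - k)) as T.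
    replace (k + (l - k))%nat with l in T by lia.
    rewrite minus_INR in T by exact hm. set (L := INR l) in *. set (Q := INR k) in *.
    assert (T' : Rabs (j0 (Z n l x) - j0 (Z n k x) - (L - Q) * hstep n * g) <= (L - Q) * (hstep n * (eps + K * hstep n))).
    { apply T. intros j Hj. destruct j as [|j]; [lia|].
      assert (Hjl : INR (S (S j)) * hstep n <= L * hstep n) by (apply Rmult_le_compat_r; [lra|apply le_INR; lia]).
      assert (Hjk : Q * hstep n <= INR (S j) * hstep n) by (apply Rmult_le_compat_r; [lra|apply le_INR; lia]).
      rewrite (S_INR (S j)) in Hjl.
      pose proof (ZG n j x ltac:(rewrite (S_INR (S j)); lra)) as E1.
      pose proof (hG (INR (S j) * hstep n)) as E2. rewrite idx_mul in E2.
      assert (0 <= INR (S j) * hstep n) by (apply Rmult_le_pos; [apply pos_INR|lra]).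
      specialize (E2 ltac:(lra) ltac:(apply Rabs_def1; lra)).
      replace (j0 (Z n (S (S j)) x) - j0 (Z n (S j) x) - hstep n * g)
        with ((j0 (Z n (S (S j)) x) - j0 (Z n (S j) x) - hstep n * G n (S j) x) + hstep n * (G n (S j) x - g)) by ring.
      eapply Rle_trans; [apply Rabs_triang|]. rewrite Rabs_mult, (Rabs_pos_eq (hstep n)) by lra.
      assert (hstep n * Rabs (G n (S j) x - g) <= hstep n * eps) by (apply Rmult_le_compat_l; lra). lra. }
    replace (j0 (Z n l x) + - j0 (Z n k x) + - ((b - a) * g))
      with ((j0 (Z n l x) - j0 (Z n k x) - (L - Q) * hstep n * g) + ((L - Q) * hstep n - (b - a)) * g) by ring.
    eapply Rle_trans; [apply Rabs_triang|]. apply Rplus_le_compat.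
    + eapply Rle_trans; [exact T'|]. rewrite <- Rmult_assoc. apply Rmult_le_compat_r; [|lra].
      assert (0 <= K * hstep n) by (apply Rmult_le_pos; lra). lra.
    + rewrite Rabs_mult. apply Rmult_le_compat_r; [apply Rabs_pos|]. apply Rabs_le. lra.
Qed.

Lemma zlim_pderiv_t (t x g : R) :
  0 < t <= delta -> tends (near_time t) (fun q => G (fst q) (idx (fst q) (snd q)) x) g ->
  forall eps, 0 < eps -> exists d, 0 < d /\
    forall h, h <> 0 -> Rabs h < d -> 0 <= t + h <= delta ->
      Rabs ((zlim (t + h) x - zlim t x) / h - g) < eps.
Proof.
  intros Ht HG eps He. destruct (HG (eps / 2) ltac:(lra)) as [d [Hd HGd]]. simpl in HGd.
  (* Keeping |h| below t keeps t + h positive, as [increment_limit] requires. *)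
  exists (Rmin d t). split; [apply Rmin_glb_lt; lra|]. intros h Hh0 Hh Hth.
  assert (h1 : Rabs h < d) by (eapply Rlt_le_trans; [exact Hh|apply Rmin_l]).
  assert (h2 : Rabs h < t) by (eapply Rlt_le_trans; [exact Hh|apply Rmin_r]).
  apply Rabs_def2 in h1, h2.
  assert (E : Rabs (zlim (t + h) x - zlim t x - h * g) <= Rabs h * (eps / 2)).
  { destruct (Rle_dec 0 h) as [P|P].
    - rewrite (Rabs_pos_eq h) by exact P.
      replace h with (t + h - t) at 2 3 by ring. apply (increment_limit t x g (eps / 2) d); try assumption; lra.
    - rewrite (Rabs_left h) by lra.
      replace (zlim (t + h) x - zlim t x - h * g) with (- (zlim t x - zlim (t + h) x - (t - (t + h)) * g)) by ring.
      rewrite Rabs_Ropp. replace (- h) with (t - (t + h)) by ring.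
      apply (increment_limit t x g (eps / 2) d); try assumption; lra. }
  replace ((zlim (t + h) x - zlim t x) / h - g) with ((zlim (t + h) x - zlim t x - h * g) / h) by (field; exact Hh0).
  unfold Rdiv. rewrite Rabs_mult, Rabs_inv.
  assert (P : 0 < Rabs h) by (apply Rabs_pos_lt, Hh0).
  apply Rle_lt_trans with (Rabs h * (eps / 2) * / Rabs h).
  - apply Rmult_le_compat_r; [left; apply Rinv_0_lt_compat, P|exact E].
  - replace (Rabs h * (eps / 2) * / Rabs h) with (eps / 2) by (field; lra). lra.
Qed.

End Ultralimit.

(** * The source terms near the degenerate line *)

Section Sources.

Variables Dc Da Dphi2 Dpsi1 Dpsi2 : nat -> R -> R.
Variables m0 psi0 phi1 : R.

Definition jpsi1 (x : R) : jet := jof Dpsi1 0 x.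
Definition jpsi2 (x : R) : jet := jof Dpsi2 0 x.
Definition jdphi2 (x : R) : jet := jof Dphi2 1 x.
(** The slopes of R2 and S2 are k - w and - k - w. Thus [jk] is the skew part, with (R2 - S2) / 2 =
    t k to leading order, and [jw] is the shared part. *)
Definition jk (x : R) : jet := (jcst (Dc 1%nat phi1) * (jpsi1 x * jdphi2 x))%J.
Definition jw (x : R) : jet := (jcst (2 * Da 1%nat phi1 / Da 0%nat phi1) * (jpsi1 x * jpsi2 x))%J.
Definition jf11 (lam x : R) : jet :=
  (jcst (Da 0%nat phi1 * Da 1%nat phi1) * (jpsi2 x * jpsi2 x)
   + jcst (2 * lam * Da 0%nat phi1 * Da 1%nat phi1) * jdphi2 x)%J.
Definition jf21 (x : R) : jet := (jk x - jw x)%J.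
Definition jf22 (x : R) : jet := (- jk x - jw x)%J.

Definition half (a : jet) : jet := (jcst (/ 2) * a)%J.

Definition jc (u : jet) : jet := jcomp Dc 0 u.
Definition jc' (u : jet) : jet := jcomp Dc 1 u.
Definition ja (u : jet) : jet := jcomp Da 0 u.
Definition ja' (u : jet) : jet := jcomp Da 1 u.

(** In each pair the sources split into a singular skew part, entering R and S with opposite signs,
    and a shared part. Sums and differences are written as halves, which distributes the factors 1 /
    4 and 1 / 2 of the system. *)
Definition common1 (lam : R) (u r2 s2 : jet) : jet :=
  (jcst lam * ja u * ja' u * ((r2 - s2) * jinv (jc u))
   - ja u * ja u * jc' u * (half (r2 - s2) * half (r2 - s2) * jinv (jc u))
   + ja u * ja' u * r2 * s2)%J.
Definition skew1 (u r1 s1 : jet) : jet :=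
  (jc' u * half (r1 + s1) * (half (r1 - s1) * jinv (jc u)))%J.
Definition common2 (lam : R) (u r1 s1 r2 s2 : jet) : jet :=
  (- (jcst lam * (ja' u * jinv (ja u)) * ((r1 - s1) * jinv (jc u)))
   - ja' u * jinv (ja u) * (r1 * s2 + s1 * r2))%J.
Definition skew2 (u r1 r2 s2 : jet) : jet := (jc' u * r1 * (half (r2 - s2) * jinv (jc u)))%J.

Definition srcR1 lam u r1 s1 r2 s2 : jet := (skew1 u r1 s1 + common1 lam u r2 s2)%J.
Definition srcS1 lam u r1 s1 r2 s2 : jet := (- skew1 u r1 s1 + common1 lam u r2 s2)%J.
Definition srcR2 lam u r1 s1 r2 s2 : jet := (skew2 u r1 r2 s2 + common2 lam u r1 s1 r2 s2)%J.
Definition srcS2 lam u r1 s1 r2 s2 : jet := (- skew2 u s1 r2 s2 + common2 lam u r1 s1 r2 s2)%J.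

Hypothesis HDc : forall (k : nat) x, derivable_pt_lim (Dc k) x (Dc (S k) x).
Hypothesis HDa : forall (k : nat) x, derivable_pt_lim (Da k) x (Da (S k) x).
Hypothesis HDphi2 : forall (k : nat) x, derivable_pt_lim (Dphi2 k) x (Dphi2 (S k) x).
Hypothesis HDpsi1 : forall (k : nat) x, derivable_pt_lim (Dpsi1 k) x (Dpsi1 (S k) x).
Hypothesis HDpsi2 : forall (k : nat) x, derivable_pt_lim (Dpsi2 k) x (Dpsi2 (S k) x).
Hypothesis Hcb : forall l : nat, (1 <= l <= 3)%nat -> bounded_fun (Dc l).
Hypothesis Hab : forall l : nat, (1 <= l <= 3)%nat -> bounded_fun (Da l).
Hypothesis Hm0 : 0 < m0.
Hypothesis Hc1 : forall z, Rabs (Dc 1%nat z) >= m0.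
Hypothesis Ha0 : forall z, Rabs (Da 0%nat z) >= m0.
Hypothesis Hphi1 : Dc 0%nat phi1 = 0.
Hypothesis Hphi2b : forall j : nat, (1 <= j <= 4)%nat -> bounded_fun (Dphi2 j).
Hypothesis Hpsi1b : forall k : nat, (k <= 3)%nat -> bounded_fun (Dpsi1 k).
Hypothesis Hpsi2b : forall k : nat, (k <= 3)%nat -> bounded_fun (Dpsi2 k).
Hypothesis Hpsi0 : 0 < psi0.
Hypothesis Hpsi1low : forall x, Rabs (Dpsi1 0%nat x) >= psi0.

Lemma data_stable : exists A, 1 <= A /\ forall lam, Rabs lam <= 1 ->
  shift_stable jpsi1 A /\ shift_stable jpsi2 A /\ shift_stable jdphi2 A /\
  shift_stable (jf11 lam) A /\ shift_stable jf21 A /\ shift_stable jf22 A.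
Proof.
  destruct (shift_stable_jof Dpsi1 0 HDpsi1) as [L1 H1]; [intros; apply Hpsi1b; lia|].
  destruct (shift_stable_jof Dpsi2 0 HDpsi2) as [L2 H2]; [intros; apply Hpsi2b; lia|].
  destruct (shift_stable_jof Dphi2 1 HDphi2) as [L3 H3]; [intros; apply Hphi2b; lia|].
  assert (W : forall F L M, shift_stable F L -> L <= M -> shift_stable F M).
  { intros F L M [F0 F1] HLM. split.
    - intros x. eapply Rle_trans; [apply F0|exact HLM].
    - intros b x e Hb He. eapply Rle_trans; [apply F1; eassumption|].
      apply Rmult_le_compat_r; [|exact HLM]. pose proof (nj_pos (b x)). lra. }
  assert (Hk := shift_stable_mul _ _ _ _ (shift_stable_cst (Dc 1%nat phi1)) (shift_stable_mul _ _ _ _ H1 H3)).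
  assert (Hw := shift_stable_mul _ _ _ _ (shift_stable_cst (2 * Da 1%nat phi1 / Da 0%nat phi1)) (shift_stable_mul _ _ _ _ H1 H2)).
  assert (Hn : forall F L, shift_stable F L -> shift_stable (fun x => - F x)%J L).
  { intros F L [F0 F1]. split.
    - intros x. rewrite nj_opp. apply F0.
    - intros b x e Hb He. replace (shift b (fun x => - F x)%J x - - F x)%J with (- (shift b F x - F x))%J.
      + rewrite nj_opp. apply F1; assumption.
      + apply jet_ext; simpl; ring. }
  match type of Hk with shift_stable _ ?X => set (Lk := X) in * end.
  match type of Hw with shift_stable _ ?X => set (Lw := X) in * end.
  pose proof (shift_stable_pos _ _ H1). pose proof (shift_stable_pos _ _ H2). pose proof (shift_stable_pos _ _ H3).
  pose proof (shift_stable_pos _ _ Hk). pose proof (shift_stable_pos _ _ Hw).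
  set (P := Rabs (Da 0%nat phi1 * Da 1%nat phi1)).
  set (L11 := 6 * (P * (6 * (L2 * L2))) + 6 * (2 * P * L3)).
  assert (0 <= P) by apply Rabs_pos.
  assert (0 <= L11).
  { unfold L11. apply Rplus_le_le_0_compat; repeat (apply Rmult_le_pos; try lra). }
  exists (1 + L1 + L2 + L3 + (Lk + Lw) + L11). split; [lra|]. intros lam Hlam.
  repeat split; try (eapply W; [eassumption|lra]).
  (* [repeat split] has also opened the conjunction inside [shift_stable], so each of the three
     remaining functions leaves two goals. *)
  1,2: assert (S11 : shift_stable (jf11 lam) L11);
    [ apply shift_stable_add;
      [ apply shift_stable_mul; [apply shift_stable_cst|apply shift_stable_mul; exact H2]
      | apply shift_stable_mul; [|exact H3]; eapply W; [apply shift_stable_cst|];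
        replace (2 * lam * Da 0%nat phi1 * Da 1%nat phi1) with (2 * lam * (Da 0%nat phi1 * Da 1%nat phi1)) by ring;
        rewrite !Rabs_mult, (Rabs_pos_eq 2), <- Rabs_mult by lra; fold P;
        apply Rmult_le_compat_r; lra ]
    | eapply W; [exact S11|lra] ].
  1,2: eapply W; [apply shift_stable_add; [exact Hk|apply Hn; exact Hw]|lra].
  1,2: eapply W; [apply shift_stable_add; [apply Hn; exact Hk|apply Hn; exact Hw]|lra].
Qed.

(** * Orders in t, uniform over admissible data *)

Variables A delta0 : R.
Hypothesis HA1 : 1 <= A.
Hypothesis HA : forall lam, Rabs lam <= 1 ->
  shift_stable jpsi1 A /\ shift_stable jpsi2 A /\ shift_stable jdphi2 A /\
  shift_stable (jf11 lam) A /\ shift_stable jf21 A /\ shift_stable jf22 A.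
Hypothesis Hd0 : 0 < delta0 <= 1.
Hypothesis Hd0A : 2 * A * delta0 <= psi0 / 2.

(** All arguments of the sources are bundled, so that a single constant in [bigO] is uniform in
    time, position, lambda and the values of the unknowns, hence in the time step. *)
Record point := Point { pt : R; pl : R; px : R; pu : jet; pr1 : jet; ps1 : jet; pr2 : jet; ps2 : jet }.

Definition rho1 (p : point) : jet := (pr1 p - (jpsi1 (px p) + jcst (pt p) * jf11 (pl p) (px p)))%J.
Definition sig1 (p : point) : jet := (ps1 p - (jpsi1 (px p) + jcst (pt p) * jf11 (pl p) (px p)))%J.
Definition rho2 (p : point) : jet := (pr2 p - (jpsi2 (px p) + jcst (pt p) * jf21 (px p)))%J.
Definition sig2 (p : point) : jet := (ps2 p - (jpsi2 (px p) + jcst (pt p) * jf22 (px p)))%J.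

(** The remainders are only required to be below t, not M t^2, so that constants derived from [adm]
    do not depend on M. The bound on u is sharper, of order t^2, because c(u) / t must be known up
    to O(t). *)
Definition adm (p : point) : Prop :=
  0 < pt p <= delta0 /\ Rabs (pl p) <= 1 /\
  nj (rho1 p) <= pt p /\ nj (sig1 p) <= pt p /\ nj (rho2 p) <= pt p /\ nj (sig2 p) <= pt p /\
  nj (pu p - (jcst phi1 + jcst (pt p) * jpsi1 (px p))) <= 2 * A * pt p ^ 2.

Definition bigO (k : nat) (f : point -> jet) : Prop :=
  exists K, 0 <= K /\ forall p, adm p -> nj (f p) <= K * pt p ^ k.

Lemma bigO_ext (k : nat) (f g : point -> jet) :
  bigO k f -> (forall p, adm p -> g p = f p) -> bigO k g.
Proof. intros [K [HK H]] E. exists K; split; [exact HK|]. intros p Hp. rewrite E by exact Hp. apply H, Hp. Qed.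

Lemma bigO_add (k : nat) (f g : point -> jet) : bigO k f -> bigO k g -> bigO k (fun p => f p + g p)%J.
Proof.
  intros [K [HK H]] [L [HL I]]. exists (K + L); split; [lra|]. intros p Hp.
  eapply Rle_trans; [apply nj_add|]. specialize (H p Hp); specialize (I p Hp). lra.
Qed.

Lemma bigO_opp (k : nat) (f : point -> jet) : bigO k f -> bigO k (fun p => - f p)%J.
Proof. intros [K [HK H]]. exists K; split; [exact HK|]. intros p Hp. rewrite nj_opp. apply H, Hp. Qed.

Lemma bigO_sub (k : nat) (f g : point -> jet) : bigO k f -> bigO k g -> bigO k (fun p => f p - g p)%J.
Proof. intros Hf Hg. apply bigO_add; [exact Hf|apply bigO_opp; exact Hg]. Qed.

Lemma adm_pow (p : point) (k : nat) : adm p -> 0 < pt p ^ k <= 1.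
Proof.
  intros [[H0 H1] _]. split; [apply pow_lt, H0|].
  rewrite <- (pow1 k). apply pow_incr; lra.
Qed.

Lemma bigO_mul (k l : nat) (f g : point -> jet) : bigO k f -> bigO l g -> bigO (k + l) (fun p => f p * g p)%J.
Proof.
  intros [K [HK H]] [L [HL I]]. exists (K * L); split; [apply Rmult_le_pos; assumption|]. intros p Hp.
  eapply Rle_trans; [apply nj_mul|]. rewrite pow_add.
  eapply Rle_trans; [apply Rmult_le_compat; [apply nj_pos|apply nj_pos|apply H, Hp|apply I, Hp]|].
  right; ring.
Qed.

Lemma bigO_mul0 (k : nat) (f g : point -> jet) : bigO 0 f -> bigO k g -> bigO k (fun p => f p * g p)%J.
Proof. apply (bigO_mul 0). Qed.

Lemma bigO_weak (k l : nat) (f : point -> jet) : (l <= k)%nat -> bigO k f -> bigO l f.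
Proof.
  intros Hl [K [HK H]]. exists K; split; [exact HK|]. intros p Hp.
  eapply Rle_trans; [apply H, Hp|]. apply Rmult_le_compat_l; [exact HK|].
  replace k with (l + (k - l))%nat by lia. rewrite pow_add.
  destruct (adm_pow p l Hp), (adm_pow p (k - l) Hp).
  rewrite <- (Rmult_1_r (pt p ^ l)) at 2. apply Rmult_le_compat_l; lra.
Qed.

Lemma bigO_t : bigO 1 (fun p => jcst (pt p)).
Proof.
  exists 1; split; [lra|]. intros p [[H0 H1] _]. rewrite nj_cst, Rabs_pos_eq; simpl; lra.
Qed.

Lemma bigO_cst (r : R) : bigO 0 (fun _ => jcst r).
Proof. exists (Rabs r); split; [apply Rabs_pos|]. intros p _. rewrite nj_cst. simpl. lra. Qed.

Lemma bigO_lam : bigO 0 (fun p => jcst (pl p)).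
Proof. exists 1; split; [lra|]. intros p Hp. rewrite nj_cst. destruct Hp as (_ & H & _). simpl; lra. Qed.

Lemma bigO_tinv (k : nat) (f : point -> jet) : bigO (S k) f -> bigO k (fun p => jcst (/ pt p) * f p)%J.
Proof.
  intros [K [HK H]]. exists K; split; [exact HK|]. intros p Hp.
  eapply Rle_trans; [apply nj_scal|]. specialize (H p Hp). destruct Hp as [[H0 _] _].
  assert (0 < / pt p) by (apply Rinv_0_lt_compat; exact H0).
  rewrite Rabs_pos_eq by lra.
  eapply Rle_trans; [apply Rmult_le_compat_l; [lra|exact H]|]. right. simpl. field. lra.
Qed.

Lemma bigO_psi1 : bigO 0 (fun p => jpsi1 (px p)).
Proof.
  exists A; split; [lra|]. intros p (_ & Hl & _). destruct (HA _ Hl) as [[H _] _]. simpl. rewrite Rmult_1_r. apply H.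
Qed.

Lemma bigO_psi2 : bigO 0 (fun p => jpsi2 (px p)).
Proof.
  exists A; split; [lra|]. intros p (_ & Hl & _). destruct (HA _ Hl) as [_ [[H _] _]]. simpl. rewrite Rmult_1_r. apply H.
Qed.

Lemma bigO_dphi2 : bigO 0 (fun p => jdphi2 (px p)).
Proof.
  exists A; split; [lra|]. intros p (_ & Hl & _). destruct (HA _ Hl) as [_ [_ [[H _] _]]]. simpl. rewrite Rmult_1_r. apply H.
Qed.

Lemma bigO_f11 : bigO 0 (fun p => jf11 (pl p) (px p)).
Proof.
  exists A; split; [lra|]. intros p (_ & Hl & _). destruct (HA _ Hl) as [_ [_ [_ [[H _] _]]]]. simpl. rewrite Rmult_1_r. apply H.
Qed.

Lemma bigO_f21 : bigO 0 (fun p => jf21 (px p)).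
Proof.
  exists A; split; [lra|]. intros p (_ & Hl & _). destruct (HA _ Hl) as [_ [_ [_ [_ [[H _] _]]]]]. simpl. rewrite Rmult_1_r. apply H.
Qed.

Lemma bigO_f22 : bigO 0 (fun p => jf22 (px p)).
Proof.
  exists A; split; [lra|]. intros p (_ & Hl & _). destruct (HA _ Hl) as [_ [_ [_ [_ [_ [H _]]]]]]. simpl. rewrite Rmult_1_r. apply H.
Qed.

Lemma bigO_rho1 : bigO 1 rho1.
Proof. exists 1; split; [lra|]. intros p (_ & _ & H & _). simpl. lra. Qed.
Lemma bigO_sig1 : bigO 1 sig1.
Proof. exists 1; split; [lra|]. intros p (_ & _ & _ & H & _). simpl. lra. Qed.
Lemma bigO_rho2 : bigO 1 rho2.
Proof. exists 1; split; [lra|]. intros p (_ & _ & _ & _ & H & _). simpl. lra. Qed.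
Lemma bigO_sig2 : bigO 1 sig2.
Proof. exists 1; split; [lra|]. intros p (_ & _ & _ & _ & _ & H & _). simpl. lra. Qed.

Lemma bigO_half (k : nat) (f : point -> jet) : bigO k f -> bigO k (fun p => half (f p)).
Proof. intros H. apply (bigO_mul0 k (fun _ => jcst (/ 2))); [apply bigO_cst|exact H]. Qed.

Lemma bigO_tmul (k : nat) (f : point -> jet) : bigO k f -> bigO (S k) (fun p => jcst (pt p) * f p)%J.
Proof. apply (bigO_mul 1 k); apply bigO_t. Qed.

Lemma bigO_r1_psi1 : bigO 1 (fun p => pr1 p - jpsi1 (px p))%J.
Proof.
  eapply bigO_ext; [apply bigO_add; [apply bigO_rho1|apply (bigO_tmul 0), bigO_f11]|].
  intros p _. unfold rho1. ring.
Qed.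
Lemma bigO_s1_psi1 : bigO 1 (fun p => ps1 p - jpsi1 (px p))%J.
Proof.
  eapply bigO_ext; [apply bigO_add; [apply bigO_sig1|apply (bigO_tmul 0), bigO_f11]|].
  intros p _. unfold sig1. ring.
Qed.
Lemma bigO_r2_psi2 : bigO 1 (fun p => pr2 p - jpsi2 (px p))%J.
Proof.
  eapply bigO_ext; [apply bigO_add; [apply bigO_rho2|apply (bigO_tmul 0), bigO_f21]|].
  intros p _. unfold rho2. ring.
Qed.
Lemma bigO_s2_psi2 : bigO 1 (fun p => ps2 p - jpsi2 (px p))%J.
Proof.
  eapply bigO_ext; [apply bigO_add; [apply bigO_sig2|apply (bigO_tmul 0), bigO_f22]|].
  intros p _. unfold sig2. ring.
Qed.

Lemma bigO_leading (f g : point -> jet) : bigO 0 g -> bigO 1 (fun p => f p - g p)%J -> bigO 0 f.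
Proof.
  intros Hg Hf. eapply bigO_ext; [apply bigO_add; [exact Hg|eapply bigO_weak; [|exact Hf]; lia]|].
  intros p _. cbv beta. ring.
Qed.

Lemma bigO_mu : bigO 2 (fun p => pu p - (jcst phi1 + jcst (pt p) * jpsi1 (px p)))%J.
Proof. exists (2 * A); split; [lra|]. intros p (_ & _ & _ & _ & _ & _ & H). exact H. Qed.

Lemma bigO_u : bigO 1 (fun p => pu p - jcst phi1)%J.
Proof.
  eapply bigO_ext; [apply bigO_add; [eapply bigO_weak; [|apply bigO_mu]; lia|apply (bigO_tmul 0), bigO_psi1]|].
  intros p _. cbv beta. ring.
Qed.

Lemma bigO_mul_leading (f g F G : point -> jet) :
  bigO 0 F -> bigO 0 G -> bigO 1 (fun p => f p - F p)%J -> bigO 1 (fun p => g p - G p)%J ->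
  bigO 1 (fun p => f p * g p - F p * G p)%J.
Proof.
  intros HF HG Hf Hg.
  eapply bigO_ext; [apply bigO_add; [apply (bigO_mul 1 0); [exact Hf|exact HG]|
    apply (bigO_mul 0 1); [apply (bigO_leading _ _ HF Hf)|exact Hg]]|].
  intros p _. cbv beta. ring.
Qed.

Lemma nj_comp_sub (D : nat -> R -> R) (n : nat) (B : R) (u : jet) (z N : R) :
  (forall (k : nat) x, derivable_pt_lim (D k) x (D (S k) x)) ->
  (forall x, Rabs (D (S n) x) <= B) -> (forall x, Rabs (D (S (S n)) x) <= B) ->
  nj (u - jcst z) <= N -> nj (jcomp D n u - jcst (D n z)) <= B * (4 * N + N * N).
Proof.
  intros HD H1 H2 HN.
  pose proof (nj_j0 (u - jcst z)) as u0. pose proof (nj_j1 (u - jcst z)) as u1.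
  pose proof (nj_j2 (u - jcst z)) as u2. pose proof (nj_pos (u - jcst z)) as up. simpl in u0, u1, u2.
  replace (j1 u + - 0) with (j1 u) in u1 by ring. replace (j2 u + - 0) with (j2 u) in u2 by ring.
  assert (HB : 0 <= B) by (eapply Rle_trans; [apply Rabs_pos|apply (H1 0)]).
  unfold nj; simpl.
  assert (E0 : Rabs (D n (j0 u) + - D n z) <= B * N).
  { pose proof (increment_bound (D n) (D (S n)) B z (j0 u - z) (HD n) H1) as I.
    replace (z + (j0 u - z)) with (j0 u) in I by ring.
    eapply Rle_trans; [exact I|]. apply Rmult_le_compat_l; [exact HB|]. unfold Rminus; lra. }
  assert (E1 : Rabs (D (S n) (j0 u) * j1 u + - 0) <= B * N).
  { replace (D (S n) (j0 u) * j1 u + - 0) with (D (S n) (j0 u) * j1 u) by ring. rewrite Rabs_mult.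
    apply Rmult_le_compat; try apply Rabs_pos; [apply H1|lra]. }
  assert (E2 : Rabs (D (S (S n)) (j0 u) * (j1 u * j1 u) + D (S n) (j0 u) * j2 u + - 0) <= B * (N * N) + B * (2 * N)).
  { replace (D (S (S n)) (j0 u) * (j1 u * j1 u) + D (S n) (j0 u) * j2 u + - 0)
      with (D (S (S n)) (j0 u) * (j1 u * j1 u) + D (S n) (j0 u) * j2 u) by ring.
    eapply Rle_trans; [apply Rabs_triang|]. rewrite !Rabs_mult.
    apply Rplus_le_compat; apply Rmult_le_compat; try apply Rabs_pos; try apply H1; try apply H2; try lra.
    - apply Rmult_le_pos; apply Rabs_pos.
    - apply Rmult_le_compat; try apply Rabs_pos; lra. }
  assert (0 <= B * N) by (apply Rmult_le_pos; lra).
  assert (0 <= B * (N * N)) by (apply Rmult_le_pos; [lra|apply Rmult_le_pos; lra]).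
  lra.
Qed.

Lemma bigO_comp (D : nat -> R -> R) (n : nat) :
  (forall (k : nat) x, derivable_pt_lim (D k) x (D (S k) x)) ->
  bounded_fun (D (S n)) -> bounded_fun (D (S (S n))) ->
  bigO 1 (fun p => jcomp D n (pu p) - jcst (D n phi1))%J.
Proof.
  intros HD [B1 H1] [B2 H2]. destruct bigO_u as [K [HK HU]].
  set (B := Rmax B1 B2).
  assert (HB : 0 <= B). { eapply Rle_trans; [apply Rabs_pos|]. eapply Rle_trans; [apply (H1 0)|apply Rmax_l]. }
  exists (B * (4 * K + K * K)). split.
  { apply Rmult_le_pos; [exact HB|]. pose proof (Rmult_le_pos _ _ HK HK). lra. }
  intros p Hp.
  eapply Rle_trans; [apply (nj_comp_sub D n B (pu p) phi1 (K * pt p ^ 1))|].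
  - exact HD.
  - intros x. eapply Rle_trans; [apply H1|apply Rmax_l].
  - intros x. eapply Rle_trans; [apply H2|apply Rmax_r].
  - apply HU, Hp.
  - rewrite (Rmult_assoc B (4 * K + K * K)). apply Rmult_le_compat_l; [exact HB|].
    destruct (adm_pow p 1 Hp) as [P0 P1]. set (t := pt p ^ 1) in *.
    assert (K * K * (t * t) <= K * K * (t * 1)).
    { apply Rmult_le_compat_l; [apply Rmult_le_pos; exact HK|]. apply Rmult_le_compat_l; lra. }
    lra.
Qed.

(** * Expansion of the coefficients at the degenerate line *)

Lemma bigO_jc : bigO 1 (fun p => jc (pu p)).
Proof.
  eapply bigO_ext; [apply (bigO_comp Dc 0 HDc); apply Hcb; lia|].
  intros p _. unfold jc. rewrite Hphi1. ring.
Qed.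

Lemma bigO_jc'_sub : bigO 1 (fun p => jc' (pu p) - jcst (Dc 1%nat phi1))%J.
Proof. apply (bigO_comp Dc 1 HDc); apply Hcb; lia. Qed.
Lemma bigO_ja_sub : bigO 1 (fun p => ja (pu p) - jcst (Da 0%nat phi1))%J.
Proof. apply (bigO_comp Da 0 HDa); apply Hab; lia. Qed.
Lemma bigO_ja'_sub : bigO 1 (fun p => ja' (pu p) - jcst (Da 1%nat phi1))%J.
Proof. apply (bigO_comp Da 1 HDa); apply Hab; lia. Qed.

Lemma bigO_jc' : bigO 0 (fun p => jc' (pu p)).
Proof. exact (bigO_leading _ _ (bigO_cst _) bigO_jc'_sub). Qed.
Lemma bigO_ja : bigO 0 (fun p => ja (pu p)).
Proof. exact (bigO_leading _ _ (bigO_cst _) bigO_ja_sub). Qed.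
Lemma bigO_ja' : bigO 0 (fun p => ja' (pu p)).
Proof. exact (bigO_leading _ _ (bigO_cst _) bigO_ja'_sub). Qed.

(** The expansion is centred at u and evaluated at phi1, where c vanishes. Its slope c'(u) is the
    factor present in the sources, so it can be taken out in [bigO_E]. *)
Lemma nj_taylor (u : jet) (B N : R) :
  (forall x, Rabs (Dc 2%nat x) <= B) -> (forall x, Rabs (Dc 3%nat x) <= B) ->
  nj (u - jcst phi1) <= N ->
  nj (jc u - jc' u * (u - jcst phi1)) <= B * (6 * (N * N) + N * N * N).
Proof.
  intros H2 H3 HN.
  pose proof (nj_j0 (u - jcst phi1)) as u0. pose proof (nj_j1 (u - jcst phi1)) as u1.
  pose proof (nj_j2 (u - jcst phi1)) as u2. pose proof (nj_pos (u - jcst phi1)) as up. simpl in u0, u1, u2.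
  replace (j1 u + - 0) with (j1 u) in u1 by ring. replace (j2 u + - 0) with (j2 u) in u2 by ring.
  set (d := j0 u + - phi1) in *.
  assert (HB : 0 <= B) by (eapply Rle_trans; [apply Rabs_pos|apply (H2 0)]).
  assert (a0 := Rabs_pos d). assert (a1 := Rabs_pos (j1 u)). assert (a2 := Rabs_pos (j2 u)).
  unfold nj; simpl.
  assert (E0 : Rabs (Dc 0%nat (j0 u) + - (Dc 1%nat (j0 u) * (j0 u + - phi1))) <= B * (N * N)).
  { pose proof (taylor_bound (Dc 0%nat) (Dc 1%nat) (Dc 2%nat) B (j0 u) (- d) (HDc 0) (HDc 1) H2) as T.
    replace (j0 u + - d) with phi1 in T by (unfold d; ring). rewrite Hphi1 in T.
    rewrite <- Rabs_Ropp. fold d.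
    replace (- (Dc 0%nat (j0 u) + - (Dc 1%nat (j0 u) * d))) with (0 - Dc 0%nat (j0 u) - - d * Dc 1%nat (j0 u)) by ring.
    eapply Rle_trans; [exact T|]. apply Rmult_le_compat_l; [exact HB|].
    replace (- d * - d) with (Rabs d * Rabs d) by (rewrite <- Rabs_mult, Rabs_pos_eq; [ring|apply Rle_0_sqr]).
    apply Rmult_le_compat; lra. }
  assert (E1 : Rabs (Dc 1%nat (j0 u) * j1 u + - (Dc 2%nat (j0 u) * j1 u * (j0 u + - phi1) + Dc 1%nat (j0 u) * (j1 u + - 0))) <= B * (N * N)).
  { fold d. replace (Dc 1%nat (j0 u) * j1 u + - (Dc 2%nat (j0 u) * j1 u * d + Dc 1%nat (j0 u) * (j1 u + - 0)))
      with (- (Dc 2%nat (j0 u) * (j1 u * d))) by ring. rewrite Rabs_Ropp, !Rabs_mult.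
    apply Rmult_le_compat; [apply Rabs_pos|apply Rmult_le_pos; lra|apply H2|apply Rmult_le_compat; lra]. }
  assert (E2 : Rabs (Dc 2%nat (j0 u) * (j1 u * j1 u) + Dc 1%nat (j0 u) * j2 u +
    - ((Dc 3%nat (j0 u) * (j1 u * j1 u) + Dc 2%nat (j0 u) * j2 u) * (j0 u + - phi1) +
       2 * (Dc 2%nat (j0 u) * j1 u * (j1 u + - 0)) + Dc 1%nat (j0 u) * (j2 u + - 0)))
    <= B * (N * N) + B * (N * N * N) + B * (2 * N * N)).
  { fold d.
    match goal with |- Rabs ?e <= _ => replace e with
      (- (Dc 2%nat (j0 u) * (j1 u * j1 u)) + - (Dc 3%nat (j0 u) * (j1 u * j1 u * d)) + - (Dc 2%nat (j0 u) * (j2 u * d))) by ring end.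
    eapply Rle_trans; [apply Rabs_triang|]. apply Rplus_le_compat.
    eapply Rle_trans; [apply Rabs_triang|]. apply Rplus_le_compat.
    all: rewrite Rabs_Ropp, !Rabs_mult; apply Rmult_le_compat;
      [apply Rabs_pos| |solve [apply H2|apply H3]|].
    all: repeat first [apply Rmult_le_pos | apply Rmult_le_compat]; lra. }
  assert (0 <= N) by lra.
  assert (0 <= B * (N * N)) by (apply Rmult_le_pos; [lra|apply Rmult_le_pos; lra]).
  assert (0 <= B * (N * N * N)) by (repeat (apply Rmult_le_pos; try lra)).
  lra.
Qed.

Lemma bigO_taylor : bigO 2 (fun p => jc (pu p) - jc' (pu p) * (pu p - jcst phi1))%J.
Proof.
  destruct (Hcb 2%nat ltac:(lia)) as [B1 H1]. destruct (Hcb 3%nat ltac:(lia)) as [B2 H2].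
  destruct bigO_u as [K [HK HU]].
  set (B := Rmax B1 B2).
  assert (HB : 0 <= B). { eapply Rle_trans; [apply Rabs_pos|]. eapply Rle_trans; [apply (H1 0)|apply Rmax_l]. }
  pose proof (Rmult_le_pos _ _ HK HK) as HKK. pose proof (Rmult_le_pos _ _ HKK HK) as HKKK.
  exists (B * (6 * (K * K) + K * K * K)). split; [apply Rmult_le_pos; lra|]. intros p Hp.
  eapply Rle_trans; [apply (nj_taylor (pu p) B (K * pt p ^ 1))|].
  - intros x. eapply Rle_trans; [apply H1|apply Rmax_l].
  - intros x. eapply Rle_trans; [apply H2|apply Rmax_r].
  - apply HU, Hp.
  - rewrite (Rmult_assoc B (6 * (K * K) + K * K * K)). apply Rmult_le_compat_l; [exact HB|].
    destruct (adm_pow p 1 Hp) as [P0 P1]. simpl in *. set (t := pt p * 1) in *.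
    replace (pt p * t) with (t * t) by (unfold t; ring).
    assert (K * K * K * (t * t) * t <= K * K * K * (t * t) * 1).
    { apply Rmult_le_compat_l; [|exact P1]. apply Rmult_le_pos; [exact HKKK|apply Rmult_le_pos; lra]. }
    lra.
Qed.

(** By the mean value theorem |c(w)| >= m0 |w - phi1|, and |w - phi1| >= t psi0 - 2 A t^2 >= t psi0
    / 2 by the choice of [delta0]. It is stated for a number [w] so as to apply to the limit u as
    well as to the iterates. *)
Lemma c_lower_value (t x w : R) : 0 < t <= delta0 ->
  Rabs (w - (phi1 + t * Dpsi1 0%nat x)) <= 2 * A * t ^ 2 -> m0 * psi0 / 2 * t <= Rabs (Dc 0%nat w).
Proof.
  intros [Ht0 Ht1] H.
  destruct (MVT_abs (Dc 0%nat) (Dc 1%nat) phi1 w) as [z [Hz _]]; [intros; apply HDc|].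
  rewrite Hphi1, Rminus_0_r in Hz. rewrite Hz.
  assert (Rabs (w - phi1) >= psi0 / 2 * t).
  { specialize (Hpsi1low x).
    replace (w - phi1) with (t * Dpsi1 0%nat x + (w - (phi1 + t * Dpsi1 0%nat x))) by ring.
    set (e := w - (phi1 + t * Dpsi1 0%nat x)) in *.
    pose proof (Rabs_triang_inv (t * Dpsi1 0%nat x) (- e)) as T. rewrite Rabs_Ropp in T.
    replace (t * Dpsi1 0%nat x - - e) with (t * Dpsi1 0%nat x + e) in T by ring.
    rewrite Rabs_mult, (Rabs_pos_eq t) in T by lra.
    assert (t * psi0 <= t * Rabs (Dpsi1 0%nat x)) by (apply Rmult_le_compat_l; lra).
    assert (2 * A * t * t <= psi0 / 2 * t).
    { apply Rmult_le_compat_r; [lra|]. eapply Rle_trans; [|exact Hd0A]. apply Rmult_le_compat_l; lra. }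
    lra. }
  replace (m0 * psi0 / 2 * t) with (m0 * (psi0 / 2 * t)) by field.
  specialize (Hc1 z). apply Rmult_le_compat; try lra. apply Rmult_le_pos; lra.
Qed.

Lemma c_lower (p : point) : adm p -> m0 * psi0 / 2 * pt p <= Rabs (j0 (jc (pu p))).
Proof.
  intros (Ht & _ & _ & _ & _ & _ & Hu). apply (c_lower_value (pt p) (px p)); [exact Ht|].
  exact (Rle_trans _ _ _ (nj_j0 _) Hu).
Qed.

Lemma c_nonzero (p : point) : adm p -> j0 (jc (pu p)) <> 0.
Proof.
  intros Hp E. pose proof (c_lower p Hp) as H. rewrite E, Rabs_R0 in H.
  destruct Hp as [[Ht _] _].
  assert (0 < m0 * psi0 / 2 * pt p) by (apply Rmult_lt_0_compat; [|lra]; apply Rdiv_lt_0_compat; [apply Rmult_lt_0_compat; lra|lra]).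
  lra.
Qed.

Lemma a_nonzero (u : jet) : j0 (ja u) <> 0.
Proof. simpl. intros E. specialize (Ha0 (j0 u)). rewrite E, Rabs_R0 in Ha0. lra. Qed.

Lemma bigO_tcinv : bigO 0 (fun p => jcst (pt p) * jinv (jc (pu p)))%J.
Proof.
  destruct bigO_jc as [K [HK H]]. set (kap := m0 * psi0 / 2).
  assert (Hkap : 0 < kap) by (unfold kap; apply Rdiv_lt_0_compat; [apply Rmult_lt_0_compat; lra|lra]).
  assert (Hki : 0 < / kap) by (apply Rinv_0_lt_compat; exact Hkap).
  exists (/ kap + 2 * (K * (/ kap * / kap)) + K * K * (/ kap * / kap * / kap)). split.
  { repeat apply Rplus_le_le_0_compat; repeat apply Rmult_le_pos; lra. }
  intros p Hp. eapply Rle_trans; [apply nj_scal|].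
  pose proof (c_lower p Hp) as Hl. specialize (H p Hp). destruct Hp as [[Ht _] _].
  rewrite Rabs_pos_eq by lra.
  eapply Rle_trans; [apply Rmult_le_compat_l; [lra|apply (nj_inv _ (kap * pt p) (K * pt p ^ 1))]|].
  - apply Rmult_lt_0_compat; lra.
  - exact Hl.
  - exact H.
  - right. simpl. field. split; lra.
Qed.

Lemma bigO_ainv : bigO 0 (fun p => jinv (ja (pu p))).
Proof.
  destruct bigO_ja as [K [HK H]].
  assert (Hki : 0 < / m0) by (apply Rinv_0_lt_compat; exact Hm0).
  exists (/ m0 + 2 * (K * (/ m0 * / m0)) + K * K * (/ m0 * / m0 * / m0)). split.
  { repeat apply Rplus_le_le_0_compat; repeat apply Rmult_le_pos; lra. }
  intros p Hp. specialize (H p Hp). rewrite Rmult_1_r. simpl in H; rewrite Rmult_1_r in H.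
  apply nj_inv; [exact Hm0| |exact H]. simpl. specialize (Ha0 (j0 (pu p))). lra.
Qed.

Lemma t_tinv (p : point) : adm p -> (jcst (pt p) * jcst (/ pt p) = 1)%J.
Proof. intros [[Ht _] _]. rewrite <- jcst_mul. f_equal. field. lra. Qed.

(* [t c'(u) r / c(u) = 1 + O(t)] for [r = psi1 + O(t)]: the singular coefficients are [1/t] to leading order. *)
Definition coef_error (r : point -> jet) (p : point) : jet :=
  (jc' (pu p) * r p * (jcst (pt p) * jinv (jc (pu p))) - 1)%J.

(** The error is (t c'(u) r - c(u)) / c(u). Its numerator equals c'(u) (t (r - psi1) - (u - phi1 - t
    psi1)) - (c(u) - c'(u) (u - phi1)), which is O(t^2), and dividing by c(u) costs one power of
    t. *)
Lemma bigO_E (r : point -> jet) : bigO 1 (fun p => r p - jpsi1 (px p))%J -> bigO 1 (coef_error r).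
Proof.
  intros Hr.
  assert (HN : bigO 2 (fun p => jc' (pu p) * (jcst (pt p) * (r p - jpsi1 (px p)) -
      (pu p - (jcst phi1 + jcst (pt p) * jpsi1 (px p)))) - (jc (pu p) - jc' (pu p) * (pu p - jcst phi1)))%J).
  { apply bigO_sub; [|apply bigO_taylor]. apply bigO_mul0; [apply bigO_jc'|].
    apply bigO_sub; [apply (bigO_tmul 1), Hr|apply bigO_mu]. }
  eapply bigO_ext; [apply (bigO_mul 0 1); [apply bigO_tcinv|apply (bigO_tinv 1), HN]|].
  intros p Hp. unfold coef_error.
  pose proof (jmul_inv _ (c_nonzero p Hp)) as I. pose proof (t_tinv p Hp) as T.
  rewrite <- I. set (ci := jinv (jc (pu p))) in *. set (ti := jcst (/ pt p)) in *. set (t := jcst (pt p)) in *.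
  transitivity ((t * ti) * (jc' (pu p) * r p * t * ci - jc (pu p) * ci))%J.
  - rewrite T. ring.
  - ring.
Qed.

(** * Expansion of the sources *)

Definition q1 (p : point) : jet := half (rho1 p - sig1 p).
Definition q2 (p : point) : jet := half (rho2 p - sig2 p).

Lemma half_diff1 (p : point) : half (pr1 p - ps1 p) = q1 p.
Proof. unfold q1, rho1, sig1. f_equal. ring. Qed.

Lemma diff1 (p : point) : (pr1 p - ps1 p = q1 p + q1 p)%J.
Proof. rewrite <- half_diff1. apply jet_ext; simpl; field. Qed.

(** R1 and S1 have the same initial slope, so their half-difference is the pure remainder [q1]; for
    R2 and S2 the skew slope leaves the term t k beside [q2]. *)
Lemma half_diff2 (p : point) : half (pr2 p - ps2 p) = (jk (px p) * jcst (pt p) + q2 p)%J.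
Proof. unfold q2, rho2, sig2, jf21, jf22.
  generalize (jk (px p)) (jw (px p)); intros k w. apply jet_ext; simpl; field. Qed.

Lemma diff2 (p : point) : (pr2 p - ps2 p = (jk (px p) * jcst (pt p) + q2 p) + (jk (px p) * jcst (pt p) + q2 p))%J.
Proof. rewrite <- half_diff2. generalize (pr2 p) (ps2 p); intros r s. apply jet_ext; simpl; field. Qed.

Lemma bigO_q2 : bigO 1 q2.
Proof. apply bigO_half, bigO_sub; [apply bigO_rho2|apply bigO_sig2]. Qed.

Lemma bigO_k : bigO 0 (fun p => jk (px p)).
Proof. apply bigO_mul0; [apply bigO_cst|apply bigO_mul0; [apply bigO_psi1|apply bigO_dphi2]]. Qed.

(* [t k / c(u) = phi2' + O(t)]: the trace of [v_x = Q2 / c]. *)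
Lemma bigO_k_c : bigO 1 (fun p => jk (px p) * (jcst (pt p) * jinv (jc (pu p))) - jdphi2 (px p))%J.
Proof.
  assert (H : bigO 1 (fun p => jc' (pu p) * pr1 p - jcst (Dc 1%nat phi1) * jpsi1 (px p))%J).
  { apply bigO_mul_leading; [apply bigO_cst|apply bigO_psi1|apply bigO_jc'_sub|apply bigO_r1_psi1]. }
  eapply bigO_ext; [apply (bigO_mul0 1 (fun p => jdphi2 (px p))); [apply bigO_dphi2|];
    apply bigO_sub; [apply (bigO_E pr1), bigO_r1_psi1|];
    apply (bigO_mul 1 0); [exact H|apply bigO_tcinv]|].
  intros p _. unfold coef_error, jk. ring.
Qed.

Lemma bigO_quot2 : bigO 0 (fun p => (jk (px p) * jcst (pt p) + q2 p) * jinv (jc (pu p)))%J.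
Proof.
  eapply bigO_ext; [apply (bigO_mul0 0); [apply bigO_tcinv|];
    apply bigO_add; [apply bigO_k|apply (bigO_tinv 0), bigO_q2]|].
  intros p Hp. pose proof (t_tinv p Hp) as T.
  transitivity (jinv (jc (pu p)) * (jcst (pt p) * jk (px p) + (jcst (pt p) * jcst (/ pt p)) * q2 p))%J; [|ring].
  rewrite T. ring.
Qed.

Lemma bigO_Q2 : bigO 1 (fun p => jk (px p) * jcst (pt p) + q2 p)%J.
Proof. apply bigO_add; [apply (bigO_mul 0 1); [apply bigO_k|apply bigO_t]|apply bigO_q2]. Qed.

Lemma bigO_aa' : bigO 1 (fun p => ja (pu p) * ja' (pu p) - jcst (Da 0%nat phi1) * jcst (Da 1%nat phi1))%J.
Proof. apply bigO_mul_leading; [apply bigO_cst|apply bigO_cst|apply bigO_ja_sub|apply bigO_ja'_sub]. Qed.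

(** In the term linear in (R2 - S2) / c the part t k / c tends to phi2' and supplies the lambda term
    of f11; what stays singular is q2 / t, and it carries the factor lambda. The quadratic term is
    (t k + q2)^2 / c = O(t), and a a' R2 S2 supplies the rest of f11. *)
Lemma common1_expansion : exists B W, bigO 0 B /\ bigO 1 W /\ forall p, adm p ->
  common1 (pl p) (pu p) (pr2 p) (ps2 p) =
  (jf11 (pl p) (px p) + (jcst (pl p) * B p * (jcst (/ pt p) * q2 p) + W p))%J.
Proof.
  exists (fun p => (ja (pu p) * ja' (pu p) * (1 + 1)) * (jcst (pt p) * jinv (jc (pu p))))%J.
  exists (fun p => jcst (pl p) * (1 + 1) *
     (ja (pu p) * ja' (pu p) * (jk (px p) * (jcst (pt p) * jinv (jc (pu p))))
      - jcst (Da 0%nat phi1) * jcst (Da 1%nat phi1) * jdphi2 (px p))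
    - ja (pu p) * ja (pu p) * jc' (pu p) * ((jk (px p) * jcst (pt p) + q2 p) *
        ((jk (px p) * jcst (pt p) + q2 p) * jinv (jc (pu p))))
    + (ja (pu p) * ja' (pu p) * (pr2 p * ps2 p)
       - jcst (Da 0%nat phi1) * jcst (Da 1%nat phi1) * (jpsi2 (px p) * jpsi2 (px p))))%J.
  split; [|split].
  - apply bigO_mul0; [|apply bigO_tcinv]. apply bigO_mul0; [apply bigO_mul0; [apply bigO_ja|apply bigO_ja']|].
    apply (bigO_add 0 (fun _ => 1%J) (fun _ => 1%J)); apply bigO_cst.
  - apply bigO_add; [apply bigO_sub|].
    + apply bigO_mul0.
      * apply bigO_mul0; [apply bigO_lam|].
        apply (bigO_add 0 (fun _ => 1%J) (fun _ => 1%J)); apply bigO_cst.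
      * apply bigO_mul_leading; [apply bigO_mul0; apply bigO_cst|apply bigO_dphi2|apply bigO_aa'|apply bigO_k_c].
    + apply bigO_mul0; [apply bigO_mul0; [apply bigO_mul0; apply bigO_ja|apply bigO_jc']|].
      apply (bigO_mul 1 0); [apply bigO_Q2|apply bigO_quot2].
    + apply bigO_mul_leading; [apply bigO_mul0; apply bigO_cst|apply bigO_mul0; apply bigO_psi2|apply bigO_aa'|].
      apply bigO_mul_leading; [apply bigO_psi2|apply bigO_psi2|apply bigO_r2_psi2|apply bigO_s2_psi2].
  - intros p Hp. pose proof (t_tinv p Hp) as T.
    unfold common1. rewrite half_diff2, diff2. unfold jf11.
    replace (2 * pl p * Da 0%nat phi1 * Da 1%nat phi1) with ((1 + 1) * pl p * Da 0%nat phi1 * Da 1%nat phi1) by ring.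
    rewrite !jcst_mul, jcst_add.
    set (ci := jinv (jc (pu p))). set (t := jcst (pt p)) in *. set (ti := jcst (/ pt p)) in *. set (l := jcst (pl p)).
    set (aa := ja (pu p)). set (aa' := ja' (pu p)).
    (* [ring] does not know that t (1 / t) = 1, so an intermediate form carries this product in
       front of [q2]. The other expansions do the same. *)
    transitivity (l * aa * aa' * ((jk (px p) * t + (t * ti) * q2 p + (jk (px p) * t + (t * ti) * q2 p)) * ci) -
      aa * aa * jc' (pu p) * ((jk (px p) * t + q2 p) * (jk (px p) * t + q2 p) * ci) + aa * aa' * pr2 p * ps2 p)%J.
    + rewrite T. ring.
    + ring.
Qed.

Lemma skew1_expansion : exists E, bigO 1 E /\ forall p, adm p ->
  skew1 (pu p) (pr1 p) (ps1 p) = ((1 + E p) * (jcst (/ pt p) * q1 p))%J.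
Proof.
  exists (coef_error (fun p => half (pr1 p + ps1 p))). split.
  - apply bigO_E. eapply bigO_ext; [apply bigO_half, bigO_add; [apply bigO_r1_psi1|apply bigO_s1_psi1]|].
    intros p _. apply jet_ext; simpl; field.
  - intros p Hp. pose proof (t_tinv p Hp) as T. unfold skew1, coef_error. rewrite half_diff1.
    transitivity (jc' (pu p) * half (pr1 p + ps1 p) * ((jcst (pt p) * jcst (/ pt p)) * q1 p * jinv (jc (pu p))))%J; [|ring].
    rewrite T. ring.
Qed.

(** The numerator R1 - S1 = 2 q1 has no term of order t, so the lambda term is purely a remainder
    term: f21 and f22 do not contain lambda. *)
Lemma common2_expansion : exists B W, bigO 0 B /\ bigO 1 W /\ forall p, adm p ->
  common2 (pl p) (pu p) (pr1 p) (ps1 p) (pr2 p) (ps2 p) =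
  (- jw (px p) + (jcst (pl p) * B p * (jcst (/ pt p) * q1 p) + W p))%J.
Proof.
  exists (fun p => - (ja' (pu p) * jinv (ja (pu p)) * (1 + 1) * (jcst (pt p) * jinv (jc (pu p)))))%J.
  exists (fun p => - (ja' (pu p) * jinv (ja (pu p)) * (pr1 p * ps2 p + ps1 p * pr2 p)
     - jcst (Da 1%nat phi1) * jcst (/ Da 0%nat phi1) * (jpsi1 (px p) * jpsi2 (px p) + jpsi1 (px p) * jpsi2 (px p))))%J.
  assert (N0 : Da 0%nat phi1 <> 0).
  { intros E. specialize (Ha0 phi1). rewrite E, Rabs_R0 in Ha0. lra. }
  split; [|split].
  - apply bigO_opp. apply bigO_mul0; [|apply bigO_tcinv].
    apply bigO_mul0; [apply bigO_mul0; [apply bigO_ja'|apply bigO_ainv]|].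
    apply (bigO_add 0 (fun _ => 1%J) (fun _ => 1%J)); apply bigO_cst.
  - apply bigO_opp. apply bigO_mul_leading.
    + apply bigO_mul0; apply bigO_cst.
    + apply bigO_add; apply bigO_mul0; solve [apply bigO_psi1|apply bigO_psi2].
    + apply bigO_mul_leading; [apply bigO_cst|apply bigO_cst|apply bigO_ja'_sub|].
      (* 1 / a(u) - 1 / a(phi1) = - (a(u) - a(phi1)) / (a(u) a(phi1)). *)
      eapply bigO_ext; [apply bigO_opp; apply (bigO_mul0 1 (fun p => jinv (ja (pu p)) * jcst (/ Da 0%nat phi1))%J);
        [apply bigO_mul0; [apply bigO_ainv|apply bigO_cst]|apply bigO_ja_sub]|].
      intros p _. cbv beta. pose proof (jmul_inv _ (a_nonzero (pu p))) as I.
      assert (I0 : (jcst (Da 0%nat phi1) * jcst (/ Da 0%nat phi1) = 1)%J) by (rewrite <- jcst_mul; f_equal; field; exact N0).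
      transitivity (jinv (ja (pu p)) * (jcst (Da 0%nat phi1) * jcst (/ Da 0%nat phi1))
         - (ja (pu p) * jinv (ja (pu p))) * jcst (/ Da 0%nat phi1))%J; [rewrite I, I0; ring|ring].
    + eapply bigO_ext; [apply bigO_add; apply bigO_mul_leading;
        [apply bigO_psi1|apply bigO_psi2|apply bigO_r1_psi1|apply bigO_s2_psi2
        |apply bigO_psi1|apply bigO_psi2|apply bigO_s1_psi1|apply bigO_r2_psi2]|].
      intros p _. cbv beta. ring.
  - intros p Hp. pose proof (t_tinv p Hp) as T.
    unfold common2. rewrite diff1. unfold jw.
    replace (2 * Da 1%nat phi1 / Da 0%nat phi1) with ((1 + 1) * Da 1%nat phi1 * / Da 0%nat phi1) by (field; exact N0).
    rewrite !jcst_mul, jcst_add.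
    set (ci := jinv (jc (pu p))). set (t := jcst (pt p)) in *. set (ti := jcst (/ pt p)) in *. set (l := jcst (pl p)).
    set (ai := jinv (ja (pu p))). set (aa' := ja' (pu p)).
    transitivity (- (l * (aa' * ai) * ((t * ti) * (q1 p + q1 p) * ci)) - aa' * ai * (pr1 p * ps2 p + ps1 p * pr2 p))%J.
    + rewrite T. ring.
    + ring.
Qed.

(** Since t c'(u) r / c(u) = 1 + E, the half-difference t k + q2 becomes (1 + E) (k + q2 / t). Both
    r = R1 and r = S1 are used, once for each of the two equations. *)
Lemma skew2_expansion (r : point -> jet) : bigO 1 (fun p => r p - jpsi1 (px p))%J ->
  exists E W, bigO 1 E /\ bigO 1 W /\ forall p, adm p ->
  skew2 (pu p) (r p) (pr2 p) (ps2 p) = (jk (px p) + ((1 + E p) * (jcst (/ pt p) * q2 p) + W p))%J.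
Proof.
  intros Hr. exists (coef_error r), (fun p => jk (px p) * coef_error r p)%J. split; [|split].
  - apply bigO_E, Hr.
  - apply bigO_mul0; [apply bigO_k|apply bigO_E, Hr].
  - intros p Hp. pose proof (t_tinv p Hp) as T. unfold skew2, coef_error. rewrite half_diff2.
    transitivity (jc' (pu p) * r p * ((jk (px p) * jcst (pt p) + (jcst (pt p) * jcst (/ pt p)) * q2 p) * jinv (jc (pu p))))%J; [|ring].
    rewrite T. ring.
Qed.

(** [m] is the actual size of the remainders, later M t^2, for which the bound reads (1 + K (t +
    |lambda|)) M t + K t: this is the factor theta near 1. *)
Definition srcs_close (K : R) (p : point) (m : R) : Prop :=
  let e := (1 + K * (pt p + Rabs (pl p))) * (m / pt p) + K * pt p in
  nj (srcR1 (pl p) (pu p) (pr1 p) (ps1 p) (pr2 p) (ps2 p) - jf11 (pl p) (px p)) <= e /\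
  nj (srcS1 (pl p) (pu p) (pr1 p) (ps1 p) (pr2 p) (ps2 p) - jf11 (pl p) (px p)) <= e /\
  nj (srcR2 (pl p) (pu p) (pr1 p) (ps1 p) (pr2 p) (ps2 p) - jf21 (px p)) <= e /\
  nj (srcS2 (pl p) (pu p) (pr1 p) (ps1 p) (pr2 p) (ps2 p) - jf22 (px p)) <= e.

Lemma nj_half (a : jet) : nj (half a) <= nj a / 2.
Proof. eapply Rle_trans; [apply nj_scal|]. rewrite Rabs_pos_eq; lra. Qed.

Lemma singular_bound (E B W : point -> jet) : bigO 1 E -> bigO 0 B -> bigO 1 W ->
  exists K, 0 <= K /\ forall p, adm p -> forall (m : R) (qa qb : jet), nj qa <= m -> nj qb <= m ->
  nj ((1 + E p) * (jcst (/ pt p) * qa) + (jcst (pl p) * B p * (jcst (/ pt p) * qb) + W p)) <=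
  (1 + K * (pt p + Rabs (pl p))) * (m / pt p) + K * pt p.
Proof.
  intros [KE [HE BE]] [KB [HB BB]] [KW [HW BW]]. exists (KE + KB + KW). split; [lra|].
  intros p Hp m qa qb Ha Hb. specialize (BE p Hp); specialize (BB p Hp); specialize (BW p Hp).
  destruct Hp as [[Ht _] _]. simpl in BE, BB, BW. rewrite Rmult_1_r in BE, BB, BW.
  assert (Hi : 0 < / pt p) by (apply Rinv_0_lt_compat, Ht).
  assert (Q : forall q, nj q <= m -> nj (jcst (/ pt p) * q) <= m / pt p).
  { intros q Hq. eapply Rle_trans; [apply nj_scal|]. rewrite Rabs_pos_eq by lra.
    unfold Rdiv. rewrite Rmult_comm. apply Rmult_le_compat_r; lra. }
  set (mt := m / pt p) in *.
  assert (Hmt : 0 <= mt) by (eapply Rle_trans; [apply nj_pos|apply (Q qa Ha)]).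
  clearbody mt. pose proof (Rabs_pos (pl p)) as Hl.
  assert (X1 : nj ((1 + E p) * (jcst (/ pt p) * qa)) <= (1 + KE * pt p) * mt).
  { eapply Rle_trans; [apply nj_mul|]. apply Rmult_le_compat; try apply nj_pos; [|apply Q, Ha].
    eapply Rle_trans; [apply nj_add|]. rewrite nj_cst, Rabs_R1. lra. }
  assert (X2 : nj (jcst (pl p) * B p * (jcst (/ pt p) * qb)) <= Rabs (pl p) * KB * mt).
  { eapply Rle_trans; [apply nj_mul|]. apply Rmult_le_compat; try apply nj_pos; [|apply Q, Hb].
    eapply Rle_trans; [apply nj_scal|]. apply Rmult_le_compat_l; lra. }
  eapply Rle_trans; [apply nj_add|].
  pose proof (nj_add (jcst (pl p) * B p * (jcst (/ pt p) * qb)) (W p)) as X3.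
  assert (0 <= KB * pt p * mt) by (repeat apply Rmult_le_pos; lra).
  assert (0 <= KW * pt p * mt) by (repeat apply Rmult_le_pos; lra).
  assert (0 <= KE * Rabs (pl p) * mt) by (repeat apply Rmult_le_pos; lra).
  assert (0 <= KW * Rabs (pl p) * mt) by (repeat apply Rmult_le_pos; lra).
  assert (0 <= KE * pt p) by (apply Rmult_le_pos; lra).
  assert (0 <= KB * pt p) by (apply Rmult_le_pos; lra).
  lra.
Qed.

Lemma sources_estimate : exists K, 0 <= K /\ forall p, adm p -> forall m,
  nj (rho1 p) <= m -> nj (sig1 p) <= m -> nj (rho2 p) <= m -> nj (sig2 p) <= m -> srcs_close K p m.
Proof.
  destruct skew1_expansion as (E1 & HE1 & X1).
  destruct common1_expansion as (B1 & W1 & HB1 & HW1 & Y1).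
  destruct common2_expansion as (B2 & W2 & HB2 & HW2 & Y2).
  destruct (skew2_expansion pr1 bigO_r1_psi1) as (E2 & V2 & HE2 & HV2 & X2).
  destruct (skew2_expansion ps1 bigO_s1_psi1) as (E3 & V3 & HE3 & HV3 & X3).
  destruct (singular_bound E1 B1 W1 HE1 HB1 HW1) as (K1 & HK1 & Z1).
  destruct (singular_bound E2 B2 _ HE2 HB2 (bigO_add _ _ _ HV2 HW2)) as (K2 & HK2 & Z2).
  destruct (singular_bound E3 B2 _ HE3 HB2 (bigO_sub _ _ _ HW2 HV3)) as (K3 & HK3 & Z3).
  exists (K1 + K2 + K3). split; [lra|]. intros p Hp m h1 h2 h3 h4.
  (* The half-difference of two remainders bounded by m is again bounded by m; a factor 2 here would
     bring theta to the critical value. *)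
  assert (Q1 : nj (q1 p) <= m).
  { eapply Rle_trans; [apply nj_half|]. pose proof (nj_sub (rho1 p) (sig1 p)). lra. }
  assert (Q2 : nj (q2 p) <= m).
  { eapply Rle_trans; [apply nj_half|]. pose proof (nj_sub (rho2 p) (sig2 p)). lra. }
  assert (Q1' : nj (- q1 p) <= m) by (rewrite nj_opp; exact Q1).
  assert (Q2' : nj (- q2 p) <= m) by (rewrite nj_opp; exact Q2).
  assert (Mon : forall K, 0 <= K -> K <= K1 + K2 + K3 ->
    (1 + K * (pt p + Rabs (pl p))) * (m / pt p) + K * pt p <=
    (1 + (K1 + K2 + K3) * (pt p + Rabs (pl p))) * (m / pt p) + (K1 + K2 + K3) * pt p).
  { intros K HK HKs. destruct Hp as [[Ht _] _].
    assert (0 <= m / pt p) by (apply Rmult_le_pos; [pose proof (nj_pos (q1 p)); lra|left; apply Rinv_0_lt_compat, Ht]).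
    pose proof (Rabs_pos (pl p)).
    apply Rplus_le_compat; [apply Rmult_le_compat_r; [lra|]; apply Rplus_le_compat_l|]; apply Rmult_le_compat_r; lra. }
  unfold srcs_close; cbv zeta. unfold srcR1, srcS1, srcR2, srcS2.
  rewrite X1, Y1, Y2, X2, X3 by exact Hp. unfold jf21, jf22.
  repeat split.
  - eapply Rle_trans; [|apply (Mon K1); lra]. eapply Rle_trans; [|apply (Z1 p Hp m (q1 p) (q2 p) Q1 Q2)].
    right. f_equal. ring.
  - eapply Rle_trans; [|apply (Mon K1); lra]. eapply Rle_trans; [|apply (Z1 p Hp m (- q1 p)%J (q2 p) Q1' Q2)].
    right. f_equal. ring.
  - eapply Rle_trans; [|apply (Mon K2); lra]. eapply Rle_trans; [|apply (Z2 p Hp m (q2 p) (q1 p) Q2 Q1)].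
    right. f_equal. ring.
  - eapply Rle_trans; [|apply (Mon K3); lra]. eapply Rle_trans; [|apply (Z3 p Hp m (- q2 p)%J (q1 p) Q2' Q1)].
    right. f_equal. ring.
Qed.

(** * The scheme *)

Inductive comp := cU | cV | cR1 | cS1 | cR2 | cS2.
Definition state := comp -> R -> jet.

Definition base (i : comp) (x : R) : jet :=
  match i with
  | cU => jcst phi1 | cV => jof Dphi2 0 x
  | cR1 | cS1 => jpsi1 x | cR2 | cS2 => jpsi2 x
  end.

Definition slope (lam : R) (i : comp) (x : R) : jet :=
  match i with
  | cU => jpsi1 x | cV => jpsi2 x | cR1 | cS1 => jf11 lam x | cR2 => jf21 x | cS2 => jf22 x
  end.

(** The displacement to the foot of the characteristic per unit of time: R_t - c R_x is transport
    from x + h c, and S_t + c S_x from x - h c. *)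
Definition speed (s : state) (i : comp) (x : R) : jet :=
  match i with
  | cU | cV => 0%J | cR1 | cR2 => jc (s cU x) | cS1 | cS2 => (- jc (s cU x))%J
  end.

Definition source (lam : R) (s : state) (i : comp) (x : R) : jet :=
  let g f := f lam (s cU x) (s cR1 x) (s cS1 x) (s cR2 x) (s cS2 x) in
  match i with
  | cU => half (s cR1 x + s cS1 x) | cV => half (s cR2 x + s cS2 x)
  | cR1 => g srcR1 | cS1 => g srcS1 | cR2 => g srcR2 | cS2 => g srcS2
  end.

Definition advance (h : R) (b F src : R -> jet) (x : R) : jet :=
  (shift (fun y => jcst h * b y) F x + jcst h * src x)%J.

(* At [t = 0] the sources are singular; there they are replaced by the prescribed time derivatives. *)
Fixpoint scheme (lam h : R) (k : nat) : state :=
  match k with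
  | O => base
  | S k' => fun i => match k' with
    | O => advance h (fun _ => 0%J) (base i) (slope lam i)
    | S _ => let s := scheme lam h k' in advance h (speed s i) (s i) (source lam s i)
    end
  end.

Lemma C2_advance (h : R) (b F src : R -> jet) : C2 b -> C2 F -> C2 src -> C2 (advance h b F src).
Proof.
  intros Hb HF Hs. apply C2_add; [apply C2_shift; [|exact HF]|]; apply C2_mul; try assumption; apply C2_cst.
Qed.

Lemma nj_le_mul (a : jet) (h e : R) : 0 <= h -> nj a <= e -> nj (jcst h * a) <= h * e.
Proof. intros Hh Ha. eapply Rle_trans; [apply nj_scal|]. rewrite Rabs_pos_eq by exact Hh. apply Rmult_le_compat_l; assumption. Qed.

(** The new remainder is the shifted old one, at most M t^2 (1 + 4 h Kc t), plus the displacement of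
    the profile g + t f, at most 2 A h Kc t, plus h (src - f). The hypotheses on Kc and M turn the
    excess over M t^2 into at most (1/4 + 1/4 + 5/4) M h t, and 7/4 M h t fits into M (t + h)^2 - M
    t^2 >= 2 M h t. *)
Lemma advance_remainder (h t M K Kc : R) (b F src g f : R -> jet) (x : R) :
  shift_stable g A -> shift_stable f A -> 0 < h -> 0 < t -> t + h <= 1 -> 0 <= Kc -> 16 * Kc * (t + h) <= 1 ->
  4 * (2 * A * Kc + K) <= M -> 0 <= K ->
  nj (b x) <= Kc * t ->
  (forall y, nj (F y - (g y + jcst t * f y)) <= M * t ^ 2) ->
  nj (src x - f x) <= 5 / 4 * (M * t) + K * t ->
  nj (advance h b F src x - (g x + jcst (t + h) * f x)) <= M * (t + h) ^ 2.
Proof.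
  intros [_ Hg] [_ Hf] Hh Ht Hth HKc HKc1 HM HK Hb HF Hs.
  set (B := fun y => (jcst h * b y)%J).
  assert (He : nj (B x) <= h * (Kc * t)) by (apply nj_le_mul; [lra|exact Hb]).
  assert (Ht0 : 0 <= Kc * t) by (apply Rmult_le_pos; lra).
  assert (Hh0 : 0 <= Kc * h) by (apply Rmult_le_pos; lra).
  assert (Hht : 0 < h * t) by (apply Rmult_lt_0_compat; lra).
  assert (HMp : 0 <= M).
  { assert (0 <= A * Kc) by (apply Rmult_le_pos; lra). lra. }
  assert (He1 : h * (Kc * t) <= 1).
  { assert (h * (Kc * t) <= 1 * (Kc * t)) by (apply Rmult_le_compat_r; lra). lra. }
  assert (E : (advance h b F src x - (g x + jcst (t + h) * f x) =
    shift B (fun y => F y - (g y + jcst t * f y)) x + ((shift B g x - g x) +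
     (jcst t * (shift B f x - f x) + jcst h * (src x - f x))))%J).
  { unfold advance. fold B. rewrite jcst_add. unfold jsub at 2.
    replace (shift B (fun y => F y + - (g y + jcst t * f y))%J x)
      with (shift B F x - (shift B g x + jcst t * shift B f x))%J by (apply jet_ext; simpl; ring).
    ring. }
  rewrite E.
  eapply Rle_trans; [apply nj_add|].
  pose proof (nj_shift B (fun y => F y - (g y + jcst t * f y))%J x (M * t ^ 2) (h * (Kc * t)) HF He He1) as N1.
  pose proof (nj_add (shift B g x - g x) (jcst t * (shift B f x - f x) + jcst h * (src x - f x))) as N2.
  pose proof (nj_add (jcst t * (shift B f x - f x)) (jcst h * (src x - f x))) as N3.
  pose proof (Hg B x _ He He1) as N4.
  pose proof (nj_le_mul _ t _ (Rlt_le _ _ Ht) (Hf B x _ He He1)) as N5.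
  pose proof (nj_le_mul _ h _ (Rlt_le _ _ Hh) Hs) as N6.
  assert (P1 : t * (A * (h * (Kc * t))) <= 1 * (A * (h * (Kc * t)))).
  { apply Rmult_le_compat_r; [|lra]. repeat apply Rmult_le_pos; lra. }
  assert (P2 : M * (h * t) * (4 * (Kc * t * t)) <= M * (h * t) * (1 / 4)).
  { apply Rmult_le_compat_l; [apply Rmult_le_pos; lra|].
    assert (Kc * t * t <= Kc * t * 1) by (apply Rmult_le_compat_l; lra). lra. }
  assert (P3 : (h * t) * (4 * (2 * A * Kc + K)) <= (h * t) * M) by (apply Rmult_le_compat_l; lra).
  assert (P4 : 0 <= M * (h * h)) by (apply Rmult_le_pos; [exact HMp|apply Rmult_le_pos; lra]).
  replace (t ^ 2) with (t * t) in N1 by ring. replace ((t + h) ^ 2) with ((t + h) * (t + h)) by ring.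
  assert (P5 : 0 <= M * (h * t)) by (apply Rmult_le_pos; lra).
  lra.
Qed.

Definition point_at (lam t : R) (s : state) (x : R) : point :=
  Point t lam x (s cU x) (s cR1 x) (s cS1 x) (s cR2 x) (s cS2 x).

(** u and v are not transported and their sources stay within 2 A t of the slopes, so 2 A t^2 is
    preserved independently of M. *)
Definition rem_cst (M : R) (i : comp) : R := match i with cU | cV => 2 * A | _ => M end.

Definition invariant (M lam t : R) (s : state) : Prop :=
  forall i, C2 (s i) /\ forall x, nj (s i x - (base i x + jcst t * slope lam i x)) <= rem_cst M i * t ^ 2.

Lemma invariant_adm (M lam t : R) (s : state) (x : R) :
  0 < t <= delta0 -> Rabs lam <= 1 -> M * t <= 1 -> invariant M lam t s -> adm (point_at lam t s x).
Proof.
  intros Ht Hl HM Hi.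
  assert (E : M * t ^ 2 <= t).
  { simpl. rewrite Rmult_1_r, <- Rmult_assoc. rewrite <- (Rmult_1_l t) at 3. apply Rmult_le_compat_r; lra. }
  repeat split; simpl; try tauto; try lra.
  1-4: eapply Rle_trans; [|exact E].
  - exact (proj2 (Hi cR1) x).
  - exact (proj2 (Hi cS1) x).
  - exact (proj2 (Hi cR2) x).
  - exact (proj2 (Hi cS2) x).
  - exact (proj2 (Hi cU) x).
Qed.

Lemma C2_base (i : comp) : C2 (base i).
Proof. destruct i; simpl; try apply C2_cst; apply C2_jof; assumption. Qed.

Lemma C2_slope (lam : R) (i : comp) : C2 (slope lam i).
Proof.
  assert (H1 : C2 jpsi1) by (apply C2_jof, HDpsi1).
  assert (H2 : C2 jpsi2) by (apply C2_jof, HDpsi2).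
  assert (H3 : C2 jdphi2) by (apply C2_jof, HDphi2).
  destruct i; simpl; try assumption; unfold jf11, jf21, jf22, jk, jw;
    repeat first [apply C2_sub | apply C2_add | apply C2_opp | apply C2_mul | apply C2_cst]; assumption.
Qed.

Lemma C2_speed (s : state) (i : comp) : C2 (s cU) -> C2 (speed s i).
Proof.
  intros H. assert (C2 (fun x => jc (s cU x))) by (apply C2_comp; assumption).
  destruct i; simpl; try assumption; try apply C2_cst; apply C2_opp; assumption.
Qed.

Lemma C2_source (lam : R) (s : state) (i : comp) :
  (forall j, C2 (s j)) -> (forall x, j0 (jc (s cU x)) <> 0) -> C2 (source lam s i).
Proof.
  intros H Hn.
  assert (I1 : C2 (fun x => jinv (jc (s cU x)))) by (apply (C2_inv (fun x => jc (s cU x))); [apply C2_comp; [assumption|apply H]|exact Hn]).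
  assert (I2 : C2 (fun x => jinv (ja (s cU x)))) by (apply (C2_inv (fun x => ja (s cU x))); [apply C2_comp; [assumption|apply H]|intros; apply a_nonzero]).
  assert (I3 : C2 (fun x => jc' (s cU x))) by (apply C2_comp; [assumption|apply H]).
  assert (I4 : C2 (fun x => ja (s cU x))) by (apply C2_comp; [assumption|apply H]).
  assert (I5 : C2 (fun x => ja' (s cU x))) by (apply C2_comp; [assumption|apply H]).
  pose proof (H cR1) as h1. pose proof (H cS1) as h2. pose proof (H cR2) as h3. pose proof (H cS2) as h4.
  destruct i; unfold source, srcR1, srcS1, srcR2, srcS2, skew1, skew2, common1, common2, half;
    repeat match goal with
    | |- C2 (fun x => jadd _ _) => apply C2_add
    | |- C2 (fun x => jsub _ _) => apply C2_sub
    | |- C2 (fun x => jopp _) => apply C2_opp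
    | |- C2 (fun x => jmul _ _) => apply C2_mul
    | |- C2 (fun x => jcst _) => apply C2_cst
    | |- _ => assumption
    end.
Qed.

Lemma slope_stable (lam : R) (i : comp) : Rabs lam <= 1 -> shift_stable (slope lam i) A.
Proof. intros Hl. destruct (HA lam Hl) as (h1 & h2 & h3 & h4 & h5 & h6). destruct i; assumption. Qed.

Lemma shift_zero (h : R) (F : R -> jet) (x : R) : shift (fun _ => jcst h * 0)%J F x = F x.
Proof.
  unfold shift; simpl. replace (x + h * 0) with x by ring.
  destruct (F x) as [f0 f1 f2]; simpl. f_equal; ring.
Qed.

(** One step with zero speed and the prescribed slopes lands exactly on base + h slope, so the
    remainder vanishes. *)
Lemma invariant_first (M lam h : R) : 0 <= M -> 0 < h -> invariant M lam h (scheme lam h 1).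
Proof.
  intros HM Hh i. split.
  - apply C2_advance; [apply C2_cst|apply C2_base|apply C2_slope].
  - intros x. simpl scheme. unfold advance. rewrite shift_zero.
    replace (base i x + jcst h * slope lam i x - (base i x + jcst h * slope lam i x))%J with (jcst 0) by ring.
    rewrite nj_cst, Rabs_R0. apply Rmult_le_pos; [destruct i; simpl; lra|apply pow_le; lra].
Qed.

Record constants (lam0 delta M K Kc : R) : Prop := Constants {
  cs_lam0 : 0 < lam0 <= 1;
  cs_delta : 0 < delta <= delta0;
  cs_M : 0 <= M;
  cs_K : 0 <= K;
  cs_Kc : 0 <= Kc;
  cs_Md : M * delta <= 1;
  cs_Kd : 4 * (K * (delta + lam0)) <= 1;
  cs_Kcd : 16 * Kc * delta <= 1;
  cs_MK : 4 * (2 * A * Kc + K) <= M;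
  cs_src : forall p, adm p -> forall m,
    nj (rho1 p) <= m -> nj (sig1 p) <= m -> nj (rho2 p) <= m -> nj (sig2 p) <= m -> srcs_close K p m;
  cs_c : forall p, adm p -> nj (jc (pu p)) <= Kc * pt p }.

(** K and Kc refer only to [adm]; M is computed from them, and only then are delta and lam0 taken
    small. *)
Lemma constants_exist : exists lam0 delta M K Kc, constants lam0 delta M K Kc.
Proof.
  destruct sources_estimate as (K & HK & HS). destruct bigO_jc as (Kc & HKc & HC).
  set (M := 4 * (2 * A * Kc + K)).
  assert (HAK : 0 <= A * Kc) by (apply Rmult_le_pos; lra).
  assert (HM : 0 <= M) by (unfold M; lra).
  (* One summand for each smallness condition: 1 gives lam0 <= 1, and 8 K gives 4 K delta and 4 K
     lam0 at most 1 / 2 each. *)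
  set (D := 1 + M + 16 * Kc + 8 * K).
  assert (HD : 0 < D) by (unfold D; lra).
  assert (HDi : 0 < / D) by (apply Rinv_0_lt_compat, HD).
  assert (HDD : D * / D = 1) by (apply Rinv_r; lra).
  set (d := Rmin delta0 (/ D)).
  assert (Hd1 : d <= / D) by apply Rmin_r.
  assert (Hd2 : 0 < d) by (apply Rmin_glb_lt; lra).
  assert (B : forall X, 0 <= X -> X <= D -> X * d <= 1).
  { intros X h1 h2. rewrite <- HDD. apply Rmult_le_compat; lra. }
  assert (Hinv1 : / D <= 1). { rewrite <- Rinv_1. apply Rinv_le_contravar; unfold D; lra. }
  exists (/ D), d, M, K, Kc. constructor; try assumption.
  - split; assumption.
  - split; [exact Hd2|apply Rmin_l].
  - apply B; unfold D; lra.
  - assert (8 * K * / D <= 1) by (rewrite <- HDD; apply Rmult_le_compat_r; [lra|unfold D; lra]).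
    assert (8 * K * d <= 1) by (apply B; unfold D; lra). lra.
  - apply B; unfold D; lra.
  - right; reflexivity.
  - intros p Hp. specialize (HC p Hp). simpl in HC. rewrite Rmult_1_r in HC. exact HC.
Qed.

(** * Uniform bounds on the iterates *)

Section Bounds.
Variables lam0 delta M K Kc : R.
Hypothesis HCs : constants lam0 delta M K Kc.
Variable lam : R.
Hypothesis Hlam : Rabs lam <= lam0.

Lemma lam_le1 : Rabs lam <= 1.
Proof. destruct (cs_lam0 _ _ _ _ _ HCs). lra. Qed.

Lemma M_le1 (t : R) : 0 < t <= delta -> M * t <= 1.
Proof.
  intros Ht. eapply Rle_trans; [|apply (cs_Md _ _ _ _ _ HCs)].
  apply Rmult_le_compat_l; [apply (cs_M _ _ _ _ _ HCs)|lra].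
Qed.

Lemma inv_adm (t : R) (s : state) (x : R) : 0 < t <= delta -> invariant M lam t s -> adm (point_at lam t s x).
Proof.
  intros Ht Hi. pose proof (cs_delta _ _ _ _ _ HCs).
  apply (invariant_adm M); [lra|apply lam_le1|apply M_le1; exact Ht|exact Hi].
Qed.

Lemma half_sum_remainder (a b g p q : jet) (t e : R) : 0 <= t ->
  nj (a - (g + jcst t * p)) <= e -> nj (b - (g + jcst t * q)) <= e -> nj p <= A -> nj q <= A ->
  nj (half (a + b) - g) <= e + A * t.
Proof.
  intros Ht Ha Hb Hp Hq.
  replace (half (a + b) - g)%J with (half ((a - (g + jcst t * p)) + (b - (g + jcst t * q)) + jcst t * (p + q)))%J
    by (apply jet_ext; simpl; field).
  eapply Rle_trans; [apply nj_half|].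
  pose proof (nj_add ((a - (g + jcst t * p)) + (b - (g + jcst t * q))) (jcst t * (p + q))) as N1.
  pose proof (nj_add (a - (g + jcst t * p)) (b - (g + jcst t * q))) as N2.
  pose proof (nj_add p q) as N3.
  assert (N4 : nj (jcst t * (p + q)) <= t * (2 * A)) by (apply nj_le_mul; [exact Ht|lra]).
  lra.
Qed.

Lemma source_remainder (t : R) (s : state) (i : comp) (x : R) :
  0 < t <= delta -> invariant M lam t s ->
  nj (source lam s i x - slope lam i x) <= match i with cU | cV => 2 * A * t | _ => 5 / 4 * (M * t) + K * t end.
Proof.
  intros Ht Hi. pose proof (inv_adm t s x Ht Hi) as Hp. pose proof (M_le1 t Ht) as HM.
  destruct HCs as [h1 h2 h3 h4 h5 h6 h7 h8 h9 h10 h11].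
  assert (E : M * t ^ 2 <= t).
  { simpl. rewrite Rmult_1_r, <- Rmult_assoc. rewrite <- (Rmult_1_l t) at 3. apply Rmult_le_compat_r; lra. }
  pose proof (fun i => proj1 (slope_stable lam i lam_le1)) as HS.
  assert (Hc : srcs_close K (point_at lam t s x) (M * t ^ 2)).
  { apply h10; [exact Hp|apply (proj2 (Hi cR1))|apply (proj2 (Hi cS1))|apply (proj2 (Hi cR2))|apply (proj2 (Hi cS2))]. }
  (* [cs_Kd] keeps K (t + |lambda|) below 1 / 4, so theta is at most 5 / 4. *)
  assert (F : (1 + K * (t + Rabs lam)) * (M * t ^ 2 / t) + K * t <= 5 / 4 * (M * t) + K * t).
  { replace (M * t ^ 2 / t) with (M * t) by (field; lra). apply Rplus_le_compat_r.
    apply Rmult_le_compat_r; [apply Rmult_le_pos; lra|].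
    assert (K * (t + Rabs lam) <= K * (delta + lam0)) by (apply Rmult_le_compat_l; lra). lra. }
  (* The averages of R and S differ from psi by at most A t from the slopes and t from the
     remainders; A >= 1 merges these into 2 A t. *)
  assert (E' : t + A * t <= 2 * A * t).
  { assert (1 * t <= A * t) by (apply Rmult_le_compat_r; lra). lra. }
  destruct Hc as (k1 & k2 & k3 & k4). simpl in k1, k2, k3, k4, F.
  destruct i.
  - eapply Rle_trans; [apply (half_sum_remainder _ _ _ (jf11 lam x) (jf11 lam x) t (M * t ^ 2))|lra];
      [lra|apply (proj2 (Hi cR1))|apply (proj2 (Hi cS1))|apply (HS cR1)|apply (HS cR1)].
  - eapply Rle_trans; [apply (half_sum_remainder _ _ _ (jf21 x) (jf22 x) t (M * t ^ 2))|lra];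
      [lra|apply (proj2 (Hi cR2))|apply (proj2 (Hi cS2))|apply (HS cR2)|apply (HS cS2)].
  - eapply Rle_trans; [exact k1|exact F].
  - eapply Rle_trans; [exact k2|exact F].
  - eapply Rle_trans; [exact k3|exact F].
  - eapply Rle_trans; [exact k4|exact F].
Qed.

Lemma speed_bound (t : R) (s : state) (i : comp) (x : R) :
  0 < t <= delta -> invariant M lam t s -> nj (speed s i x) <= Kc * t.
Proof.
  intros Ht Hi. pose proof (cs_c _ _ _ _ _ HCs _ (inv_adm t s x Ht Hi)) as H. simpl in H.
  pose proof (nj_pos (jc (s cU x))).
  destruct i; simpl; rewrite ?nj_opp, ?nj_cst, ?Rabs_R0; lra.
Qed.

Lemma invariant_step (t h : R) (s : state) :
  0 < h -> 0 < t -> t + h <= delta -> invariant M lam t s ->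
  invariant M lam (t + h) (fun i => advance h (speed s i) (s i) (source lam s i)).
Proof.
  intros Hh Ht Hth Hi i.
  assert (Htd : 0 < t <= delta) by lra.
  split.
  - apply C2_advance; [apply C2_speed, (proj1 (Hi cU))|apply (proj1 (Hi i))|].
    apply C2_source; [intros j; apply (proj1 (Hi j))|]. intros x.
    apply (c_nonzero (point_at lam t s x)), inv_adm; assumption.
  - intros x. pose proof (source_remainder t s i x Htd Hi) as Hs.
    pose proof (speed_bound t s i x Htd Hi) as Hb.
    destruct HCs as [h1 h2 h3 h4 h5 h6 h7 h8 h9 h10 h11].
    assert (Kd : 16 * Kc * (t + h) <= 1).
    { eapply Rle_trans; [|exact h8]. apply Rmult_le_compat_l; lra. }
    pose proof (HA lam lam_le1) as (g1 & g2 & _).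
    pose proof (slope_stable lam i lam_le1) as g3.
    assert (UV : speed s i = (fun _ => 0%J) -> nj (source lam s i x - slope lam i x) <= 2 * A * t ->
      nj (s i x - (base i x + jcst t * slope lam i x)) <= 2 * A * t ^ 2 ->
      nj (advance h (speed s i) (s i) (source lam s i) x - (base i x + jcst (t + h) * slope lam i x)) <= 2 * A * (t + h) ^ 2).
    { intros Es Hsr Hr. unfold advance. rewrite Es, shift_zero, jcst_add.
      replace (s i x + jcst h * source lam s i x - (base i x + (jcst t + jcst h) * slope lam i x))%J
        with ((s i x - (base i x + jcst t * slope lam i x)) + jcst h * (source lam s i x - slope lam i x))%J by ring.
      eapply Rle_trans; [apply nj_add|].
      pose proof (nj_le_mul _ h _ (Rlt_le _ _ Hh) Hsr).
      assert (0 <= A * (h * t)) by (repeat apply Rmult_le_pos; lra).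
      assert (0 <= A * (h * h)) by (repeat apply Rmult_le_pos; lra).
      simpl in *. lra. }
    pose proof (proj2 (Hi i)) as Hr.
    destruct i; try (apply UV; [reflexivity|exact Hs|apply Hr]);
      unfold rem_cst; eapply advance_remainder with (K := K) (Kc := Kc); solve [eassumption|lra].
Qed.

Lemma scheme_invariant (h : R) (k : nat) : 0 < h -> INR (S k) * h <= delta -> invariant M lam (INR (S k) * h) (scheme lam h (S k)).
Proof.
  intros Hh. induction k as [|k IH]; intros Hk.
  - replace (INR 1 * h) with h by (simpl; ring). apply invariant_first; [apply (cs_M _ _ _ _ _ HCs)|exact Hh].
  - assert (E : INR (S (S k)) * h = INR (S k) * h + h) by (rewrite (S_INR (S k)); ring).
    rewrite E in *. apply (invariant_step (INR (S k) * h) h (scheme lam h (S k))); try assumption.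
    + apply Rmult_lt_0_compat; [apply lt_0_INR; lia|exact Hh].
    + apply IH. lra.
Qed.

End Bounds.

(** * Convergence of the scheme *)

(** The first two estimates make values and first derivatives Lipschitz in time, each at the price
    of one x-derivative, hence the bound on [j2]. The third is consistency: a Taylor expansion at
    the foot of the characteristic. *)
Lemma advance_increment (h B N : R) (b F src : R -> jet) (x : R) :
  0 < h -> C2 F -> (forall y, Rabs (j1 (F y)) <= B) -> (forall y, Rabs (j2 (F y)) <= B) ->
  nj (b x) <= 1 -> nj (src x) <= N ->
  Rabs (j0 (advance h b F src x) - j0 (F x)) <= (2 * B + N) * h /\
  Rabs (j1 (advance h b F src x) - j1 (F x)) <= (2 * B + N) * h /\
  Rabs (j0 (advance h b F src x) - j0 (F x) - h * (j0 (b x) * j1 (F x) + j0 (src x))) <= B * (h * h).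
Proof.
  intros Hh HF H1 H2 Hb Hs. simpl.
  pose proof (Rle_trans _ _ _ (nj_j0 _) Hb) as b0. pose proof (Rle_trans _ _ _ (nj_j1 _) Hb) as b1.
  pose proof (Rle_trans _ _ _ (nj_j0 _) Hs) as s0. pose proof (Rle_trans _ _ _ (nj_j1 _) Hs) as s1.
  assert (HB : 0 <= B) by (eapply Rle_trans; [apply Rabs_pos|apply (H1 x)]).
  set (d := h * j0 (b x)).
  assert (Hd : Rabs d <= h).
  { unfold d. rewrite Rabs_mult, Rabs_pos_eq by lra. rewrite <- (Rmult_1_r h) at 2. apply Rmult_le_compat_l; lra. }
  assert (Hd1 : Rabs (h * j1 (b x)) <= h).
  { rewrite Rabs_mult, Rabs_pos_eq by lra. rewrite <- (Rmult_1_r h) at 2. apply Rmult_le_compat_l; lra. }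
  assert (Hs0 : Rabs (h * j0 (src x)) <= h * N) by (rewrite Rabs_mult, Rabs_pos_eq by lra; apply Rmult_le_compat_l; lra).
  assert (Hs1 : Rabs (h * j1 (src x)) <= h * N) by (rewrite Rabs_mult, Rabs_pos_eq by lra; apply Rmult_le_compat_l; lra).
  assert (I0 := increment_bound (fun y => j0 (F y)) (fun y => j1 (F y)) B x d (fun y => proj1 (HF y)) H1).
  assert (I1 := increment_bound (fun y => j1 (F y)) (fun y => j2 (F y)) B x d (fun y => proj2 (HF y)) H2).
  assert (I2 := taylor_bound (fun y => j0 (F y)) (fun y => j1 (F y)) (fun y => j2 (F y)) B x d
    (fun y => proj1 (HF y)) (fun y => proj2 (HF y)) H2).
  cbv beta in I0, I1, I2.
  assert (HBd : B * Rabs d <= B * h) by (apply Rmult_le_compat_l; lra).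
  assert (HBh : 0 <= B * h) by (apply Rmult_le_pos; lra).
  split; [|split].
  - replace (j0 (F (x + d)) + h * j0 (src x) - j0 (F x)) with ((j0 (F (x + d)) - j0 (F x)) + h * j0 (src x)) by ring.
    eapply Rle_trans; [apply Rabs_triang|]. lra.
  - match goal with |- Rabs ?e <= _ => replace e with
      ((j1 (F (x + d)) - j1 (F x)) + (j1 (F (x + d)) * (h * j1 (b x)) + h * j1 (src x))) by ring end.
    eapply Rle_trans; [apply Rabs_triang|].
    pose proof (Rabs_triang (j1 (F (x + d)) * (h * j1 (b x))) (h * j1 (src x))) as T.
    rewrite (Rabs_mult (j1 (F (x + d)))) in T.
    assert (Rabs (j1 (F (x + d))) * Rabs (h * j1 (b x)) <= B * h) by (apply Rmult_le_compat; try apply Rabs_pos; [apply H1|exact Hd1]).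
    lra.
  - replace (j0 (F (x + d)) + h * j0 (src x) - j0 (F x) - h * (j0 (b x) * j1 (F x) + j0 (src x)))
      with (j0 (F (x + d)) - j0 (F x) - d * j1 (F x)) by (unfold d; ring).
    eapply Rle_trans; [exact I2|]. apply Rmult_le_compat_l; [exact HB|].
    replace (d * d) with (Rabs d * Rabs d) by (rewrite <- Rabs_mult; apply Rabs_pos_eq, Rle_0_sqr).
    apply Rmult_le_compat; try apply Rabs_pos; exact Hd.
Qed.

(* Time derivative of component [i] prescribed by the system, from the values [w] of the components and the
   [x]-derivative [p] of component [i]. *)
Definition rate (lam : R) (i : comp) (w : comp -> R) (p : R) : R :=
  j0 (speed (fun j _ => jcst (w j)) i 0) * p + j0 (source lam (fun j _ => jcst (w j)) i 0).

Lemma tends_rate {T : Type} (F : (T -> Prop) -> Prop) (lam : R) (i : comp) (w : T -> comp -> R)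
    (p : T -> R) (l : comp -> R) (m : R) :
  is_filter F -> (forall j, tends F (fun q => w q j) (l j)) -> tends F p m -> Dc 0%nat (l cU) <> 0 ->
  tends F (fun q => rate lam i (w q) (p q)) (rate lam i l m).
Proof.
  intros HF Hw Hp Hn.
  assert (Ha : Da 0%nat (l cU) <> 0) by exact (a_nonzero (jcst (l cU))).
  destruct i; unfold rate; simpl;
  repeat match goal with
  | |- tends F (fun q => w q _) _ => apply Hw
  | |- tends F (fun q => p q) _ => apply Hp
  | |- tends F (fun q => _ + _) _ => apply (tends_add F HF)
  | |- tends F (fun q => _ * _) _ => apply (tends_mul F HF)
  | |- tends F (fun q => - _) _ => apply (tends_opp F HF)
  | |- tends F (fun q => / Dc 0%nat _) _ => apply (tends_inv F HF); [exact Hn|]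
  | |- tends F (fun q => / Da 0%nat _) _ => apply (tends_inv F HF); [exact Ha|]
  | |- tends F (fun q => Dc _ _) _ => apply (tends_derivable F HF Dc); [exact HDc|]
  | |- tends F (fun q => Da _ _) _ => apply (tends_derivable F HF Da); [exact HDa|]
  | |- tends F (fun q => _) _ => apply (tends_cst F HF)
  end; apply Hp.
Qed.

Section Convergence.
Variables lam0 delta M K Kc : R.
Hypothesis HCs : constants lam0 delta M K Kc.
Variable lam : R.
Hypothesis Hlam : Rabs lam <= lam0.
Variable U : (nat -> Prop) -> Prop.
Hypothesis HU : free_ultra U.

Let iter (i : comp) (n k : nat) : R -> jet := scheme lam (hstep n) k i.
Let incr (i : comp) (n k : nat) (x : R) : R :=
  rate lam i (fun j => j0 (iter j n k x)) (j1 (iter i n k x)).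
(** [KB] bounds second derivatives: twice the distance 3 A + M to [base], plus 2 A for [base]
    itself. [KS] is A for the slope plus the distance of the source from it at t <= 1, and [KT] is
    the resulting Lipschitz constant in time. *)
Let KB : R := 8 * A + 2 * M.
Let KS : R := 3 * A + 2 * M + K.
Let KT : R := 2 * KB + KS.

Lemma delta_le1 : 0 < delta <= 1.
Proof. pose proof (cs_delta _ _ _ _ _ HCs). lra. Qed.

Lemma iter_invariant (n k : nat) : INR (S k) * hstep n <= delta ->
  invariant M lam (INR (S k) * hstep n) (scheme lam (hstep n) (S k)).
Proof. intros H. apply (scheme_invariant lam0 delta M K Kc HCs lam Hlam); [apply hstep_pos|exact H]. Qed.

Lemma time_pos (n k : nat) : 0 < INR (S k) * hstep n.
Proof. apply Rmult_lt_0_compat; [apply lt_0_INR; lia|apply hstep_pos]. Qed.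

Lemma iter_C2 (i : comp) (n k : nat) : INR k * hstep n <= delta -> C2 (iter i n k).
Proof. destruct k as [|k]; intros H; [apply C2_base|apply (iter_invariant n k H)]. Qed.

Lemma iter_remainder (i : comp) (n k : nat) (x : R) : INR k * hstep n <= delta ->
  nj (iter i n k x - (base i x + jcst (INR k * hstep n) * slope lam i x)) <= rem_cst M i * (INR k * hstep n) ^ 2.
Proof.
  destruct k as [|k]; intros H; [|apply (iter_invariant n k H)].
  simpl INR. rewrite Rmult_0_l. unfold iter; simpl scheme.
  replace (base i x - (base i x + 0 * slope lam i x))%J with (jcst 0) by ring.
  rewrite nj_cst, Rabs_R0. simpl. lra.
Qed.

Lemma rem_cst_bound (i : comp) : 0 <= rem_cst M i <= 2 * A + M.
Proof. pose proof (cs_M _ _ _ _ _ HCs). destruct i; simpl; lra. Qed.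

Lemma nj_slope (i : comp) (x : R) : nj (slope lam i x) <= A.
Proof. apply slope_stable. apply (lam_le1 lam0 delta M K Kc HCs lam Hlam). Qed.

Lemma iter_near_base (i : comp) (n k : nat) (x : R) : INR k * hstep n <= delta ->
  nj (iter i n k x - base i x) <= 3 * A + M.
Proof.
  intros H. pose proof (iter_remainder i n k x H) as Hr. pose proof delta_le1.
  pose proof (hstep_pos n). pose proof (pos_INR k).
  set (t := INR k * hstep n) in *. assert (Ht : 0 <= t) by (apply Rmult_le_pos; lra).
  replace (iter i n k x - base i x)%J
    with ((iter i n k x - (base i x + jcst t * slope lam i x)) + jcst t * slope lam i x)%J by ring.
  eapply Rle_trans; [apply nj_add|].
  pose proof (nj_le_mul (slope lam i x) t A Ht (nj_slope i x)).
  assert (t * A <= 1 * A) by (apply Rmult_le_compat_r; lra).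
  pose proof (rem_cst_bound i).
  assert (rem_cst M i * t ^ 2 <= (2 * A + M) * 1).
  { apply Rmult_le_compat; try lra; [apply pow_le, Ht|]. simpl. rewrite Rmult_1_r. rewrite <- (Rmult_1_r 1). apply Rmult_le_compat; lra. }
  lra.
Qed.

Lemma base_derivatives (i : comp) (x : R) : Rabs (j1 (base i x)) <= 2 * A /\ Rabs (j2 (base i x)) <= 2 * A.
Proof.
  destruct (HA lam (lam_le1 lam0 delta M K Kc HCs lam Hlam)) as ([p1 _] & [p2 _] & [p3 _] & _).
  specialize (p1 x); specialize (p2 x); specialize (p3 x).
  destruct i; simpl.
  - rewrite Rabs_R0. lra.
  - pose proof (nj_j0 (jdphi2 x)) as q0. pose proof (nj_j1 (jdphi2 x)) as q1'. simpl in q0, q1'. lra.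
  - pose proof (nj_j1 (jpsi1 x)) as q0. pose proof (nj_j2 (jpsi1 x)) as q1'. simpl in q0, q1'. lra.
  - pose proof (nj_j1 (jpsi1 x)) as q0. pose proof (nj_j2 (jpsi1 x)) as q1'. simpl in q0, q1'. lra.
  - pose proof (nj_j1 (jpsi2 x)) as q0. pose proof (nj_j2 (jpsi2 x)) as q1'. simpl in q0, q1'. lra.
  - pose proof (nj_j1 (jpsi2 x)) as q0. pose proof (nj_j2 (jpsi2 x)) as q1'. simpl in q0, q1'. lra.
Qed.

Lemma iter_bounds (i : comp) (n k : nat) (x : R) : INR k * hstep n <= delta ->
  Rabs (j0 (iter i n k x) - j0 (base i x)) <= KB /\
  Rabs (j1 (iter i n k x)) <= KB /\ Rabs (j2 (iter i n k x)) <= KB.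
Proof.
  intros H. pose proof (iter_near_base i n k x H) as N. destruct (base_derivatives i x) as [b1 b2].
  pose proof (cs_M _ _ _ _ _ HCs) as HM.
  set (e := (iter i n k x - base i x)%J) in *.
  pose proof (nj_j0 e) as e0. pose proof (nj_j1 e) as e1. pose proof (nj_j2 e) as e2.
  assert (E1 : j1 (iter i n k x) = j1 e + j1 (base i x)) by (simpl; ring).
  assert (E2 : j2 (iter i n k x) = j2 e + j2 (base i x)) by (simpl; ring).
  assert (E0 : j0 (iter i n k x) - j0 (base i x) = j0 e) by (simpl; ring).
  rewrite E0, E1, E2. unfold KB.
  pose proof (Rabs_triang (j1 e) (j1 (base i x))). pose proof (Rabs_triang (j2 e) (j2 (base i x))).
  repeat split; lra.
Qed.

Lemma KB_pos : 0 <= KB.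
Proof. pose proof (cs_M _ _ _ _ _ HCs). unfold KB. lra. Qed.

Lemma KS_pos : 0 <= KS.
Proof. pose proof (cs_M _ _ _ _ _ HCs). pose proof (cs_K _ _ _ _ _ HCs). unfold KS. lra. Qed.

Lemma source_near_slope (i : comp) (n k : nat) (x : R) : INR (S k) * hstep n <= delta ->
  nj (source lam (scheme lam (hstep n) (S k)) i x - slope lam i x) <= (2 * A + 2 * M + K) * (INR (S k) * hstep n).
Proof.
  intros H. pose proof (time_pos n k) as Ht.
  pose proof (source_remainder lam0 delta M K Kc HCs lam Hlam _ _ i x (conj Ht H) (iter_invariant n k H)) as S.
  pose proof (cs_M _ _ _ _ _ HCs). pose proof (cs_K _ _ _ _ _ HCs).
  eapply Rle_trans; [exact S|]. set (t := INR (Datatypes.S k) * hstep n) in *.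
  assert (0 <= M * t) by (apply Rmult_le_pos; lra).
  assert (0 <= K * t) by (apply Rmult_le_pos; lra).
  assert (0 <= A * t) by (apply Rmult_le_pos; lra).
  destruct i; lra.
Qed.

Lemma iter_step (i : comp) (n k : nat) (x : R) : INR (S k) * hstep n <= delta ->
  Rabs (j0 (iter i n (S k) x) - j0 (iter i n k x)) <= KT * hstep n /\
  Rabs (j1 (iter i n (S k) x) - j1 (iter i n k x)) <= KT * hstep n.
Proof.
  intros H. pose proof (hstep_pos n) as Hh. pose proof KB_pos as Hk.
  pose proof (cs_M _ _ _ _ _ HCs) as HM. pose proof (cs_K _ _ _ _ _ HCs) as HK. pose proof delta_le1 as Hd.
  destruct k as [|k].
  - destruct (advance_increment (hstep n) KB KS (fun _ => 0%J) (base i) (slope lam i) x) as (a1 & a2 & _); try tauto.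
    + apply C2_base.
    + intros y. destruct (base_derivatives i y). unfold KB. lra.
    + intros y. destruct (base_derivatives i y). unfold KB. lra.
    + rewrite nj_cst, Rabs_R0. lra.
    + eapply Rle_trans; [apply nj_slope|]. unfold KS. lra.
  - assert (Hk1 : INR (S k) * hstep n <= delta) by (rewrite (S_INR (S k)) in H; lra).
    pose proof (time_pos n k) as Ht.
    destruct (advance_increment (hstep n) KB KS (speed (scheme lam (hstep n) (S k)) i) (iter i n (S k))
      (source lam (scheme lam (hstep n) (S k)) i) x) as (a1 & a2 & _); try tauto.
    + apply iter_C2, Hk1.
    + intros y. apply iter_bounds, Hk1.
    + intros y. apply iter_bounds, Hk1.
    + eapply Rle_trans; [apply (speed_bound lam0 delta M K Kc HCs lam Hlam _ _ i x (conj Ht Hk1) (iter_invariant n k Hk1))|].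
      pose proof (cs_Kcd _ _ _ _ _ HCs). pose proof (cs_Kc _ _ _ _ _ HCs) as HKc.
      assert (Kc * (INR (S k) * hstep n) <= Kc * delta) by (apply Rmult_le_compat_l; lra).
      assert (0 <= Kc * delta) by (apply Rmult_le_pos; lra). lra.
    + pose proof (source_near_slope i n k x Hk1) as N.
      replace (source lam (scheme lam (hstep n) (S k)) i x)
        with ((source lam (scheme lam (hstep n) (S k)) i x - slope lam i x) + slope lam i x)%J by ring.
      eapply Rle_trans; [apply nj_add|]. pose proof (nj_slope i x).
      assert ((2 * A + 2 * M + K) * (INR (S k) * hstep n) <= (2 * A + 2 * M + K) * 1) by (apply Rmult_le_compat_l; lra).
      unfold KS. lra.
Qed.

Lemma iter_rate (i : comp) (n k : nat) (x : R) : INR (S (S k)) * hstep n <= delta ->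
  Rabs (j0 (iter i n (S (S k)) x) - j0 (iter i n (S k) x) - hstep n * incr i n (S k) x) <= KT * (hstep n * hstep n).
Proof.
  intros H. pose proof (hstep_pos n) as Hh. pose proof KB_pos as Hk. pose proof KS_pos as Hs.
  assert (Hk1 : INR (S k) * hstep n <= delta) by (rewrite (S_INR (S k)) in H; lra).
  pose proof (time_pos n k) as Ht. pose proof delta_le1 as Hd.
  destruct (advance_increment (hstep n) KB (nj (source lam (scheme lam (hstep n) (S k)) i x))
    (speed (scheme lam (hstep n) (S k)) i) (iter i n (S k))
    (source lam (scheme lam (hstep n) (S k)) i) x) as (_ & _ & a3); try tauto; try lra.
  - apply iter_C2, Hk1.
  - intros y. apply iter_bounds, Hk1.
  - intros y. apply iter_bounds, Hk1.
  - eapply Rle_trans; [apply (speed_bound lam0 delta M K Kc HCs lam Hlam _ _ i x (conj Ht Hk1) (iter_invariant n k Hk1))|].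
    pose proof (cs_Kcd _ _ _ _ _ HCs). pose proof (cs_Kc _ _ _ _ _ HCs) as HKc.
    assert (Kc * (INR (S k) * hstep n) <= Kc * delta) by (apply Rmult_le_compat_l; lra).
    assert (0 <= Kc * delta) by (apply Rmult_le_pos; lra). lra.
  (* Values of speed and source depend on values only, so the constant jets in [rate] give the same
     number as the iterates. *)
  - replace (incr i n (S k) x) with
      (j0 (speed (scheme lam (hstep n) (S k)) i x) * j1 (iter i n (S k) x) + j0 (source lam (scheme lam (hstep n) (S k)) i x))
      by (destruct i; reflexivity).
    eapply Rle_trans; [exact a3|]. apply Rmult_le_compat_r; [apply Rmult_le_pos; lra|]. unfold KT; lra.
Qed.

(** * The limit functions and their regularity up to t = 0 *)

Let sol (i : comp) : R -> R -> R := zlim U (iter i).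
Let solx (i : comp) : R -> R -> R := plim U (iter i).
(** At t = 0 the rate would divide by c(phi1) = 0, so the prescribed initial derivative takes its
    place. *)
Let solt (i : comp) (t x : R) : R :=
  if Req_EM_T t 0 then j0 (slope lam i x) else rate lam i (fun j => sol j t x) (solx i t x).

Lemma KT_pos : 0 <= KT.
Proof. pose proof KB_pos. pose proof KS_pos. unfold KT. lra. Qed.

Lemma KB_KT : KB <= KT.
Proof. pose proof KB_pos. pose proof KS_pos. unfold KT. lra. Qed.

Lemma sol_tends (i : comp) (t x : R) : 0 <= t <= delta -> tends U (fun n => zn (iter i) n t x) (sol i t x).
Proof.
  apply (zlim_tends U HU delta KB (iter i) (fun x => j0 (base i x))).
  intros n k y H. apply iter_bounds, H.
Qed.

Lemma tends_unique (f : nat -> R) (l m : R) : tends U f l -> tends U f m -> l = m.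
Proof.
  intros H1 H2. pose proof (fu_filter _ HU) as HF.
  apply Rle_antisym; [apply (tends_le U HF f f l m)|apply (tends_le U HF f f m l)];
    try assumption; try apply (fu_proper _ HU); apply (flt_all _ HF); intros; apply Rle_refl.
Qed.

Lemma sol_0 (i : comp) (x : R) : sol i 0 x = j0 (base i x).
Proof.
  pose proof delta_le1. apply (tends_unique (fun n => zn (iter i) n 0 x)); [apply sol_tends; lra|].
  eapply (tends_ext U (fu_filter _ HU)); [apply (tends_cst U (fu_filter _ HU))| |reflexivity].
  intros n. unfold zn. rewrite idx_0. reflexivity.
Qed.

(** The invariant survives the limit. It yields both the time derivative at t = 0 and the lower
    bound on |c(u)| that makes the system regular for t > 0. *)
Lemma sol_remainder (i : comp) (t x : R) : 0 <= t <= delta ->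
  Rabs (sol i t x - (j0 (base i x) + t * j0 (slope lam i x))) <= rem_cst M i * t ^ 2.
Proof.
  intros Ht. pose proof (fu_filter _ HU) as HF.
  eapply (tends_le U HF (fun n => Rabs (zn (iter i) n t x + - (j0 (base i x) + (INR (idx n t) * hstep n) * j0 (slope lam i x))))
     (fun _ => rem_cst M i * t ^ 2)).
  - apply (fu_proper _ HU).
  - apply (tends_abs U HF). apply (tends_add U HF); [apply sol_tends, Ht|]. apply (tends_opp U HF).
    apply (tends_add U HF); [apply (tends_cst U HF)|]. apply (tends_mul U HF); [|apply (tends_cst U HF)].
    intros eps He. eapply (flt_imp _ HF); [|apply (hstep_eventually U HU eps He)]. cbv beta. intros n Hn.
    destruct (idx_spec n t ltac:(lra)). apply Rabs_def1; lra.
  - apply (tends_cst U HF).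
  - apply (flt_all _ HF). intros n. destruct (idx_spec n t ltac:(lra)) as [t1 t2].
    pose proof (iter_remainder i n (idx n t) x ltac:(lra)) as Hr.
    eapply Rle_trans; [|eapply Rle_trans; [exact (Rle_trans _ _ _ (nj_j0 _) Hr)|]].
    + right. f_equal.
    + apply Rmult_le_compat_l; [apply rem_cst_bound|]. apply pow_incr. split; [|exact t1].
      apply Rmult_le_pos; [apply pos_INR|left; apply hstep_pos].
Qed.

Lemma c_sol_nonzero (t x : R) : 0 < t <= delta -> Dc 0%nat (sol cU t x) <> 0.
Proof.
  intros Ht E. pose proof (cs_delta _ _ _ _ _ HCs).
  pose proof (sol_remainder cU t x ltac:(lra)) as H1. simpl in H1.
  pose proof (c_lower_value t x (sol cU t x) ltac:(lra) H1) as H2. rewrite E, Rabs_R0 in H2.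
  assert (0 < m0 * psi0 / 2 * t).
  { apply Rmult_lt_0_compat; [|lra]. apply Rdiv_lt_0_compat; [apply Rmult_lt_0_compat; lra|lra]. }
  lra.
Qed.

Lemma incr_near (i : comp) (t x : R) : 0 < t <= delta ->
  tends (near_time U delta t) (fun q => incr i (fst q) (idx (fst q) (snd q)) x)
    (rate lam i (fun j => sol j t x) (solx i t x)).
Proof.
  intros Ht. pose proof KT_pos as HKT. pose proof KB_KT.
  apply (tends_rate (near_time U delta t) lam i (fun q j => zn (iter j) (fst q) (snd q) x) (fun q => pn (iter i) (fst q) (snd q) x)).
  - apply near_time_filter, HU.
  - intros j. apply (zn_near U HU delta KT (iter j) (fun x => j0 (base j x))); try assumption; try lra.
    + intros n k y Hk. destruct (iter_bounds j n k y Hk). lra.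
    + intros n k y Hk. apply iter_step, Hk.
  - apply (pn_near U HU delta KT (iter i)); try assumption; try lra.
    + intros n k y Hk. destruct (iter_bounds i n k y Hk) as (_ & h & _). lra.
    + intros n k y Hk. apply iter_step, Hk.
  - apply c_sol_nonzero, Ht.
Qed.

Lemma sol_C0 (i : comp) : cont_strip delta (sol i) /\ cont_strip delta (solx i) /\ pderiv_x delta (sol i) (solx i).
Proof.
  pose proof KT_pos as HKT. pose proof KB_KT.
  assert (b0 : forall n k y, INR k * hstep n <= delta -> Rabs (j0 (iter i n k y) - j0 (base i y)) <= KT)
    by (intros n k y Hk; destruct (iter_bounds i n k y Hk); lra).
  assert (b1 : forall n k y, INR k * hstep n <= delta -> Rabs (j1 (iter i n k y)) <= KT)
    by (intros n k y Hk; destruct (iter_bounds i n k y Hk) as (_ & h & _); lra).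
  assert (b2 : forall n k y, INR k * hstep n <= delta -> Rabs (j2 (iter i n k y)) <= KT)
    by (intros n k y Hk; destruct (iter_bounds i n k y Hk) as (_ & _ & h); lra).
  assert (s0 := fun n k y Hk => proj1 (iter_step i n k y Hk)).
  assert (s1 := fun n k y Hk => proj2 (iter_step i n k y Hk)).
  pose proof (iter_C2 i) as c2.
  split; [|split].
  - apply (zlim_cont U HU delta KT (iter i) (fun x => j0 (base i x))); assumption.
  - apply (plim_cont U HU delta KT (iter i)); assumption.
  - apply (zlim_pderiv_x U HU delta KT (iter i) (fun x => j0 (base i x))); assumption.
Qed.

Lemma quotient_bound (a h C eps : R) : h <> 0 -> 0 <= C -> Rabs a <= C * h ^ 2 -> Rabs h < eps / (C + 1) -> 0 < eps ->
  Rabs (a / h) < eps.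
Proof.
  intros Hh HC Ha Hd He. unfold Rdiv. rewrite Rabs_mult, Rabs_inv.
  assert (P : 0 < Rabs h) by (apply Rabs_pos_lt, Hh).
  apply Rle_lt_trans with (C * h ^ 2 * / Rabs h).
  - apply Rmult_le_compat_r; [left; apply Rinv_0_lt_compat, P|exact Ha].
  - rewrite <- (pow2_abs h). replace (C * Rabs h ^ 2 * / Rabs h) with (C * Rabs h) by (field; lra).
    assert (E : (C + 1) * (eps / (C + 1)) = eps) by (field; lra).
    assert (C * Rabs h <= C * (eps / (C + 1))) by (apply Rmult_le_compat_l; lra).
    assert (0 < eps / (C + 1)) by (apply Rdiv_lt_0_compat; lra). lra.
Qed.

Lemma sol_pderiv_t (i : comp) : pderiv_t delta (sol i) (solt i).
Proof.
  intros t x Ht eps He. unfold solt. destruct (Req_EM_T t 0) as [->|Hn].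
  (* On the initial line differentiability is the quadratic remainder bound itself; only for t > 0
     is the scheme's consistency used. *)
  - destruct (rem_cst_bound i) as [HC _].
    exists (eps / (rem_cst M i + 1)). split; [apply Rdiv_lt_0_compat; lra|].
    intros h Hh Hhd Hth. rewrite Rplus_0_l in *.
    replace ((sol i h x - sol i 0 x) / h - j0 (slope lam i x))
      with ((sol i h x - (j0 (base i x) + h * j0 (slope lam i x))) / h)
      by (rewrite sol_0; field; exact Hh).
    apply (quotient_bound _ h (rem_cst M i)); try assumption. apply sol_remainder, Hth.
  - assert (Ht' : 0 < t <= delta) by lra. pose proof KT_pos as HKT. pose proof KB_KT.
    apply (zlim_pderiv_t U HU delta KT (iter i) (incr i) (fun x => j0 (base i x))); try assumption.
    + intros n k y Hk. destruct (iter_bounds i n k y Hk). lra.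
    + intros n k y Hk. apply iter_rate, Hk.
    + apply incr_near, Ht'.
Qed.

Let KR : R := Kc * KB + (2 * A + 2 * M + K).

Lemma KR_pos : 0 <= KR.
Proof.
  pose proof (cs_M _ _ _ _ _ HCs). pose proof (cs_K _ _ _ _ _ HCs). pose proof (cs_Kc _ _ _ _ _ HCs).
  pose proof (Rmult_le_pos _ _ H1 KB_pos). unfold KR. lra.
Qed.

(** The transport term is at most Kc t times [KB], and the source differs from the slope by O(t).
    This is what makes the time derivative continuous at t = 0, across the two branches of
    [solt]. *)
Lemma rate_near_slope (i : comp) (t x : R) : 0 < t <= delta ->
  Rabs (rate lam i (fun j => sol j t x) (solx i t x) - j0 (slope lam i x)) <= KR * t.
Proof.
  intros Ht. pose proof (fu_filter _ HU) as HF. pose proof KR_pos as HKR.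
  eapply (tends_le U HF (fun n => Rabs (incr i n (idx n t) x + - j0 (slope lam i x))) (fun _ => KR * t)).
  - apply (fu_proper _ HU).
  - apply (tends_abs U HF). apply (tends_add U HF); [|apply (tends_cst U HF)].
    intros eps He. destruct (incr_near i t x Ht eps He) as [d [Hd H]].
    eapply (flt_imp _ HF); [|exact H]. cbv beta. intros n Hn. apply (Hn t); [lra|].
    rewrite Rminus_diag, Rabs_R0. exact Hd.
  - apply (tends_cst U HF).
  (* For hstep n < t the grid index is positive, so that the estimates on the true speed and source
     apply. *)
  - eapply (flt_imp _ HF); [|apply (hstep_eventually U HU t (proj1 Ht))]. cbv beta. intros n Hn.
    destruct (idx_spec n t ltac:(lra)) as [t1 t2]. destruct (idx n t) as [|k] eqn:Ek; [simpl in t2; lra|].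
    assert (Hk : INR (S k) * hstep n <= delta) by lra. pose proof (time_pos n k) as Hp.
    replace (incr i n (S k) x) with
      (j0 (speed (scheme lam (hstep n) (S k)) i x) * j1 (iter i n (S k) x) + j0 (source lam (scheme lam (hstep n) (S k)) i x))
      by (destruct i; reflexivity).
    pose proof (speed_bound lam0 delta M K Kc HCs lam Hlam _ _ i x (conj Hp Hk) (iter_invariant n k Hk)) as Hs.
    pose proof (Rle_trans _ _ _ (nj_j0 _) Hs) as Hs0.
    pose proof (Rle_trans _ _ _ (nj_j0 _) (source_near_slope i n k x Hk)) as Hr0.
    set (s0 := j0 (speed (scheme lam (hstep n) (S k)) i x)) in *.
    change (j0 (source lam (scheme lam (hstep n) (S k)) i x - slope lam i x))
      with (j0 (source lam (scheme lam (hstep n) (S k)) i x) + - j0 (slope lam i x)) in Hr0.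
    rewrite Rplus_assoc. eapply Rle_trans; [apply Rabs_triang|].
    assert (Rabs (s0 * j1 (iter i n (S k) x)) <= Kc * (INR (S k) * hstep n) * KB).
    { rewrite Rabs_mult. apply Rmult_le_compat; try apply Rabs_pos; [exact Hs0|apply iter_bounds, Hk]. }
    assert (KR * (INR (S k) * hstep n) <= KR * t) by (apply Rmult_le_compat_l; lra).
    unfold KR in *. lra.
Qed.

(** Neighbourhoods relative to the strip, as a filter, so that [tends_rate] also proves continuity
    of the limit rate. *)
Definition near_strip (t x : R) (P : R * R -> Prop) : Prop :=
  exists d, 0 < d /\ forall t' x', 0 <= t' <= delta -> Rabs (t' - t) < d -> Rabs (x' - x) < d -> P (t', x').

Lemma near_strip_filter (t x : R) : is_filter (near_strip t x).
Proof.
  split.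
  - intros P H. exists 1. split; [lra|]. intros; apply H.
  - intros P Q [d [Hd H1]] [e [He H2]]. exists (Rmin d e). split; [apply Rmin_glb_lt; assumption|].
    intros t' x' Ht ht hx. split; [apply H1|apply H2]; try assumption;
      (eapply Rlt_le_trans; [eassumption|]); first [apply Rmin_l|apply Rmin_r].
  - intros P Q HPQ [d [Hd H]]. exists d. split; [exact Hd|]. intros; apply HPQ, H; assumption.
Qed.

Lemma cont_strip_tends (f : R -> R -> R) (t x : R) :
  cont_strip delta f -> 0 <= t <= delta -> tends (near_strip t x) (fun q => f (fst q) (snd q)) (f t x).
Proof. intros Hf Ht eps He. destruct (Hf t x Ht eps He) as [d [Hd H]]. exists d. split; [exact Hd|exact H]. Qed.

Lemma solt_cont (i : comp) : cont_strip delta (solt i).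
Proof.
  intros t x Ht eps He. destruct (Req_EM_T t 0) as [->|Hn].
  - assert (Hc : continuity_pt (fun y => j0 (slope lam i y)) x).
    { apply derivable_continuous_pt. exists (j1 (slope lam i x)). apply C2_slope. }
    destruct (Hc (eps / 2) ltac:(lra)) as [d [Hd H]]. pose proof KR_pos as HKR.
    assert (He2 : 0 < eps / 2 / (KR + 1)) by (apply Rdiv_lt_0_compat; lra).
    exists (Rmin d (eps / 2 / (KR + 1))). split; [apply Rmin_glb_lt; assumption|].
    intros t' x' Ht' h1 h2.
    assert (h3 : Rabs (x' - x) < d) by (eapply Rlt_le_trans; [exact h2|apply Rmin_l]).
    assert (h4 : Rabs (t' - 0) < eps / 2 / (KR + 1)) by (eapply Rlt_le_trans; [exact h1|apply Rmin_r]).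
    rewrite Rminus_0_r, Rabs_pos_eq in h4 by lra.
    assert (S : Rabs (j0 (slope lam i x') - j0 (slope lam i x)) < eps / 2).
    { destruct (Req_dec x' x) as [->|Hx]; [rewrite Rminus_diag, Rabs_R0; lra|].
      apply H. split; [split; [exact I|auto]|exact h3]. }
    assert (T : Rabs (solt i t' x' - j0 (slope lam i x')) <= KR * t').
    { unfold solt. destruct (Req_EM_T t' 0) as [->|Hn].
      - rewrite Rminus_diag, Rabs_R0. lra.
      - apply rate_near_slope. lra. }
    assert (E : solt i 0 x = j0 (slope lam i x)) by (unfold solt; destruct (Req_EM_T 0 0); [reflexivity|lra]).
    rewrite E. replace (solt i t' x' - j0 (slope lam i x))
      with ((solt i t' x' - j0 (slope lam i x')) + (j0 (slope lam i x') - j0 (slope lam i x))) by ring.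
    eapply Rle_lt_trans; [apply Rabs_triang|].
    assert ((KR + 1) * (eps / 2 / (KR + 1)) = eps / 2) by (field; lra).
    assert (KR * t' <= KR * (eps / 2 / (KR + 1))) by (apply Rmult_le_compat_l; lra). lra.
  - assert (Ht' : 0 < t <= delta) by lra.
    destruct (tends_rate (near_strip t x) lam i (fun q j => sol j (fst q) (snd q)) (fun q => solx i (fst q) (snd q))
      (fun j => sol j t x) (solx i t x)) with (eps := eps) as [d [Hd H]].
    + apply near_strip_filter.
    + intros j. apply cont_strip_tends; [apply sol_C0|exact Ht].
    + apply cont_strip_tends; [apply sol_C0|exact Ht].
    + apply c_sol_nonzero, Ht'.
    + exact He.
    (* The radius t keeps s away from 0, where [solt] takes its other branch. *)
    + exists (Rmin d t). split; [apply Rmin_glb_lt; lra|]. intros s y Hs h1 h2.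
      assert (h3 : Rabs (s - t) < t) by (eapply Rlt_le_trans; [exact h1|apply Rmin_r]).
      apply Rabs_def2 in h3. unfold solt.
      destruct (Req_EM_T s 0) as [E|_]; [lra|]. destruct (Req_EM_T t 0) as [E|_]; [lra|].
      apply (H s y Hs); eapply Rlt_le_trans; try eassumption; apply Rmin_l.
Qed.

Lemma sol_C1 (i : comp) : C1_strip delta (sol i) (solt i) (solx i).
Proof.
  destruct (sol_C0 i) as (h1 & h2 & h3).
  repeat split; [exact h1|apply sol_pderiv_t|exact h3|apply solt_cont|exact h2].
Qed.

(** For t > 0 the equations hold by the definition of [solt], up to rearrangement; the content lies
    in [sol_C1], which says that [solt] is the time derivative of [sol] and is continuous. *)
Lemma scheme_limit_solves (c a phi2 psi1 psi2 : R -> R) :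
  smooth_with c Dc -> smooth_with a Da -> smooth_with phi2 Dphi2 ->
  smooth_with psi1 Dpsi1 -> smooth_with psi2 Dpsi2 ->
  classical_solution c a Dc Da Dphi2 phi1 phi2 psi1 psi2 lam delta.
Proof.
  intros [Ec _] [Ea _] [Ephi _] [E1 _] [E2 _].
  exists (sol cR1), (sol cS1), (sol cR2), (sol cS2), (sol cU), (sol cV),
    (solt cR1), (solx cR1), (solt cS1), (solx cS1), (solt cR2), (solx cR2), (solt cS2), (solx cS2),
    (solt cU), (solx cU), (solt cV), (solx cV).
  do 6 (split; [apply sol_C1|]). split.
  - intros t x Ht. cbv zeta. rewrite <- Ec, <- Ea.
    pose proof (c_sol_nonzero t x Ht) as Hn. pose proof (a_nonzero (jcst (sol cU t x))) as Hna. simpl in Hna.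
    unfold solt. destruct (Req_EM_T t 0) as [E|_]; [lra|]. unfold rate; simpl.
    repeat split; field; try split; assumption.
  - intros x. rewrite !sol_0. unfold solt. destruct (Req_EM_T 0 0) as [_|E]; [|lra].
    unfold f11, f21, f22. simpl. rewrite <- ?E1, <- ?E2, <- ?Ephi.
    pose proof (a_nonzero (jcst phi1)) as Hna. simpl in Hna.
    repeat split; try reflexivity; field; assumption.
Qed.

End Convergence.

End Sources.

Theorem theorem1p1
  (c a phi2 psi1 psi2 : R -> R) (Dc Da Dphi2 Dpsi1 Dpsi2 : nat -> R -> R)
  (m0 psi0 phi1 : R)
  (Hc : smooth_with c Dc) (Ha : smooth_with a Da)
  (Hcb : forall l : nat, (1 <= l <= 3)%nat -> bounded_fun (Dc l))
  (Hab : forall l : nat, (1 <= l <= 3)%nat -> bounded_fun (Da l))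
  (Hm0 : 0 < m0)
  (Hc1 : forall z, Rabs (Dc 1%nat z) >= m0)
  (Ha0 : forall z, Rabs (a z) >= m0)
  (Hphi1 : c phi1 = 0)
  (Hphi2 : smooth_with phi2 Dphi2) (Hpsi1 : smooth_with psi1 Dpsi1)
  (Hpsi2 : smooth_with psi2 Dpsi2)
  (Hphi2b : forall j : nat, (1 <= j <= 4)%nat -> bounded_fun (Dphi2 j))
  (Hpsi1b : forall k : nat, (k <= 3)%nat -> bounded_fun (Dpsi1 k))
  (Hpsi2b : forall k : nat, (k <= 3)%nat -> bounded_fun (Dpsi2 k))
  (Hpsi0 : 0 < psi0)
  (Hpsi1low : forall x, Rabs (psi1 x) >= psi0) :
  exists lambda0 delta : R, 0 < lambda0 /\ 0 < delta /\
    forall lambda : R, Rabs lambda <= lambda0 ->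
      classical_solution c a Dc Da Dphi2 phi1 phi2 psi1 psi2 lambda delta.
Proof.
  pose proof Hc as [Ec Dc1]. pose proof Ha as [Ea Da1]. pose proof Hphi2 as [_ Dp].
  pose proof Hpsi1 as [Eps1 Dps1]. pose proof Hpsi2 as [_ Dps2].
  rewrite <- Ec in Hphi1.
  assert (Ha0' : forall z, Rabs (Da 0%nat z) >= m0) by (intros z; rewrite Ea; apply Ha0).
  assert (Hlow : forall x, Rabs (Dpsi1 0%nat x) >= psi0) by (intros x; rewrite Eps1; apply Hpsi1low).
  destruct (data_stable Dc Da Dphi2 Dpsi1 Dpsi2 phi1) as (A & HA1 & HA); try assumption.
  (* The bound psi0 / (4 A) makes 2 A t^2 at most half of psi0 t, so that u - phi1 is at least psi0
     t / 2 in size. *)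
  set (d0 := Rmin 1 (psi0 / (4 * A))).
  assert (Hp : 0 < psi0 / (4 * A)) by (apply Rdiv_lt_0_compat; lra).
  assert (Hd0 : 0 < d0 <= 1) by (split; [apply Rmin_glb_lt; lra|apply Rmin_l]).
  assert (Hd0A : 2 * A * d0 <= psi0 / 2).
  { replace (psi0 / 2) with (2 * A * (psi0 / (4 * A))) by (field; lra). apply Rmult_le_compat_l; [lra|apply Rmin_r]. }
  destruct (constants_exist Dc Da Dphi2 Dpsi1 Dpsi2 m0 psi0 phi1) with (A := A) (delta0 := d0)
    as (lam0 & delta & M & K & Kc & HC); try assumption.
  destruct free_ultra_exists as [U HU].
  exists lam0, delta. split; [apply HC|split; [apply HC|]]. intros lam Hlam.
  eapply (scheme_limit_solves Dc Da Dphi2 Dpsi1 Dpsi2 m0 psi0 phi1) with (A := A) (U := U); eassumption.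
Qed.
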